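(* Suppose $M$ is a smooth closed connected manifold that admits a free smooth $S^1$-action, $Y$ is a closed connected manifold and $\beta: Y \rightarrow Y$ is a finite order homeomorphism. Then there exists a minimal homeomorphism on $M \times Y$ that is homotopic to $\mathrm{id}_M \times \beta$.
   Context: A closed manifold is a compact manifold without boundary ($Y$ is only assumed to be a topological manifold). A homeomorphism $\varphi: X\to X$ of a compact metric space $X$ is minimal if whenever $F\subseteq X$ is a non-empty closed subset with $\varphi(F)=F$, then $F=X$. A homeomorphism $\beta$ has finite order if $\beta^n=\mathrm{id}$ for some integer $n\geq 1$. An $S^1$-action on $M$ is free if $\theta\cdot m=m$ for some $m\in M$ implies that $\theta$ is the identity element of $S^1$. *)

(* Defs.v *)
From HB Require Import structures.
From mathcomp Require Import all_boot all_order all_algebra.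
From mathcomp Require Import all_classical all_reals all_analysis.
From mathcomp Require Import ring lra.

Set Implicit Arguments.
Unset Strict Implicit.
Unset Printing Implicit Defensive.

Import Order.TTheory GRing.Theory Num.Theory.
Import numFieldNormedType.Exports.

Local Open Scope classical_set_scope.
Local Open Scope ring_scope.

Section SmoothMaps.
Context {R : realType}.

(* Only used for open U, where the values of f outside U are irrelevant. *)
Fixpoint Ck_on (k : nat) m n (U : set 'rV[R]_m) (f : 'rV[R]_m -> 'rV[R]_n) :=
  (forall x, U x -> {for x, continuous f}) /\
  if k is k'.+1 then
    forall v, (forall x, U x -> derivable f x v) /\ Ck_on k' U ('D_v f)
  else True.

Definition smooth_on m n (U : set 'rV[R]_m) (f : 'rV[R]_m -> 'rV[R]_n) :=
  forall k, Ck_on k U f.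

Lemma near_open m n (U : set 'rV[R]_m) (f g : 'rV[R]_m -> 'rV[R]_n) x :
  open U -> (forall x, U x -> f x = g x) -> U x -> \forall y \near x, f y = g y.
Proof.
by move=> oU fg Ux; apply: filterS (open_nbhs_nbhs (conj oU Ux)) => y /fg.
Qed.

Lemma continuous_near_eq m n (f g : 'rV[R]_m -> 'rV[R]_n) x :
  (\forall y \near x, f y = g y) ->
  {for x, continuous f} -> {for x, continuous g}.
Proof.
move=> fg cf; rewrite /prop_for /continuous_at -(nbhs_singleton fg).
exact: cvg_trans (@near_eq_cvg _ _ (nbhs x) _ f g fg) cf.
Qed.

Lemma Ck_on_eq k m n (U : set 'rV[R]_m) (f g : 'rV[R]_m -> 'rV[R]_n) :
  open U -> (forall x, U x -> f x = g x) -> Ck_on k U f -> Ck_on k U g.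
Proof.
move=> oU; elim: k f g => [|k IH] f g fg [cf Hf].
  split=> // x Ux; apply: continuous_near_eq (cf x Ux).
  exact: near_open oU fg Ux.
split=> [x Ux|v].
  apply: continuous_near_eq (cf x Ux).
  exact: near_open oU fg Ux.
have [dv Cv] := Hf v; split=> [x Ux|].
  by apply: near_eq_derivable (dv x Ux); exact: near_open oU fg Ux.
apply: IH Cv => x Ux.
by apply: near_eq_derive; exact: near_open oU fg Ux.
Qed.

Lemma cvg_row_mx (T : Type) (F : set_system T) {FF : Filter F} m1 m2
    (f : T -> 'rV[R]_m1) (g : T -> 'rV[R]_m2) (a : 'rV[R]_m1) (b : 'rV[R]_m2) :
  f @ F --> a -> g @ F --> b ->
  (fun x => row_mx (f x) (g x)) @ F --> row_mx a b.
Proof.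
move=> fa gb A [P nP PA].
have Hl : nbhs a [set u : 'rV[R]_m1 | forall i j, P i (lshift m2 j) (u i j)].
  exists (fun i j => P i (lshift m2 j)) => // i j.
  by have := nP i (lshift m2 j); rewrite row_mxEl.
have Hr : nbhs b [set u : 'rV[R]_m2 | forall i j, P i (rshift m1 j) (u i j)].
  exists (fun i j => P i (rshift m1 j)) => // i j.
  by have := nP i (rshift m1 j); rewrite row_mxEr.
have {}fa := fa _ Hl; have {}gb := gb _ Hr.
apply: (@filterS _ F _ _ _ _ (@filterI _ F _ _ _ fa gb)) => x [/= Hf Hg].
apply: PA => i j; rewrite mxE; case: splitP => k jk.
  by rewrite (_ : j = lshift m2 k)//; apply/val_inj.
by rewrite (_ : j = rshift m1 k)//; apply/val_inj.
Qed.

Lemma derive_row_mx (V : normedModType R) m1 m2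
    (f : V -> 'rV[R]_m1) (g : V -> 'rV[R]_m2) x v :
  derivable f x v -> derivable g x v ->
  derivable (fun y => row_mx (f y) (g y)) x v /\
  'D_v (fun y => row_mx (f y) (g y)) x = row_mx ('D_v f x) ('D_v g x).
Proof.
move=> df dg.
have H : (fun h => h^-1 *: (((fun y => row_mx (f y) (g y)) \o shift x) (h *: v)
     - row_mx (f x) (g x))) @ 0^' --> row_mx ('D_v f x) ('D_v g x).
  under eq_fun do rewrite /= opp_row_mx add_row_mx scale_row_mx.
  exact: cvg_row_mx.
by split; [apply/cvg_ex; eexists; exact: H|exact: cvg_lim].
Qed.

Lemma continuous_row_mx (V : topologicalType) m1 m2
    (f : V -> 'rV[R]_m1) (g : V -> 'rV[R]_m2) x :
  {for x, continuous f} -> {for x, continuous g} ->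
  {for x, continuous (fun y => row_mx (f y) (g y))}.
Proof. by move=> cf cg; exact: (@cvg_row_mx _ (nbhs x)). Qed.

Lemma Ck_on_row_mx k m n1 n2 (U : set 'rV[R]_m)
    (f : 'rV[R]_m -> 'rV[R]_n1) (g : 'rV[R]_m -> 'rV[R]_n2) :
  open U -> Ck_on k U f -> Ck_on k U g ->
  Ck_on k U (fun x => row_mx (f x) (g x)).
Proof.
move=> oU; elim: k f g => [|k IH] f g [cf Hf] [cg Hg].
  by split=> // x Ux; apply: continuous_row_mx; [exact: cf|exact: cg].
split=> [x Ux|v]; first by apply: continuous_row_mx; [exact: cf|exact: cg].
have [dfv Cfv] := Hf v; have [dgv Cgv] := Hg v; split=> [x Ux|].
  by have [] := derive_row_mx (dfv x Ux) (dgv x Ux).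
apply: Ck_on_eq (IH _ _ Cfv Cgv) => // x Ux.
by have [_ ->] := derive_row_mx (dfv x Ux) (dgv x Ux).
Qed.

Lemma Ck_on_linear k m1 m n (L : {linear 'rV[R]_m -> 'rV[R]_m1}) U V
    (f : 'rV[R]_m1 -> 'rV[R]_n) : continuous L -> (forall x, U x -> V (L x)) ->
  Ck_on k V f -> Ck_on k U (f \o L).
Proof.
move=> cL UV; elim: k f => [|k IH] f [cf Hf].
  by split=> // x Ux; apply: continuous_comp; [exact: cL|exact/cf/UV].
split=> [x Ux|v]; first by apply: continuous_comp; [exact: cL|exact/cf/UV].
have gr x : (fun h => h^-1 *: (((f \o L) \o shift x) (h *: v) - (f \o L) x)) =
    (fun h => h^-1 *: ((f \o shift (L x)) (h *: L v) - f (L x))).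
  by apply/funext => h; rewrite /= linearP.
have [df Cf] := Hf (L v); split=> [x Ux|].
  by rewrite /derivable gr; exact/df/UV.
rewrite (_ : 'D_v (f \o L) = 'D_(L v) f \o L); first exact: IH.
by apply/funext => x; rewrite /derive/= gr.
Qed.

Lemma const_mx_cvg (T : Type) (F : set_system T) {FF : Filter F} (f : T -> R)
    (a : R) m n :
  f @ F --> a -> (fun x => const_mx (f x) : 'M[R]_(m, n)) @ F -->
    (const_mx a : 'M[R]_(m, n)).
Proof.
move=> fa A [P nP PA].
have H : nbhs a [set u : R | forall i j, P i j u].
  apply: (@filter_forall _ _ _ (nbhs a)) => i.
  apply: (@filter_forall _ _ _ (nbhs a)) => j.
  by have := nP i j; rewrite mxE.
by apply: (@filterS _ F _ _ _ _ (fa _ H)) => x /= Px; apply: PA => i j; rewrite mxE.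
Qed.

Lemma Ck_on_cst k m n (U : set 'rV[R]_m) (a : 'rV[R]_n) : Ck_on k U (cst a).
Proof.
elim: k a => [|k IH] a; (split; first by move=> x _; exact: cst_continuous) => // v.
split=> [x _|]; first exact: derivable_cst.
by rewrite (_ : 'D_v _ = cst 0)//; apply/funext => x; exact: derive_cst.
Qed.

Lemma Ck_on_id k m (U : set 'rV[R]_m) : Ck_on k U id.
Proof.
case: k => [|k]; (split; first by move=> x _; exact: cvg_id) => // v.
split=> [x _|]; first exact: derivable_id.
rewrite (_ : 'D_v _ = cst v); first exact: Ck_on_cst.
by apply/funext => x; exact: derive_id.
Qed.

Lemma derive_const_mx (V : normedModType R) m n (f : V -> R) x v :
  derivable f x v ->
  derivable (fun y => const_mx (f y) : 'M[R]_(m, n)) x v /\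
  'D_v (fun y => const_mx (f y) : 'M[R]_(m, n)) x = const_mx ('D_v f x).
Proof.
move=> df.
have H : (fun h => h^-1 *: (((fun y => const_mx (f y) : 'M[R]_(m, n)) \o shift x)
    (h *: v) - const_mx (f x))) @ 0^' --> (const_mx ('D_v f x) : 'M[R]_(m, n)).
  rewrite (_ : (fun _ => _) = fun h =>
      const_mx (h^-1 *: ((f \o shift x) (h *: v) - f x))).
    exact: const_mx_cvg.
  by apply/funext => h; apply/matrixP => i j; rewrite !mxE.
by split; [apply/cvg_ex; eexists; exact: H|exact: cvg_lim].
Qed.

Lemma is_derive_coord (x v : 'rV[R]_1) :
  is_derive x v (fun y : 'rV[R]_1 => y 0 0) (v 0 0).
Proof.
have H : (fun h : R => h^-1 *: (((fun y : 'rV[R]_1 => y 0 0) \o shift x) (h *: v)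
    - x 0 0)) @ 0^' --> v 0 0.
  apply: cvg_near_cst; near=> h.
  have h0 : h != 0 by near: h; exact: nbhs_dnbhs_neq.
  by rewrite /= !mxE addrK /GRing.scale/= mulKf.
by apply: DeriveDef; [apply/cvg_ex; eexists; exact: H|exact: cvg_lim].
Unshelve. all: by end_near. Qed.

Lemma is_derive_invX (c : R) j (x v : 'rV[R]_1) : x 0 0 != 0 ->
  is_derive x v (fun y => c * (y 0 0)^-1 ^+ j)
    (- (j%:R * c * v 0 0) * (x 0 0)^-1 ^+ j.+1).
Proof.
move=> x0; have cx := is_derive_coord x v.
have dV : is_derive x v (fun y : 'rV[R]_1 => (y 0 0)^-1)
    (- (x 0 0) ^- 2 *: v 0 0).
  apply: DeriveDef; first exact: derivableV.
  by rewrite deriveV// derive_val.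
have H : is_derive x v (c *: (fun y : 'rV[R]_1 => (y 0 0)^-1) ^+ j) _ :=
  is_deriveZ c (is_deriveX j dV).
have -> : (fun y : 'rV[R]_1 => c * (y 0 0)^-1 ^+ j) =
    c *: (fun y : 'rV[R]_1 => (y 0 0)^-1) ^+ j.
  by apply/funext => y; rewrite /= fctE.
apply: is_derive_eq H _; rewrite /GRing.scale/= -exprVn.
by case: j => [|j]; rewrite ?exprS ?expr0; ring.
Qed.

Lemma Ck_on_inv k j (c : R) (U : set 'rV[R]_1) :
  open U -> (forall x, U x -> x 0 0 != 0) ->
  Ck_on k U (fun x => const_mx (c * (x 0 0)^-1 ^+ j) : 'rV[R]_1).
Proof.
move=> oU U0; have cts j' c' x : U x -> {for x, continuous (fun x : 'rV[R]_1 =>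
    const_mx (c' * (x 0 0)^-1 ^+ j') : 'rV[R]_1)}.
  move=> Ux; apply: (@const_mx_cvg _ (nbhs x)).
  have c0 : (fun v : 'rV[R]_1 => v 0 0) @ x --> x 0 0 by exact: coord_continuous.
  have c1 := cvgV (U0 x Ux) c0.
  have cm : (fun v : 'rV[R]_1 => (v 0 0)^-1 ^+ j') @ x --> (x 0 0)^-1 ^+ j'.
    exact: (@cvg_comp _ _ _ _ (fun y : R => y ^+ j') _ _ _ (c1 _)
      (@exprn_continuous _ j' _)).
  exact: (cvgM (cvg_cst c') cm).
elim: k c j => [|k IH] c j; (split; first exact: cts) => // v.
have D x : U x -> derivable (fun y : 'rV[R]_1 => c * (y 0 0)^-1 ^+ j) x v.
  by move=> /U0 x0; have [] := is_derive_invX c j v x0.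
split=> [x Ux|]; first by have [] := derive_const_mx 1 1 (D x Ux).
apply: Ck_on_eq (IH (- (j%:R * c * v 0 0)) j.+1) => // x Ux.
have [_ ->] := derive_const_mx 1 1 (D x Ux).
by have [_ ->] := is_derive_invX c j v (U0 x Ux).
Qed.

End SmoothMaps.

Section Manifolds.
Context {R : realType}.

(* The values of chart_map outside chart_dom, and of chart_inv outside
   chart_map @` chart_dom, are irrelevant. *)
Record chart (n : nat) (T : topologicalType) := Chart {
  chart_dom : set T;
  chart_map : T -> 'rV[R]_n;
  chart_inv : 'rV[R]_n -> T;
  chart_dom_open : open chart_dom;
  chart_cod_open : open (chart_map @` chart_dom);
  chart_map_continuous :
    forall x, chart_dom x -> {for x, continuous chart_map};
  chart_inv_continuous :
    forall v, (chart_map @` chart_dom) v -> {for v, continuous chart_inv};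
  chart_mapK : forall x, chart_dom x -> chart_inv (chart_map x) = x
}.

Arguments chart_dom_open {n T} c.
Arguments chart_cod_open {n T} c.

Definition topological_manifold (n : nat) (T : topologicalType) :=
  [/\ hausdorff_space T, @second_countable T
    & forall x : T, exists c : chart n T, chart_dom c x].

Record smooth_structure (n : nat) (T : topologicalType) := SmoothStructure {
  atlas : set (chart n T);
  atlas_cover : forall x : T, exists2 c, atlas c & chart_dom c x;
  atlas_compatible : forall c d, atlas c -> atlas d ->
    smooth_on (chart_map c @` (chart_dom c `&` chart_dom d))
              (chart_map d \o chart_inv c)
}.

Definition smooth_map m n (M N : topologicalType) (SM : smooth_structure m M)
    (SN : smooth_structure n N) (f : M -> N) :=
  continuous f /\
  forall c d, atlas SM c -> atlas SN d ->
    smooth_on (chart_map c @` (chart_dom c `&` f @^-1` chart_dom d))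
              (chart_map d \o f \o chart_inv c).

Definition closed_connected_manifold n (T : topologicalType) :=
  [/\ topological_manifold n T, compact [set: T] & connected [set: T]].

Lemma chart_image_open n (T : topologicalType) (c : chart n T) (A : set T) :
  open A -> open (chart_map c @` (chart_dom c `&` A)).
Proof.
move=> oA.
have -> : chart_map c @` (chart_dom c `&` A) =
    (chart_map c @` chart_dom c) `&` (chart_inv c @^-1` A).
  apply/seteqP; split=> [_ [x [cx Ax] <-]|_ [[x cx <-]]] /=.
    by split; [exists x|rewrite /= chart_mapK].
  by rewrite chart_mapK// => Ax; exists x.
rewrite openE => v [cv Av].
have h1 : nbhs v (chart_map c @` chart_dom c).
  exact: open_nbhs_nbhs (conj (chart_cod_open c) cv).
have h2 : nbhs v (chart_inv c @^-1` A).
  by apply: (chart_inv_continuous cv); exact: open_nbhs_nbhs (conj oA Av).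
exact: (@filterI _ (nbhs v) _ _ _ h1 h2).
Qed.

Section ProductStructure.
Context (m n : nat) (M N : topologicalType).

Section ProductChart.
Variables (c : chart m M) (d : chart n N).

Let pdom : set (M * N) := chart_dom c `*` chart_dom d.
Let pmap (p : M * N) := row_mx (chart_map c p.1) (chart_map d p.2).
Let pinv (v : 'rV[R]_(m + n)) := (chart_inv c (lsubmx v), chart_inv d (rsubmx v)).

Lemma prod_chart_image (A : set M) (B : set N) :
  pmap @` (A `*` B) =
  [set v | (chart_map c @` A) (lsubmx v) /\ (chart_map d @` B) (rsubmx v)].
Proof.
apply/seteqP; split=> [_ [[x y] [/= Ax By] <-]|v [[x Ax xv] [y By yv]]] /=.
  by rewrite /pmap row_mxKl row_mxKr; split; [exists x|exists y].
by exists (x, y) => //; rewrite /pmap/= xv yv hsubmxK.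
Qed.

Lemma prod_chart_dom_open : open pdom.
Proof.
rewrite openE => -[x y] [/= cx dy].
exists (chart_dom c, chart_dom d) => //; split.
- exact: open_nbhs_nbhs (conj (chart_dom_open c) cx).
- exact: open_nbhs_nbhs (conj (chart_dom_open d) dy).
Qed.

Lemma prod_chart_cod_open : open (pmap @` pdom).
Proof.
rewrite prod_chart_image; apply: openI.
- apply: (@open_comp _ _ (lsubmx : 'rV[R]_(m + n) -> _)) => [v _|].
    exact: continuous_lsubmx.
  exact: chart_cod_open.
- apply: (@open_comp _ _ (rsubmx : 'rV[R]_(m + n) -> _)) => [v _|].
    exact: continuous_rsubmx.
  exact: chart_cod_open.
Qed.

Lemma prod_chart_map_continuous x : pdom x -> {for x, continuous pmap}.
Proof.
case: x => x y [/= cx dy]; apply: continuous_row_mx.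
- apply: (@continuous_comp _ _ _ fst); first exact: cvg_fst.
  exact: chart_map_continuous.
- apply: (@continuous_comp _ _ _ snd); first exact: cvg_snd.
  exact: chart_map_continuous.
Qed.

Lemma prod_chart_inv_continuous v :
  (pmap @` pdom) v -> {for v, continuous pinv}.
Proof.
rewrite prod_chart_image => -[cv dv].
have cl : {for v, continuous (chart_inv c \o (@lsubmx R 1 m n))}.
  apply: continuous_comp; first exact: continuous_lsubmx.
  exact: chart_inv_continuous.
have cr : {for v, continuous (chart_inv d \o (@rsubmx R 1 m n))}.
  apply: continuous_comp; first exact: continuous_rsubmx.
  exact: chart_inv_continuous.
exact: (cvg_pair cl cr).
Qed.

Lemma prod_chart_mapK x : pdom x -> pinv (pmap x) = x.
Proof.
by case: x => x y [/= cx dy]; rewrite /pinv/= row_mxKl row_mxKr !chart_mapK.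
Qed.

Definition prod_chart : chart (m + n) (M * N)%type :=
  Chart prod_chart_dom_open prod_chart_cod_open prod_chart_map_continuous
    prod_chart_inv_continuous prod_chart_mapK.

End ProductChart.

Variables (SM : smooth_structure m M) (SN : smooth_structure n N).

Let patlas : set (chart (m + n) (M * N)%type) :=
  [set prod_chart p.1 p.2 | p in atlas SM `*` atlas SN].

Lemma prod_atlas_cover (x : M * N) : exists2 c, patlas c & chart_dom c x.
Proof.
have [c Mc cx] := atlas_cover SM x.1; have [d Nd dx] := atlas_cover SN x.2.
by exists (prod_chart c d) => //; exists (c, d).
Qed.

Lemma prod_atlas_compatible c d : patlas c -> patlas d ->
  smooth_on (chart_map c @` (chart_dom c `&` chart_dom d))
            (chart_map d \o chart_inv c).
Proof.
move=> [[c1 c2] [/= Mc1 Nc2] <-] [[d1 d2] [/= Md1 Nd2] <-] k /=.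
rewrite -setXI prod_chart_image.
have o1 : open (chart_map c1 @` (chart_dom c1 `&` chart_dom d1)).
  exact/chart_image_open/chart_dom_open.
have o2 : open (chart_map c2 @` (chart_dom c2 `&` chart_dom d2)).
  exact/chart_image_open/chart_dom_open.
apply: Ck_on_row_mx.
- apply: openI.
  + by apply: (@open_comp _ _ (lsubmx : 'rV[R]_(m + n) -> _)) => // v _;
      exact: continuous_lsubmx.
  + by apply: (@open_comp _ _ (rsubmx : 'rV[R]_(m + n) -> _)) => // v _;
      exact: continuous_rsubmx.
- apply: (@Ck_on_linear _ _ _ _ _ lsubmx _ _ _ _ _ (atlas_compatible Mc1 Md1 k)).
  + exact: continuous_lsubmx.
  + by move=> v [].
- apply: (@Ck_on_linear _ _ _ _ _ rsubmx _ _ _ _ _ (atlas_compatible Nc2 Nd2 k)).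
  + exact: continuous_rsubmx.
  + by move=> v [].
Qed.

Definition prod_smooth_structure : smooth_structure (m + n) (M * N)%type :=
  SmoothStructure prod_atlas_cover prod_atlas_compatible.

End ProductStructure.
End Manifolds.

Arguments chart R n T : clear implicits.
Arguments smooth_structure R n T : clear implicits.
Arguments topological_manifold R n T : clear implicits.
Arguments closed_connected_manifold R n T : clear implicits.

Section Circle.
Context {R : realType}.

Definition circle_set : set (R * R) := [set z | z.1 ^+ 2 + z.2 ^+ 2 = 1].
Definition circle : topologicalType := set_type circle_set.

Definition to_circle (z : R * R) (hz : circle_set z) : circle :=
  exist _ z (mem_set hz).

Lemma circleP (z : circle) : (sval z).1 ^+ 2 + (sval z).2 ^+ 2 = 1.
Proof. exact: (set_valP z). Qed.

Lemma circle_one_subproof : circle_set (1, 0).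
Proof. by rewrite /circle_set/= expr1n expr0n addr0. Qed.

Definition circle_one : circle := to_circle circle_one_subproof.

Lemma circle_mul_subproof (z w : circle) :
  circle_set ((sval z).1 * (sval w).1 - (sval z).2 * (sval w).2,
              (sval z).1 * (sval w).2 + (sval z).2 * (sval w).1).
Proof.
rewrite /circle_set/=; have := circleP z; have := circleP w.
move: (sval z) (sval w) => [a b] [c d] /= cd ab.
transitivity ((a ^+ 2 + b ^+ 2) * (c ^+ 2 + d ^+ 2)); first by ring.
by rewrite ab cd mulr1.
Qed.

(* Complex multiplication of z = z.1 + i z.2 and w = w.1 + i w.2. *)
Definition circle_mul (z w : circle) : circle :=
  to_circle (circle_mul_subproof z w).

Section Stereographic.
Variable s : bool.
Let e : R := (-1) ^+ s.

Let e2 : e * e = 1.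
Proof. by rewrite /e -expr2 sqrr_sign. Qed.

Definition stereo_dom : set circle := [set z | 1 - e * (sval z).1 != 0].

Definition stereo_map (z : circle) : 'rV[R]_1 :=
  const_mx ((sval z).2 / (1 - e * (sval z).1)).

Lemma stereo_inv_subproof (v : 'rV[R]_1) :
  circle_set (e * ((v 0 0 ^+ 2 - 1) / (v 0 0 ^+ 2 + 1)),
              2 * v 0 0 / (v 0 0 ^+ 2 + 1)).
Proof.
rewrite /circle_set/=; set t := v 0 0.
have t0 : t ^+ 2 + 1 != 0 by rewrite gt_eqF// ltr_wpDl// sqr_ge0.
rewrite exprMn [e ^+ 2]expr2 e2 mul1r; field.
by [].
Qed.

Definition stereo_inv (v : 'rV[R]_1) : circle :=
  to_circle (stereo_inv_subproof v).

Lemma stereo_invK v : stereo_dom (stereo_inv v) /\ stereo_map (stereo_inv v) = v.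
Proof.
have t0 : v 0 0 ^+ 2 + 1 != 0 by rewrite gt_eqF// ltr_wpDl// sqr_ge0.
have E : 1 - e * (e * ((v 0 0 ^+ 2 - 1) / (v 0 0 ^+ 2 + 1))) =
    2 / (v 0 0 ^+ 2 + 1).
  by rewrite mulrA e2 mul1r; field.
split; rewrite /stereo_dom /stereo_map/= E.
  by rewrite mulf_neq0// ?invr_eq0// pnatr_eq0.
by apply/rowP => i; rewrite mxE !ord1; field; rewrite t0.
Qed.

Lemma stereo_mapK z : stereo_dom z -> stereo_inv (stereo_map z) = z.
Proof.
rewrite /stereo_dom/= => h; apply/val_inj => /=; have := circleP z.
rewrite /stereo_map !mxE; move: (sval z) h => [x y] /= h xy.
have hx : y ^+ 2 = (1 - e * x) * (1 + e * x).
  transitivity (1 - (e * e) * x ^+ 2); last by ring.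
  by rewrite e2 mul1r -[X in X - _]xy; ring.
have E : (y / (1 - e * x)) ^+ 2 = (1 + e * x) / (1 - e * x).
  by rewrite expr_div_n hx; field.
have E1 : (y / (1 - e * x)) ^+ 2 + 1 = 2 / (1 - e * x) by rewrite E; field.
rewrite E1 E; congr pair.
  transitivity ((e * e) * x); first by field.
  by rewrite e2 mul1r.
by field.
Qed.

Lemma stereo_cod : stereo_map @` stereo_dom = setT.
Proof.
apply/seteqP; split=> // v _; have [? ?] := stereo_invK v.
by exists (stereo_inv v).
Qed.

Let val_cts : continuous (sval : circle -> R * R).
Proof. exact: (@initial_continuous circle (R * R)%type set_val). Qed.

Let fst_cts : continuous (fst : R * R -> R).
Proof. by case=> a b; exact: cvg_fst. Qed.

Let snd_cts : continuous (snd : R * R -> R).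
Proof. by case=> a b; exact: cvg_snd. Qed.

Let den_cts : continuous (fun z : circle => 1 - e * (sval z).1).
Proof.
move=> z.
have cx : (fun z : circle => (sval z).1) @ z --> (sval z).1.
  exact: (@cvg_comp _ _ _ _ fst _ _ _ (@val_cts z) (@fst_cts (sval z))).
exact: (cvgB (cvg_cst (1 : R)) (cvgM (cvg_cst e) cx)).
Qed.

Lemma stereo_dom_open : open stereo_dom.
Proof.
apply: (@open_comp _ _ (fun z : circle => 1 - e * (sval z).1) [set x | x != 0]).
  by move=> z _; exact: den_cts.
exact: open_neq.
Qed.

Lemma stereo_cod_open : open (stereo_map @` stereo_dom).
Proof. by rewrite stereo_cod; exact: openT. Qed.

Lemma stereo_map_continuous z : stereo_dom z -> {for z, continuous stereo_map}.
Proof.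
move=> hz; have cy : (fun z : circle => (sval z).2) @ z --> (sval z).2.
  exact: (@cvg_comp _ _ _ _ snd _ _ _ (@val_cts z) (@snd_cts (sval z))).
have H : (fun z : circle => (sval z).2 / (1 - e * (sval z).1)) @ z -->
    (sval z).2 / (1 - e * (sval z).1).
  exact: (cvgM cy (cvgV hz (@den_cts z))).
exact: (@const_mx_cvg _ _ (nbhs z) _ _ _ 1 1 H).
Qed.

Lemma stereo_inv_continuous v :
  (stereo_map @` stereo_dom) v -> {for v, continuous stereo_inv}.
Proof.
move=> _; move: v; apply: continuous_comp_initial => v.
have c0 : (fun v : 'rV[R]_1 => v 0 0) @ v --> v 0 0 by exact: coord_continuous.
have c1 : (fun v : 'rV[R]_1 => v 0 0 ^+ 2) @ v --> v 0 0 ^+ 2.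
  exact: (cvgM c0 c0).
have cd : (fun v : 'rV[R]_1 => (v 0 0 ^+ 2 + 1)^-1) @ v --> (v 0 0 ^+ 2 + 1)^-1.
  have t0 : v 0 0 ^+ 2 + 1 != 0 by rewrite gt_eqF// ltr_wpDl// sqr_ge0.
  exact: (cvgV t0 (cvgD c1 (cvg_cst (1 : R)))).
have ca : (fun v : 'rV[R]_1 => e * ((v 0 0 ^+ 2 - 1) / (v 0 0 ^+ 2 + 1))) @ v
    --> e * ((v 0 0 ^+ 2 - 1) / (v 0 0 ^+ 2 + 1)).
  exact: (cvgM (cvg_cst e) (cvgM (cvgB c1 (cvg_cst (1 : R))) cd)).
have cb : (fun v : 'rV[R]_1 => 2 * v 0 0 / (v 0 0 ^+ 2 + 1)) @ v
    --> 2 * v 0 0 / (v 0 0 ^+ 2 + 1).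
  exact: (cvgM (cvgM (cvg_cst (2 : R)) c0) cd).
exact: (cvg_pair ca cb).
Qed.

(* Stereographic projection from the pole (e, 0), e = (-1) ^+ s. *)
Definition stereo_chart : chart R 1 circle :=
  Chart stereo_dom_open stereo_cod_open stereo_map_continuous
    stereo_inv_continuous stereo_mapK.

End Stereographic.

Let circle_atlas : set (chart R 1 circle) := range stereo_chart.

Lemma circle_atlas_cover (z : circle) :
  exists2 c, circle_atlas c & chart_dom c z.
Proof.
have [h|h] := eqVneq (1 - (sval z).1) 0; last first.
  by exists (stereo_chart false); [exists false|rewrite /= /stereo_dom/= expr0 mul1r].
exists (stereo_chart true); first by exists true.
rewrite /= /stereo_dom/= expr1 mulN1r opprK.
have <- : 1 = (sval z).1 by apply/eqP; rewrite -subr_eq0 h.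
by rewrite (_ : 1 + 1 = 2%:R)// pnatr_eq0.
Qed.

Lemma circle_atlas_compatible c d : circle_atlas c -> circle_atlas d ->
  smooth_on (chart_map c @` (chart_dom c `&` chart_dom d))
            (chart_map d \o chart_inv c).
Proof.
move=> [s _ <-] [t _ <-] k.
have oU := @chart_image_open _ _ _ (stereo_chart s) _ (chart_dom_open (stereo_chart t)).
have [st|st] := eqVneq s t.
  apply: (Ck_on_eq oU _ (Ck_on_id k _)) => _ [z [/= hz _] <-].
  by rewrite -st stereo_mapK.
have U0 u : (chart_map (stereo_chart s) @`
    (chart_dom (stereo_chart s) `&` chart_dom (stereo_chart t))) u ->
  u 0 0 != 0 /\ const_mx (1 * (u 0 0)^-1 ^+ 1) =
    (chart_map (stereo_chart t) \o chart_inv (stereo_chart s)) u.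
  move=> [z [/= hz tz] <-] /=; rewrite stereo_mapK//.
  have := circleP z; move: hz tz; rewrite /stereo_dom /stereo_map/= mxE.
  have -> : (-1) ^+ t = - (-1) ^+ s :> R.
    by case: (s) (t) st => -[] //= _; rewrite ?expr0 ?expr1 ?opprK.
  have : (-1) ^+ s * (-1) ^+ s = 1 :> R by rewrite -expr2 sqrr_sign.
  move: ((-1) ^+ s) (sval z) => e [x y] /= e2 hs ht xy.
  have hx : y ^+ 2 = (1 - e * x) * (1 - - e * x).
    transitivity (1 - (e * e) * x ^+ 2); last by ring.
    by rewrite e2 mul1r -[X in X - _]xy; ring.
  have y0 : y != 0.
    by rewrite -sqrf_eq0 hx mulf_neq0.
  split; first by rewrite mulf_neq0// invr_eq0.
  apply/rowP => i; rewrite !mxE mul1r expr1 invfM invrK.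
  apply: (mulfI y0); rewrite mulrA mulfV// mul1r mulrA -expr2 hx.
  by field.
by apply: (Ck_on_eq oU _ (Ck_on_inv k 1 1 oU _)) => x /U0[].
Qed.

Definition circle_smooth_structure : smooth_structure R 1 circle :=
  SmoothStructure circle_atlas_cover circle_atlas_compatible.

End Circle.

Arguments circle R : clear implicits.
Arguments circle_smooth_structure R : clear implicits.

Definition smooth_circle_action (R : realType) n (M : topologicalType)
    (SM : smooth_structure R n M) (act : circle R -> M -> M) :=
  [/\ forall x, act circle_one x = x,
      forall z w x, act (circle_mul z w) x = act z (act w x)
    & smooth_map (prod_smooth_structure (circle_smooth_structure R) SM) SM
        (fun p : circle R * M => act p.1 p.2)].

Definition free_circle_action (R : realType) (M : Type)
    (act : circle R -> M -> M) :=
  forall z x, act z x = x -> z = circle_one.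

Definition homeomorphism (X Y : topologicalType) (f : X -> Y) :=
  continuous f /\ exists g : Y -> X, [/\ continuous g, cancel f g & cancel g f].

Definition finite_order (X : Type) (f : X -> X) :=
  exists2 n : nat, (0 < n)%N & forall x, iter n f x = x.

Definition minimal (X : topologicalType) (f : X -> X) :=
  forall F : set X, closed F -> F !=set0 -> f @` F = F -> F = setT.

Definition homotopic (R : realType) (X Y : topologicalType) (f g : X -> Y) :=
  exists H : R * X -> Y,
    [/\ {within `[0, 1] `*` [set: X], continuous H},
        forall x, H (0, x) = f x
      & forall x, H (1, x) = g x].

(* Main.v *)
Require Import Defs.
From mathcomp Require Import all_boot all_order all_algebra.
From mathcomp Require Import all_classical all_reals all_analysis.
From mathcomp Require Import ring lra.

Set Implicit Arguments.
Unset Strict Implicit.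
Unset Printing Implicit Defensive.

Import Order.TTheory GRing.Theory Num.Theory.
Import numFieldNormedType.Exports.

Local Open Scope classical_set_scope.
Local Open Scope ring_scope.

(* Anosov-Katok construction.  Let k be the order of beta.  The map is a uniform
   limit of conjugates f_n = g_n A_n g_n^-1 on M x Y, where A_n is the product of
   the rotation by a rational angle t_n and of beta.  The denominator of t_n is a
   multiple of k, so that A_n generates a free finite group.  Given an open set V,
   one finds h commuting with A_n such that every circle orbit meets
   h^-1 (g_n^-1 V) up to A_n; with g_{n+1} = g_n h and t_{n+1} = t_n + small of
   much larger denominator, f_{n+1} is close to f_n (because h commutes with A_n)
   and all its orbits visit V.  Letting V run through a countable basis makes the
   limit minimal.  Since f_{n+1} = S_n(tau_n) f_n for a flow S_n whose time-tau_n
   segment is uniformly small, the homotopy from id x beta converges together with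
   the maps, and no local contractibility of Y is needed.

   To find h, cut M into flat codimension-one slices meeting each circle orbit at
   most once, tile slices x Y by small boxes, and rotate the tiles to distinct
   heights: this gives finitely many disjoint boxes that together meet every
   orbit.  Disjoint boxes can be squeezed to points and pushed into any open set
   by homeomorphisms commuting with A_n. *)

(** * Engulfing by homeomorphisms commuting with a periodic map *)

(** As Y is only a topological manifold, the conjugacies have to be assembled from homeomorphisms
    supported in charts. Such a homeomorphism commutes with A_n once it is repeated along the
    A_n-translates of its support, provided these are disjoint. This is why A_n must generate a free
    action; with a denominator that is not a multiple of k, a power of A_n could fix points without
    being the identity.

    What gets engulfed is a transversal of the circle orbits, because whole orbits in general cannot
    be pushed into a small open set. Slices of codimension one leave room for this: a slice rotated
    to a given height meets each orbit at most once, so finitely many tiles forbid only finitely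
    many heights and a new tile can always be placed.

    A transversal suffices for the following reason. If q is the period of A_n, the q-th power of
    the next rotation is the identity on Y and advances by a tiny step along the circle orbits. A
    set that meets every circle orbit, up to A_n, is therefore met by every orbit of the next map,
    within one period. Such bounded visits survive all later perturbations once these are small
    enough. *)

Lemma compact_induction (X : topologicalType) (K : set X) (P : set X -> Prop) :
  compact K -> P set0 -> (forall A B, P A -> P B -> P (A `|` B)) ->
  (forall A B, A `<=` B -> P B -> P A) ->
  (forall x, K x -> exists2 U, nbhs x U & P U) -> P K.
Proof.
move=> /compact_near_coveringP cK P0 PU PS locP.
(* Near [F] means for all sets containing some [U] with [P U]; compactness in near-covering form
   then yields one such [U] that contains all of [K]. *)
pose F : set_system (set X) := [set S | exists2 U, P U & forall W, U `<=` W -> S W].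
have FF : Filter F.
  split; first by exists set0.
  - move=> S T [U PU1 US] [V PV1 VT]; exists (U `|` V); first exact: PU.
    by move=> W UVW; split; [apply: US|apply: VT] => x Hx; apply: UVW; [left|right].
  - by move=> S T ST [U PU1 US]; exists U => // W /US /ST.
have [x Kx|U PU1 UK] := cK _ F (fun W x => W x) FF.
  have [U nU PU1] := locP x Kx.
  by exists (U, [set W | U `<=` W]) => /=; [split=> //; exists U|move=> [y W] /= [Uy]; apply].
by apply: PS PU1; apply: UK.
Qed.

Lemma compact_separation (X : topologicalType) (K L : set X) :
  hausdorff_space X -> compact [set: X] -> closed K -> closed L -> K `&` L = set0 ->
  exists U, [/\ open U, K `<=` U & exists V, [/\ open V, L `<=` V & U `&` V = set0]].
Proof.
move=> hX cX cK cL KL0.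
have nL : set_nbhs K (~` L).
  by move=> x Kx; apply: open_nbhs_nbhs; split;
    [exact: closed_openC|move=> Lx; suff: set0 x by []; rewrite -KL0].
have [U nU UL] := compact_normal hX cX cK nL.
have /set_nbhsP[U' [oU' KU' U'U]] := nU.
exists U'; split=> //; exists (~` closure U); split.
- exact/closed_openC/closed_closure.
- by move=> x Lx /UL.
- by rewrite -subset0 => x [/U'U /subset_closure].
Qed.

Section Homeo.
Implicit Types X Y Z : topologicalType.

Lemma homeo_id X : homeomorphism (@id X).
Proof. by split; [move=> x; exact: cvg_id|exists id; split=> // x; exact: cvg_id]. Qed.

Lemma continuous_comp_all X Y Z (f : X -> Y) (g : Y -> Z) :
  continuous f -> continuous g -> continuous (g \o f).
Proof. by move=> cf cg x; apply: continuous_comp; [exact: cf|exact: cg]. Qed.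

Lemma homeo_comp X Y Z (f : X -> Y) (g : Y -> Z) :
  homeomorphism f -> homeomorphism g -> homeomorphism (g \o f).
Proof.
move=> [cf [f' [cf' fK f'K]]] [cg [g' [cg' gK g'K]]]; split.
  exact: continuous_comp_all.
exists (f' \o g'); split; first exact: continuous_comp_all.
  by move=> x /=; rewrite gK fK.
by move=> x /=; rewrite f'K g'K.
Qed.

Lemma homeo_inv X Y (f : X -> Y) : homeomorphism f ->
  exists g, [/\ homeomorphism g, cancel f g & cancel g f].
Proof.
by move=> [cf [g [cg fK gK]]]; exists g; split=> //; split=> //; exists f.
Qed.

Lemma homeo_iter X (f : X -> X) i : homeomorphism f -> homeomorphism (iter i f).
Proof.
move=> hf; elim: i => [|i IH]; first exact: homeo_id.
exact: (homeo_comp IH hf).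
Qed.

Lemma can_iter (T : Type) (f g : T -> T) i : cancel f g -> cancel (iter i f) (iter i g).
Proof. by move=> fK; elim: i => // i IH x; rewrite iterSr /= fK IH. Qed.

Lemma iter_comm (T : Type) (A h : T -> T) i x :
  (forall y, h (A y) = A (h y)) -> h (iter i A x) = iter i A (h x).
Proof. by move=> hA; elim: i => //= i IH; rewrite hA IH. Qed.

End Homeo.

(** * Equivariant extension of locally supported homeomorphisms *)

Section Periodic.
Context (T : topologicalType) (A : T -> T) (q : nat).
Hypothesis A_homeo : homeomorphism A.
Hypothesis Aq : forall x, iter q A x = x.
Hypothesis q_gt0 : (0 < q)%N.

Lemma iter_modn i x : iter (i %% q) A x = iter i A x.
Proof.
rewrite {2}(divn_eq i q) addnC iterD.
have -> : iter (i %/ q * q) A x = x; last by [].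
by elim: (i %/ q)%N => [|n IH] //; rewrite mulSn iterD IH Aq.
Qed.

Lemma iter_invariant (V : set T) i x : (forall x, V (A x) <-> V x) ->
  V (iter i A x) <-> V x.
Proof. by move=> VA; elim: i => //= i IH; rewrite VA. Qed.

(** Pushes made in a chart do not commute with [A]; copying them to the disjoint translates of [O]
    repairs this and leaves them unchanged on [O]. *)
Lemma equivariant_extension (O : set T) (a : T -> T) :
  (forall i x, (0 < i < q)%N -> O x -> ~ O (iter i A x)) ->
  homeomorphism a -> (forall x, ~ O x -> a x = x) ->
  exists a', [/\ homeomorphism a', forall x, a' (A x) = A (a' x),
    forall x, O x -> a' x = a x
    & forall x, (forall i, ~ O (iter i A x)) -> a' x = x].
Proof.
move=> disj ha aid.
have [B [hB AK BK]] := homeo_inv A_homeo.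
have aO x : O x -> O (a x).
  have [a1 [_ aK _]] := homeo_inv ha.
  move=> Ox; apply: contrapT => nO; have ax := can_inj aK (aid _ nO).
  by apply: nO; rewrite ax.
(* The conjugates of a have disjoint supports; a' is their product. *)
pose al i := iter i B \o a \o iter i A.
pose Oi i := [set x | O (iter i A x)].
have Oal i x : Oi i x -> Oi i (al i x).
  by move=> Ox; rewrite /Oi /al /= (can_iter _ BK); exact: aO.
have alid i x : ~ Oi i x -> al i x = x.
  by move=> nO; rewrite /al /= aid// (can_iter _ AK).
have Odisj i j x : (i < q)%N -> (j < q)%N -> Oi i x -> Oi j x -> i = j.
  wlog ij : i j / (i <= j)%N.
    move=> W iq jq Hi Hj; have /orP[ij|ij] := leq_total i j; first exact: W.
    by apply/esym; exact: W.
  move=> iq jq Hi Hj; apply/eqP; rewrite eqn_leq ij /= leqNgt; apply/negP => ltij.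
  apply: (disj (j - i)%N _ _ Hi).
    by rewrite subn_gt0 ltij/= (leq_ltn_trans (leq_subr _ _)).
  by rewrite -iterD subnK.
pose fl s := foldr (fun i f => al i \o f) id s.
have hfl s : homeomorphism (fl s).
  elim: s => [|i s IH]; first exact: homeo_id.
  apply: homeo_comp IH _; apply: homeo_comp; first exact: homeo_iter.
  by apply: homeo_comp => //; exact: homeo_iter.
have flout s x : (forall i, i \in s -> ~ Oi i x) -> fl s x = x.
  elim: s => //= i s IH H; rewrite IH.
    by apply: alid; apply: H; rewrite mem_head.
  by move=> j js; apply: H; rewrite inE js orbT.
have flin s x i : {subset s <= iota 0 q} -> uniq s -> i \in s -> Oi i x -> fl s x = al i x.
  elim: s => //= j s IH sq /andP[js us]; rewrite inE => /orP[/eqP -> Ox|si Ox].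
    rewrite flout// => k ks Okx.
    have kq : (k < q)%N by have := sq k; rewrite inE ks orbT mem_iota => /(_ isT) /andP[].
    have jq : (j < q)%N by have := sq j; rewrite inE eqxx mem_iota => /(_ isT) /andP[].
    by move: js; rewrite (Odisj _ _ _ jq kq Ox Okx) ks.
  have kq k : k \in j :: s -> (k < q)%N by move=> /sq; rewrite mem_iota => /andP[].
  rewrite (IH _ us si Ox); last by move=> k ks; apply: sq; rewrite inE ks orbT.
  apply: alid => Oj; move: js; rewrite (Odisj j i (al i x)) ?si//.
  - exact/kq/mem_head.
  - by apply: kq; rewrite inE si orbT.
  - exact: Oal.
have inq i : (i \in iota 0 q) = (i < q)%N by rewrite mem_iota.
pose a' := fl (iota 0 q).
have a'in i x : (i < q)%N -> Oi i x -> a' x = al i x.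
  by move=> iq; apply: flin => //; [exact: iota_uniq|rewrite inq].
exists a'; split.
- exact: hfl.
- move=> x; have [[i iq Ox]|nO] := pselect (exists2 i, (i < q)%N & Oi i x).
    (* [A] carries [Oi i] to [Oi i.-1]; for [i = 0] the index wraps around to [q.-1], where
       [A^q = id] closes the cycle. *)
    rewrite (a'in i x)//; case: i iq Ox => [|i] iq Ox.
      rewrite (a'in q.-1); first last.
      - by rewrite /Oi /= -iterSr prednK// Aq.
      - by rewrite prednK.
      rewrite /al /= -iterSr prednK// Aq.
      have -> : iter q.-1 B (a x) = A (iter q B (a x)) by rewrite -{2}(prednK q_gt0) /= BK.
      by rewrite -{1}(Aq (a x)) (can_iter _ AK).
    rewrite (a'in i); first last.
    - by rewrite /Oi /= -iterSr.
    - exact: ltnW.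
    by rewrite /al /= -iterSr /= BK.
  have a'x : a' x = x.
    by apply: flout => i; rewrite inq => iq Ox; apply: nO; exists i.
  rewrite a'x; apply: flout => i; rewrite inq => iq; rewrite /Oi /= -iterSr -iter_modn => Ox.
  by apply: nO; exists (i.+1 %% q)%N => //; rewrite ltn_mod.
- by move=> x Ox; rewrite (a'in 0%N).
- by move=> x H; apply: flout => i _; exact: H.
Qed.

(** Targets are [A]-invariant, so that a map commuting with [A] and sending [C] into [V] sends all
    translates of [C] there too; adding a further box relies on this. *)
Definition engulfable (C : set T) := forall V, open V -> V !=set0 ->
  (forall x, V (A x) <-> V x) ->
  exists h, [/\ homeomorphism h, forall x, h (A x) = A (h x)
    & forall x, C x -> V (h x)].

End Periodic.

(** A variant of Brown's cellular sets: ambient homeomorphisms supported arbitrarily close to [X]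
    crush it towards the chosen point [d]. *)
Definition cellular (T : topologicalType) (X : set T) (d : T) :=
  X d /\ forall O, open O -> X `<=` O -> forall W, open W -> W d ->
  exists a, [/\ homeomorphism a, forall x, ~ O x -> a x = x
    & forall x, X x -> W (a x)].

(** A local homogeneity condition: crushing [X] towards [z'] drags [z] as close to [z'] as desired,
    with nothing moved outside [O]. *)
Definition locally_cellular (T : topologicalType) := forall (z : T) O, open O -> O z ->
  exists B, [/\ open B, B z & forall z', B z' ->
    exists X, [/\ cellular X z', X z & X `<=` O]].

Lemma cellular_homeo (T : topologicalType) (X : set T) d (f : T -> T) :
  homeomorphism f -> cellular X d -> cellular (f @` X) (f d).
Proof.
move=> hf [Xd cell]; split; first by exists d.
have [g [[cg _] fK gK]] := homeo_inv hf; have cf := hf.1.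
move=> O oO XO W oW Wd.
have [||||a [ha aid aW]] := cell (f @^-1` O) _ _ (f @^-1` W) => //.
- by apply: open_comp oO => ? _; exact: cf.
- by move=> x Xx; apply: XO; exists x.
- by apply: open_comp oW => ? _; exact: cf.
exists (f \o a \o g); split.
- have hg : homeomorphism g by split=> //; exists f; split.
  by apply: homeo_comp => //; exact: homeo_comp.
- by move=> x nO /=; rewrite aid ?gK//= gK.
- by move=> _ [x Xx <-] /=; rewrite fK; exact: aW.
Qed.

Section Engulfing.
Context (T : topologicalType) (A : T -> T) (q : nat).
Hypothesis T_hausdorff : hausdorff_space T.
Hypothesis T_compact : compact [set: T].
Hypothesis T_connected : connected [set: T].
Hypothesis T_cell : locally_cellular T.
Hypothesis A_homeo : homeomorphism A.
Hypothesis q_gt0 : (0 < q)%N.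
Hypothesis Aq : forall x, iter q A x = x.
Hypothesis A_free : forall i x, (0 < i < q)%N -> iter i A x <> x.

Let iter_cts i : continuous (iter i A).
Proof. by have [] := homeo_iter i A_homeo. Qed.

Lemma open_forall_ord m (O : nat -> set T) : (forall i, open (O i)) ->
  open [set x | forall i, (i < m)%N -> O i x].
Proof.
move=> oO; elim: m => [|m IH].
  by rewrite (_ : [set _ | _] = setT); [exact: openT|apply/seteqP; split].
rewrite (_ : [set _ | _] = [set x | forall i, (i < m)%N -> O i x] `&` O m).
  exact: openI.
apply/seteqP; split=> [x H|x [H Om] i].
  by split; [move=> i im; apply: H; exact: ltnW|exact: H].
by rewrite ltnS leq_eqVlt => /orP[/eqP ->|/H].
Qed.

Definition saturation (C : set T) : set T := [set x | exists i, C (iter i A x)].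

Lemma saturationA C x : saturation C (A x) <-> saturation C x.
Proof.
split=> [[i]|[i]]; first by rewrite -iterSr; exists i.+1.
move=> Ci; exists (i + q.-1)%N; rewrite -iterSr -addnS prednK// iterD.
by rewrite Aq.
Qed.

Lemma saturation_sub C : C `<=` saturation C.
Proof. by move=> x Cx; exists 0%N. Qed.

Lemma saturation_open V : open V -> open (saturation V).
Proof.
move=> oV; rewrite (_ : saturation V = \bigcup_i (iter i A @^-1` V)).
  by apply: bigcup_open => i _; apply: open_comp oV => ? _; exact: iter_cts.
by apply/seteqP; split=> [x [i Ci]|x [i _ Ci]]; exists i.
Qed.

(** By periodicity finitely many iterates suffice, so the union of the closed preimages stays
    closed. *)
Lemma saturation_closed C : closed C -> closed (saturation C).
Proof.
move=> cC; rewrite -openC.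
rewrite (_ : ~` _ = [set x | forall i, (i < q)%N -> (~` (iter i A @^-1` C)) x]).
  apply: open_forall_ord => i; rewrite openC.
  by apply: preimage_closed cC => ? _; exact: iter_cts.
apply/seteqP; split=> x H; first by move=> i _ Ci; apply: H; exists i.
by move=> [i]; rewrite -(iter_modn Aq); apply: H; rewrite ltn_mod.
Qed.

(** For each [i], normality separates [X] from its preimage under the [i]-th iterate by [U] and [V];
    a point of [U] whose image under the inverse iterate lies in [V] cannot come back to the set of
    such points after [i] steps. Only finitely many [i] have to be intersected. *)
Lemma free_nbhd (X C : set T) : closed X -> closed C ->
  (forall i x, (0 < i < q)%N -> X x -> ~ X (iter i A x)) ->
  (forall x, X x -> ~ saturation C x) ->
  exists O, [/\ open O, X `<=` O, forall x, O x -> ~ saturation C x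
    & forall i x, (0 < i < q)%N -> O x -> ~ O (iter i A x)].
Proof.
move=> cX cC XX XC.
have sep i : exists O, [/\ open O, X `<=` O
    & (0 < i < q)%N -> forall x, O x -> ~ O (iter i A x)].
  have [iq|] := boolP (0 < i < q)%N; last by exists setT; split=> //; exact: openT.
  have cXi : closed (iter i A @^-1` X).
    by apply: preimage_closed cX => ? _; exact: iter_cts.
  have XXi : X `&` (iter i A @^-1` X) = set0.
    by rewrite -subset0 => x [Xx]; exact: XX.
  have [U [oU XU [V [oV XV UV]]]] :=
    compact_separation T_hausdorff T_compact cX cXi XXi.
  have [B [hB AK BK]] := homeo_inv (homeo_iter i A_homeo).
  exists (U `&` (B @^-1` V)); split.
  - by apply: openI => //; apply: open_comp oV => ? _; exact: hB.1.
  - by move=> x Xx; split; [exact: XU|apply: XV; rewrite /= BK].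
  - move=> _ x [Ux _] [_]; rewrite /= AK => Vx.
    by suff: set0 x by []; rewrite -UV.
pose O i := projT1 (cid (sep i)).
have OP i : [/\ open (O i), X `<=` O i
    & (0 < i < q)%N -> forall x, O i x -> ~ O i (iter i A x)] := projT2 (cid (sep i)).
exists ([set x | forall i, (i < q)%N -> O i x] `&` ~` saturation C); split.
- apply: openI; first by apply: open_forall_ord => i; have [] := OP i.
  by rewrite openC; exact: saturation_closed.
- by move=> x Xx; split; [move=> i _; have [_ + _] := OP i; apply|exact: XC].
- by move=> x [].
- move=> i x iq [Ox _] [Ox' _]; have [_ _ H] := OP i.
  by apply: (H iq x); [apply: Ox|apply: Ox']; case/andP: iq.
Qed.

Lemma engulfable0 : engulfable A set0.
Proof. by move=> V _ _ _; exists id; split=> //; exact: homeo_id. Qed.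

(** The new map is [g \o h \o a']: [a'] shrinks [X] towards [d] away from the translates of [C], [h]
    sends [C] into [V], and [g] brings [h d] into [V] while fixing what [h] has placed there.
    Shrinking reduces engulfing a cell to moving one point. *)
Lemma engulfableU (C X : set T) d : closed C -> engulfable A C ->
  cellular X d -> closed X ->
  (forall i x, (0 < i < q)%N -> X x -> ~ X (iter i A x)) ->
  (forall x, X x -> ~ saturation C x) ->
  engulfable A (C `|` X).
Proof.
move=> cC eC [Xd cellX] cX XX XC V oV V0 VA.
have [h [hh hA hC]] := eC V oV V0 VA.
have [h' [hh' hK h'K]] := homeo_inv hh.
pose hCA := [set x | saturation C (h' x)].
have hCAsub : hCA `<=` V.
  move=> x [i]; rewrite -[x in V x]h'K => /hC.
  by rewrite (iter_comm i _ hA) iter_invariant.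
have hCAclosed : closed hCA.
  by apply: preimage_closed (saturation_closed cC) => ? _; exact: hh'.1.
have hCAA x : hCA (A x) <-> hCA x.
  rewrite /hCA /= -{1}[x]h'K -hA hK; exact: saturationA.
(* Pushing one more point into V while fixing h(C), which already lies in V:
   the points for which this is possible form a clopen set, because a point
   outside V has a neighbourhood disjoint from h(C). *)
pose Z := [set z | exists g, [/\ homeomorphism g, forall x, g (A x) = A (g x),
  forall x, hCA x -> g x = x & V (g z)]].
have oZ : open Z.
  rewrite (_ : Z = \bigcup_(g in [set g | [/\ homeomorphism g,
      forall x, g (A x) = A (g x) & forall x, hCA x -> g x = x]]) (g @^-1` V)).
    by apply: bigcup_open => g [hg _ _]; apply: open_comp oV => ? _; exact: hg.1.
  by apply/seteqP; split=> [z [g [? ? ? ?]]|z [g [? ? ?] ?]]; exists g.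
have cZ : closed Z.
  rewrite -openC openE => z nZ.
  (* On the orbits of [hCA], which lie in [V], the identity is a witness for [Z]; a point outside
     [Z] is thus off this closed set and can be moved nearby without disturbing it. *)
  have zh : ~ saturation hCA z.
    move=> [i]; rewrite iter_invariant// => Hz; apply: nZ.
    by exists id; split=> //; [exact: homeo_id|exact: hCAsub].
  have [|||O [oO Oz OC OO]] := @free_nbhd [set z] hCA _ hCAclosed.
  - by apply: compact_closed => //; exact: compact_set1.
  - by move=> i x iq -> /=; exact: A_free.
  - by move=> x ->.
  have [B [oB Bz HB]] := T_cell oO (Oz z erefl).
  apply: (@filterS _ (nbhs z) _ B); last exact: open_nbhs_nbhs.
  move=> z' Bz' Zz'; apply: nZ.
  (* If a nearby [z'] were in [Z], crushing [Y] into the open set [Z] around [z'] would carry [z]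
     into [Z], and from there into [V]. *)
  have [Y [[Yz' cellY] Yz YO]] := HB z' Bz'.
  have [a [ha aid aZ]] := cellY O oO YO Z oZ Zz'.
  have [a' [ha' a'A a'O a'out]] := equivariant_extension A_homeo Aq q_gt0 OO ha aid.
  have [g [hg gA gC gV]] := aZ z Yz.
  exists (g \o a'); split=> /=.
  - exact: homeo_comp.
  - by move=> x; rewrite a'A gA.
  - move=> x Cx; rewrite a'out ?gC// => i /OC; apply.
    by exists 0%N => /=; rewrite iter_invariant.
  - by rewrite a'O//; exact: YO.
have ZT : Z = setT.
  apply: T_connected.
  - have [v Vv] := V0; exists v; exists id; split=> //; exact: homeo_id.
  - by exists Z => //; rewrite setTI.
  - by exists Z => //; rewrite setTI.
have [g [hg gA gC gV]] : Z (h d) by rewrite ZT.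
have [N1 [oO XO OC OO]] := free_nbhd cX cC XX XC.
have ogV : open ((g \o h) @^-1` V).
  by apply: open_comp oV => ? _; apply: continuous_comp; [exact: hh.1|exact: hg.1].
have [a [ha aid aW]] := cellX N1 oO XO _ ogV gV.
have [a' [ha' a'A a'O a'out]] := equivariant_extension A_homeo Aq q_gt0 OO ha aid.
exists (g \o h \o a'); split.
- by apply: homeo_comp => //; exact: homeo_comp.
- by move=> x /=; rewrite a'A hA gA.
- move=> x [Cx|Xx] /=; last by rewrite a'O; [exact: aW|exact: XO].
  rewrite a'out; first by rewrite gC; [exact: hC|rewrite /hCA /= hK; exact: saturation_sub].
  by move=> i /OC; apply; rewrite iter_invariant; [exact: saturation_sub|exact: saturationA].
Qed.

End Engulfing.
(** * Boxes in charts *)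

Lemma glue_continuous (X Z : topologicalType) (P K : set X) (f g : X -> Z) :
  open P -> closed K -> K `<=` P ->
  (forall x, P x -> {for x, continuous f}) ->
  (forall x, ~ K x -> {for x, continuous g}) ->
  (forall x, P x -> ~ K x -> f x = g x) -> continuous (patch g P f).
Proof.
move=> oP cK KP cf cg fg x.
have near_eq_cts (h : X -> Z) : {for x, continuous h} ->
    (\forall y \near x, h y = patch g P f y) -> {for x, continuous (patch g P f)}.
  move=> ch e; rewrite /prop_for /continuous_at -(nbhs_singleton e).
  exact: cvg_trans (@near_eq_cvg _ _ (nbhs x) _ h _ e) ch.
have [Kx|nKx] := pselect (K x).
  apply: near_eq_cts (cf x (KP x Kx)) _.
  apply: filterS (open_nbhs_nbhs (conj oP (KP x Kx))) => y Py.
  by rewrite patchT// inE.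
apply: near_eq_cts (cg x nKx) _.
have oK : open (~` K) by rewrite openC.
apply: filterS (open_nbhs_nbhs (conj oK nKx)) => y nKy.
rewrite /patch; case: ifPn => //; rewrite inE => Py.
exact/esym/fg.
Qed.

Section RowVectors.
Context {R : realType}.

Lemma mx_cvg (T : Type) (F : set_system T) {FF : Filter F} m n
    (f : T -> 'M[R]_(m, n)) (a : 'M[R]_(m, n)) :
  (forall i j, (fun x => f x i j) @ F --> a i j) -> f @ F --> a.
Proof.
move=> fa A [P nP PA].
have H : F [set x | forall i j, P i j (f x i j)].
  apply: filter_forall => i; apply: filter_forall => j.
  exact: (fa i j _ (nP i j)).
by apply: (@filterS _ F _ _ _ _ H) => x /= Px; exact: PA.
Qed.

Lemma row_norm_le n (u : 'rV[R]_n) (r : R) : 0 <= r ->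
  `|u| <= r <-> forall j, `|u 0 j| <= r.
Proof.
move=> r0; rewrite {1}/Num.norm/= mx_normrE; split=> [/bigmax_leP[_ H] j|H].
  exact: (H (0, j)).
by apply/bigmax_leP; split=> // -[i j] _ /=; rewrite ord1.
Qed.

Lemma coord_norm_le n (u : 'rV[R]_n) j : `|u 0 j| <= `|u|.
Proof. by have /row_norm_le : `|u| <= `|u| by []; apply. Qed.

Definition box n (e rho : 'rV[R]_n) : set 'rV[R]_n :=
  [set u | forall j, `|u 0 j - e 0 j| <= rho 0 j].

Lemma box_compact n (e rho : 'rV[R]_n) : compact (box e rho).
Proof.
have := @rV_compact R n (fun j => `[e 0 j - rho 0 j, e 0 j + rho 0 j]%classic)
  (fun j => @segment_compact _ _ _).
congr compact; apply/seteqP.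
by split=> u H j; have := H j; rewrite /= in_itv/= ler_distl.
Qed.

Lemma box_center n (e rho : 'rV[R]_n) : (forall j, 0 <= rho 0 j) -> box e rho e.
Proof. by move=> H j; rewrite subrr normr0. Qed.

(** Compactness gives one radius [d] valid at every point of the box; a point of the box thickened
    by [d / 2] is within [d / 2] of its coordinatewise truncation [w] to the original box. *)
Lemma box_thicken n (e rho : 'rV[R]_n) (O : set 'rV[R]_n) :
  (forall j, 0 <= rho 0 j) -> open O -> box e rho `<=` O ->
  exists2 d, 0 < d & box e (rho + const_mx d) `<=` O.
Proof.
move=> rho0 oO XO.
have /compact_near_coveringP cvr := @box_compact n e rho.
have H : \forall d \near (0 : R)^'+, box e rho `<=` [set v | ball v d `<=` O].
  apply: cvr => v Xv.
  have /nbhs_ballP[r r0 rO] : nbhs v O by apply: open_nbhs_nbhs; split=> //; exact: XO.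
  exists (ball v (r / 2), [set d | d < r / 2]).
    split; first by apply: nbhsx_ballx; rewrite divr_gt0.
    by apply: nbhs_right_lt; rewrite divr_gt0.
  move=> [w d] /= [vw dr] z wz; apply: rO.
  rewrite [r]splitr; apply: ball_triangle vw _.
  by apply: le_ball wz; exact: ltW.
near (0 : R)^'+ => d.
have d0 : 0 < d by near: d; exact: nbhs_right_gt.
have dO : box e rho `<=` [set v | ball v d `<=` O] by near: d; exact: H.
exists (d / 2); first by rewrite divr_gt0.
move=> v Xv.
pose w : 'rV[R]_n := \row_j Num.max (e 0 j - rho 0 j) (Num.min (v 0 j) (e 0 j + rho 0 j)).
have Xw : box e rho w.
  move=> j; rewrite mxE ler_distl; have := rho0 j => r0.
  apply/andP; split; first by rewrite le_max lexx.
  by rewrite ge_max ge_min lexx orbT andbT; lra.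
apply: (dO w Xw); rewrite -ball_normE /ball_/=.
apply: (@le_lt_trans _ _ (d / 2)); last by rewrite ltr_pdivrMr// ltr_pMr// ltr1n.
apply/row_norm_le; first by rewrite divr_ge0// ltW.
move=> j; have := Xv j; have r0 := rho0 j; rewrite !mxE !ler_distl => /andP[h1 h2].
case: (leP (v 0 j) (e 0 j + rho 0 j)) => h3.
  by case: (leP (e 0 j - rho 0 j) (v 0 j)) => h4; apply/andP; split; lra.
by case: (leP (e 0 j - rho 0 j) (e 0 j + rho 0 j)) => h4; apply/andP; split; lra.
Unshelve. all: by end_near. Qed.

(* A homeomorphism fixing the outside of the box of half-widths sigma: the
   radial map r |-> r / (c (1 - r) + r) for the norm whose unit ball is the
   box; it contracts for c > 1 and its inverse has the parameter 1 / c. *)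
Section Squeeze.
Variables (n : nat) (e sigma : 'rV[R]_n).
Hypothesis sigma_gt0 : forall j, 0 < sigma 0 j.

Let z (u : 'rV[R]_n) : 'rV[R]_n := \row_j ((u 0 j - e 0 j) / sigma 0 j).
Let N (u : 'rV[R]_n) : R := Num.min `|z u| 1.

Definition squeeze (c : R) (u : 'rV[R]_n) : 'rV[R]_n :=
  e + (c * (1 - N u) + N u)^-1 *: (u - e).

Let N0 u : 0 <= N u <= 1.
Proof. by rewrite /N le_min normr_ge0 ler01 /= ge_min lexx orbT. Qed.

Let den0 c u : 0 < c -> 0 < c * (1 - N u) + N u.
Proof.
move=> c0; have /andP[h1 h2] := N0 u; have [h|h] := leP (N u) (1 / 2).
  by rewrite ltr_wpDr// mulr_gt0//; lra.
by rewrite ltr_wpDl ?mulr_ge0//; lra.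
Qed.

Let N_cts : continuous N.
Proof.
move=> u; have zc : z @ u --> z u.
  apply: (@mx_cvg _ (nbhs u)) => i j; rewrite ord1 [X in _ --> X]mxE.
  under eq_fun do rewrite mxE.
  exact: (cvgM (cvgB (@coord_continuous R 1 n 0 j u) (cvg_cst _)) (cvg_cst _)).
have nc : (fun u => `|z u|) @ u --> `|z u| by exact: (@cvg_norm _ _ _ (nbhs u) _ z (z u) zc).
exact: (@continuous_min R _ (fun u => `|z u|) (cst 1) u nc (@cst_continuous _ R^o 1 u)).
Qed.

Lemma squeeze_continuous c : 0 < c -> continuous (squeeze c).
Proof.
move=> c0 u; have cN := @N_cts u.
have c1 : (fun v => c * (1 - N v) + N v) @ u --> c * (1 - N u) + N u.
  exact: (cvgD (cvgM (cvg_cst c) (cvgB (cvg_cst (1 : R)) cN)) cN).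
have d0 : c * (1 - N u) + N u != 0 by rewrite gt_eqF// den0.
exact: (cvgD (cvg_cst e) (cvgZ (cvgV d0 c1) (cvgB cvg_id (cvg_cst e)))).
Qed.

Let z_squeeze c u : z (squeeze c u) = (c * (1 - N u) + N u)^-1 *: z u.
Proof. by apply/rowP => j; rewrite !mxE; ring. Qed.

Let z_box u : box e sigma u <-> `|z u| <= 1.
Proof.
rewrite row_norm_le//; split=> H j; have := H j; rewrite mxE normrM normfV.
  by rewrite [`|sigma _ _|]gtr0_norm// ler_pdivrMr// mul1r.
by rewrite [`|sigma _ _|]gtr0_norm// ler_pdivrMr// mul1r.
Qed.

Lemma squeeze_out c u : ~ box e sigma u -> squeeze c u = u.
Proof.
rewrite z_box => /negP; rewrite -ltNge => h.
by rewrite /squeeze /N min_r ?ltW// subrr mulr0 add0r invr1 scale1r addrC subrK.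
Qed.

Let N_squeeze c u : 0 < c -> N (squeeze c u) = N u / (c * (1 - N u) + N u).
Proof.
move=> c0; have [h|h] := leP `|z u| 1; last first.
  rewrite squeeze_out; last by rewrite z_box; apply/negP; rewrite -ltNge.
  by rewrite /N min_r ?ltW// subrr mulr0 add0r divr1.
have d0 := den0 u c0.
rewrite {1}/N z_squeeze normrZ gtr0_norm ?invr_gt0//.
have zN : `|z u| = N u by rewrite /N min_l.
rewrite zN mulrC min_l// ler_pdivrMr// mul1r -subr_ge0 addrK mulr_ge0 ?(ltW c0)//.
by have /andP[_ ?] := N0 u; rewrite subr_ge0.
Qed.

Lemma squeeze_box c u : 0 < c -> box e sigma u -> box e sigma (squeeze c u).
Proof.
move=> c0; rewrite !z_box => zu; have d0 := den0 u c0.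
rewrite z_squeeze normrZ gtr0_norm ?invr_gt0//.
have zN : `|z u| = N u by rewrite /N min_l.
rewrite zN mulrC ler_pdivrMr// mul1r -subr_ge0 addrK mulr_ge0 ?(ltW c0)//.
by have /andP[_ ?] := N0 u; rewrite subr_ge0.
Qed.

Lemma squeezeK c : 0 < c -> cancel (squeeze c) (squeeze c^-1).
Proof.
move=> c0 u; rewrite {1}/squeeze N_squeeze//; have d0 := den0 u c0.
have -> : squeeze c u - e = (c * (1 - N u) + N u)^-1 *: (u - e).
  by rewrite /squeeze addrC addKr.
rewrite scalerA -invfM.
have -> : (c^-1 * (1 - N u / (c * (1 - N u) + N u)) + N u / (c * (1 - N u) + N u)) *
    (c * (1 - N u) + N u) = 1.
  by field; rewrite !gt_eqF.
by rewrite invr1 scale1r addrC subrK.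
Qed.

(** On the inner box the radius [N] is at most [1 - s], where [s = d / (|rho| + d)] measures the
    relative thickness of the shell, so the denominator is at least [c * s]. As [|u - e| <= |rho|],
    the choice of [c] brings the image within [eps]; the [+ 1] makes this strict and keeps [c]
    positive when [rho = 0]. *)
Lemma squeeze_small (rho : 'rV[R]_n) d eps : 0 < d -> 0 < eps ->
  (forall j, 0 <= rho 0 j) -> sigma = rho + const_mx d ->
  exists2 c, 0 < c & forall u, box e rho u -> ball e eps (squeeze c u).
Proof.
move=> d0 eps0 rho0 sE.
pose s := d / (`|rho| + d).
have rd : 0 < `|rho| + d by rewrite ltr_wpDl.
have s0 : 0 < s by rewrite divr_gt0.
have r1 : 0 < `|rho| + 1 by rewrite ltr_wpDl.
pose c := (`|rho| + 1) / (eps * s).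
have c0 : 0 < c := divr_gt0 r1 (mulr_gt0 eps0 s0).
exists c => // u Xu.
have zs : N u <= 1 - s.
  have -> : 1 - s = `|rho| / (`|rho| + d) by rewrite /s; field; rewrite gt_eqF.
  rewrite /N ge_min; apply/orP; left; apply/row_norm_le; first by rewrite divr_ge0// ltW.
  move=> j; rewrite mxE normrM normfV [`|sigma _ _|]gtr0_norm//.
  rewrite ler_pdivrMr// mulrAC ler_pdivlMr// sE !mxE.
  have := coord_norm_le rho j; rewrite [`|rho 0 j|]ger0_norm// => h1.
  have := Xu j; set t := `|_| => h2.
  have h3 : t * (`|rho| + d) <= rho 0 j * (`|rho| + d) by rewrite ler_wpM2r// ltW.
  have h4 : rho 0 j * d <= `|rho| * d by rewrite ler_wpM2r// ltW.
  apply: le_trans h3 _; rewrite !mulrDr [rho 0 j * `|rho|]mulrC lerD2l.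
  exact: h4.
have ue : `|u - e| <= `|rho|.
  apply/row_norm_le => // j; rewrite !mxE; apply: le_trans (Xu j) _.
  by apply: le_trans (coord_norm_le rho j); exact: ler_norm.
have den : c * s <= c * (1 - N u) + N u.
  have /andP[h _] := N0 u.
  by rewrite -[leLHS]addr0 lerD// ler_pM2l// lerBrDr addrC -lerBrDr.
rewrite -ball_normE /ball_/= /squeeze opprD addNKr normrN normrZ.
have d1 := den0 u c0.
rewrite gtr0_norm ?invr_gt0// mulrC ltr_pdivrMr//.
apply: (@lt_le_trans _ _ (eps * (c * s))).
  have -> : eps * (c * s) = `|rho| + 1 by rewrite /c; field; rewrite !gt_eqF.
  by apply: le_lt_trans ue _; rewrite ltrDl.
by rewrite ler_wpM2l// ltW.
Qed.

End Squeeze.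

End RowVectors.
Section Boxes.
Context {R : realType}.

Lemma chart_ball_open n (T : topologicalType) (c : chart R n T) v (r : R) :
  open [set x | chart_dom c x /\ ball v r (chart_map c x)].
Proof.
rewrite openE => x [cx vx].
have h1 : nbhs x (chart_dom c).
  exact: open_nbhs_nbhs (conj (chart_dom_open c) cx).
have h2 : nbhs x (chart_map c @^-1` ball v r).
  by apply: (chart_map_continuous cx); apply: open_nbhs_nbhs; split=> //; exact: ball_open.
exact: (@filterI _ (nbhs x) _ _ _ h1 h2).
Qed.

Lemma chart_invE n (T : topologicalType) (c : chart R n T) (A : set T) v :
  (chart_map c @` (chart_dom c `&` A)) v ->
  [/\ chart_dom c (chart_inv c v), A (chart_inv c v) & chart_map c (chart_inv c v) = v].
Proof. by move=> [x [cx Ax] <-]; rewrite chart_mapK. Qed.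

(* Zero half-widths are allowed: flat boxes count. *)
Definition boxlike n (T : topologicalType) (X : set T) (d : T) :=
  exists (c : chart R n T) (e rho : 'rV[R]_n), [/\ forall j, 0 <= rho 0 j,
    box e rho `<=` chart_map c @` chart_dom c, X = chart_inv c @` box e rho
    & d = chart_inv c e].

Lemma chart_inv_box_compact n (T : topologicalType) (c : chart R n T) e rho :
  box e rho `<=` chart_map c @` chart_dom c -> compact (chart_inv c @` box e rho).
Proof.
move=> Bc; apply: continuous_compact; last exact: box_compact.
by apply: continuous_in_subspaceT => v; rewrite inE => /Bc; exact: chart_inv_continuous.
Qed.

Lemma boxlike_compact n (T : topologicalType) (X : set T) d :
  boxlike n X d -> compact X.
Proof. by move=> [c [e [rho [_ Bc -> _]]]]; exact: chart_inv_box_compact. Qed.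

(** In a Hausdorff space the compact image of the box is closed, so the chart formula and the
    identity outside glue to continuous maps in both directions. *)
Lemma chart_homeo n (T : topologicalType) (c : chart R n T) e rho
    (F G : 'rV[R]_n -> 'rV[R]_n) : hausdorff_space T ->
  box e rho `<=` chart_map c @` chart_dom c ->
  continuous F -> continuous G -> cancel F G -> cancel G F ->
  (forall u, box e rho u -> box e rho (F u)) -> (forall u, ~ box e rho u -> F u = u) ->
  (forall u, box e rho u -> box e rho (G u)) -> (forall u, ~ box e rho u -> G u = u) ->
  exists a, [/\ homeomorphism a, forall x, ~ (chart_inv c @` box e rho) x -> a x = x
    & forall u, box e rho u -> a (chart_inv c u) = chart_inv c (F u)].
Proof.
move=> hT Bc cF cG FK GK FB Fid GB Gid.
pose tr H : T -> T := patch id (chart_dom c) (chart_inv c \o H \o chart_map c).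
pose K := chart_inv c @` box e rho.
have cK : closed K by apply: compact_closed => //; exact: chart_inv_box_compact.
have Kdom : K `<=` chart_dom c.
  by move=> _ [u /Bc [x cx <-] <-]; rewrite chart_mapK.
have cod H x : (forall u, box e rho u -> box e rho (H u)) ->
    (forall u, ~ box e rho u -> H u = u) -> chart_dom c x ->
    (chart_map c @` chart_dom c) (H (chart_map c x)).
  move=> HB Hid cx; have [Bx|nBx] := pselect (box e rho (chart_map c x)).
    exact/Bc/HB.
  by rewrite Hid//; exists x.
have trE H x : chart_dom c x -> tr H x = chart_inv c (H (chart_map c x)).
  by move=> cx; rewrite /tr patchT// inE.
have trN H x : ~ chart_dom c x -> tr H x = x.
  by move=> cx; rewrite /tr /patch ifF//; apply/negbTE; rewrite notin_setE.
have trid H x : (forall u, ~ box e rho u -> H u = u) -> ~ K x -> tr H x = x.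
  move=> Hid nKx; rewrite /tr /patch; case: ifPn => //; rewrite inE => cx /=.
  rewrite Hid ?chart_mapK// => Bx; apply: nKx; exists (chart_map c x) => //.
  by rewrite chart_mapK.
have trc H : continuous H -> (forall u, box e rho u -> box e rho (H u)) ->
    (forall u, ~ box e rho u -> H u = u) -> continuous (tr H).
  move=> cH HB Hid; apply: (@glue_continuous _ _ _ K) => //.
  - exact: chart_dom_open.
  - move=> x cx; apply: continuous_comp.
      exact: chart_map_continuous.
    apply: continuous_comp; first exact: cH.
    exact/chart_inv_continuous/cod.
  - by move=> x _; exact: cvg_id.
  - by move=> x cx nKx; have := trid H x Hid nKx; rewrite /tr patchT// inE.
have trK H H' : (forall u, box e rho u -> box e rho (H u)) ->
    (forall u, ~ box e rho u -> H u = u) -> cancel H H' -> cancel (tr H) (tr H').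
  move=> HB Hid HK x; have [cx|cx] := pselect (chart_dom c x); last by rewrite !trN.
  have [y cy yE] := cod H x HB Hid cx.
  by rewrite (trE H)// -yE chart_mapK// trE// yE HK chart_mapK.
exists (tr F); split.
- by split; [exact: trc|exists (tr G); split; [exact: trc|exact: trK|exact: trK]].
- by move=> x; exact: trid.
- move=> u Bu; rewrite /tr /patch ifT /=; last by rewrite inE; apply: Kdom; exists u.
  by have [x cx <-] := Bc _ Bu; rewrite chart_mapK.
Qed.

(** A flat box has no interior to squeeze in, so it is thickened by [d0] in every direction inside
    [O]; the squeeze of the thick box then shrinks the flat one towards its centre. *)
Lemma boxlike_cellular n (T : topologicalType) (X : set T) d : hausdorff_space T ->
  boxlike n X d -> cellular X d.
Proof.
move=> hT [c [e [rho [rho0 Bc -> ->]]]]; split.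
  by exists e => //; exact: box_center.
move=> O oO XO W oW Wd.
have oO' := @chart_image_open _ _ _ c _ oO; have oW' := @chart_image_open _ _ _ c _ oW.
have BO' : box e rho `<=` chart_map c @` (chart_dom c `&` O).
  move=> u Bu; have [x cx xu] := Bc _ Bu; exists x => //; split=> //.
  by apply: XO; exists u => //; rewrite -xu chart_mapK.
have [d0 dgt0 dO] := box_thicken rho0 oO' BO'.
set sigma := rho + const_mx d0 in dO.
have sigma0 j : 0 < sigma 0 j by rewrite !mxE ltr_wpDl.
have We : (chart_map c @` (chart_dom c `&` W)) e.
  have [x cx xe] := Bc _ (box_center e rho0).
  by exists x => //; split=> //; move: Wd; rewrite -xe chart_mapK.
have /nbhs_ballP[eps /= eps0 epsW] : nbhs e (chart_map c @` (chart_dom c `&` W)).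
  by apply: open_nbhs_nbhs.
have [k k0 kB] := squeeze_small e sigma0 dgt0 eps0 rho0 erefl.
have k'0 : 0 < k^-1 by rewrite invr_gt0.
have Bc' : box e sigma `<=` chart_map c @` chart_dom c.
  by move=> u /dO [x [cx _] <-]; exists x.
have kK := squeezeK e sigma0 k0.
have k'K := squeezeK e sigma0 k'0; rewrite invrK in k'K.
have [a [ha aid aE]] := chart_homeo hT Bc'
  (@squeeze_continuous R n e sigma k k0) (@squeeze_continuous R n e sigma k^-1 k'0) kK k'K
  (fun u => @squeeze_box R n e sigma sigma0 k u k0) (@squeeze_out R n e sigma sigma0 k)
  (fun u => @squeeze_box R n e sigma sigma0 k^-1 u k'0)
  (@squeeze_out R n e sigma sigma0 k^-1).
exists a; split=> //.
- move=> x nO; apply: aid => -[u /dO Bu ux]; apply: nO; rewrite -ux.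
  by have [_ +] := chart_invE Bu.
- move=> _ [u Bu <-]; rewrite aE; last first.
    move=> j; apply: le_trans (Bu j) _; rewrite !mxE lerDl; exact: ltW.
  by have [_ +] := chart_invE (epsW _ (kB _ Bu)).
Qed.

Lemma small_boxes n (T : topologicalType) (c : chart R n T) z (O : set T) :
  chart_dom c z -> open O -> O z ->
  exists2 r, 0 < r & forall e rho : 'rV[R]_n, ball (chart_map c z) r e ->
    (forall j, 0 <= rho 0 j <= r) ->
    [/\ box e rho `<=` chart_map c @` (chart_dom c `&` O),
      boxlike n (chart_inv c @` box e rho) (chart_inv c e)
      & chart_inv c @` box e rho `<=` O].
Proof.
move=> cz oO Oz; have oO' := @chart_image_open _ _ _ c _ oO.
have /nbhs_ballP[r /= r0 rO] : nbhs (chart_map c z) (chart_map c @` (chart_dom c `&` O)).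
  by apply: open_nbhs_nbhs; split=> //; exists z.
exists (r / 2) => [|e rho ze rho_r]; first by rewrite divr_gt0.
have BO : box e rho `<=` chart_map c @` (chart_dom c `&` O).
  move=> u Bu; apply: rO; move: ze; rewrite -!ball_normE /ball_/= => ze.
  rewrite [r]splitr -(subrKA e) (le_lt_trans (ler_normD _ _))// ltr_leD//.
  apply/row_norm_le; first by rewrite divr_ge0// ltW.
  move=> j; rewrite !mxE distrC; apply: le_trans (Bu j) _.
  by have /andP[] := rho_r j.
have rho0 j : 0 <= rho 0 j by have /andP[] := rho_r j.
split.
- exact: BO.
- by exists c, e, rho; split=> // u /BO [x [cx _] <-]; exists x.
- by move=> _ [u /BO /chart_invE[_ Ou _] <-].
Qed.

Lemma boxlike_nbhd n (T : topologicalType) (c : chart R n T) z (O : set T) :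
  chart_dom c z -> open O -> O z ->
  exists X, [/\ boxlike n X z, X `<=` O & nbhs z X].
Proof.
move=> cz oO Oz; have [r r0 Hr] := small_boxes cz oO Oz.
have [|j|_ XB XO] := Hr (chart_map c z) (const_mx r).
- exact: ballxx.
- by rewrite mxE lexx ltW.
exists (chart_inv c @` box (chart_map c z) (const_mx r)); split=> //.
  by rewrite -[X in boxlike _ _ X](chart_mapK cz).
have H := open_nbhs_nbhs (conj (chart_ball_open c (chart_map c z) r)
  (conj cz (ballxx (chart_map c z) r0))).
apply: filterS H => x [cx zx]; exists (chart_map c x); last by rewrite chart_mapK.
move=> j; move: zx; rewrite -ball_normE /ball_/= distrC => /ltW.
move=> /row_norm_le; rewrite !mxE => H; have := H (ltW r0) j; by rewrite !mxE.
Qed.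

(** The box of fixed half-width [r] centred at the moving point [z'] still contains [z] as long as
    [z'] is within [r] of [z] in the chart. *)
Lemma chart_locally_cellular n (T : topologicalType) : hausdorff_space T ->
  (forall x : T, exists c : chart R n T, chart_dom c x) -> locally_cellular T.
Proof.
move=> hT charts z O oO Oz; have [c cz] := charts z.
have [r r0 Hr] := small_boxes cz oO Oz.
exists [set x | chart_dom c x /\ ball (chart_map c z) r (chart_map c x)]; split.
- exact: chart_ball_open.
- by split=> //; exact: ballxx.
move=> z' [cz' zz']; have [//|j|_ XB XO] := Hr (chart_map c z') (const_mx r).
  by rewrite mxE lexx ltW.
exists (chart_inv c @` box (chart_map c z') (const_mx r)); split=> //.
  by rewrite -[X in cellular _ X](chart_mapK cz'); exact: boxlike_cellular XB.
exists (chart_map c z); last by rewrite chart_mapK.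
move=> j; move: zz'; rewrite -ball_normE /ball_/= => /ltW.
by move=> /(row_norm_le _ (ltW r0))/(_ j); rewrite !mxE.
Qed.

Lemma boxlikeX n m (S T : topologicalType) (X : set S) (Y : set T) x y :
  boxlike n X x -> boxlike m Y y -> boxlike (n + m) (X `*` Y) (x, y).
Proof.
move=> [c [e [rho [rho0 Bc -> ->]]]] [d [f [tau [tau0 Bd -> ->]]]].
have boxE u : box (row_mx e f) (row_mx rho tau) u <->
    box e rho (lsubmx u) /\ box f tau (rsubmx u).
  split=> [Bu|[Bl Br] j].
    split=> j; first by have := Bu (lshift m j); rewrite !row_mxEl mxE.
    by have := Bu (rshift n j); rewrite !row_mxEr mxE.
  rewrite -[u]hsubmxK; have [i ->|i ->] := split_ordP j.
    by rewrite !row_mxEl; exact: Bl.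
  by rewrite !row_mxEr; exact: Br.
exists (prod_chart c d), (row_mx e f), (row_mx rho tau); split.
- by move=> j; have [i ->|i ->] := split_ordP j; rewrite ?row_mxEl ?row_mxEr.
- move=> u /boxE[/Bc [a ca au] /Bd [b db bu]].
  by exists (a, b) => //=; rewrite au bu hsubmxK.
- apply/seteqP; split=> [[a b] [/= [u Bu <-] [v Bv <-]]|_ [u /boxE[Bl Br] <-]] /=.
    exists (row_mx u v); last by rewrite /= row_mxKl row_mxKr.
    by apply/boxE; rewrite row_mxKl row_mxKr.
  by split; [exists (lsubmx u)|exists (rsubmx u)].
- by rewrite /= row_mxKl row_mxKr.
Qed.

End Boxes.
(** * Slices of a free smooth circle action *)

Section CircleGroup.
Context {R : realType}.
Implicit Types z w : circle R.

Lemma circle_eq z w : sval z = sval w -> z = w.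
Proof. by move=> e; exact: val_inj. Qed.

Lemma circle_mulA z w t : circle_mul z (circle_mul w t) = circle_mul (circle_mul z w) t.
Proof. by apply: circle_eq => /=; congr pair; ring. Qed.

Lemma circle_mulC z w : circle_mul z w = circle_mul w z.
Proof. by apply: circle_eq => /=; congr pair; ring. Qed.

Lemma circle_mul1 z : circle_mul circle_one z = z.
Proof.
apply: circle_eq => /=; rewrite [RHS]surjective_pairing; congr pair; ring.
Qed.

Lemma circle_inv_subproof z : circle_set ((sval z).1, - (sval z).2).
Proof. by rewrite /circle_set/= sqrrN circleP. Qed.

Definition circle_inv z : circle R := to_circle (circle_inv_subproof z).

Lemma circle_mulV z : circle_mul (circle_inv z) z = circle_one.
Proof.
apply: circle_eq => /=; congr pair; last by ring.
by rewrite -[RHS](circleP z); ring.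
Qed.

Lemma sval_circle_continuous : continuous (sval : circle R -> R * R).
Proof. exact: (@initial_continuous (circle R) (R * R)%type set_val). Qed.

Lemma circle_fst_continuous : continuous (fun z : circle R => (sval z).1).
Proof.
by move=> z; apply: (@cvg_comp _ _ _ _ fst _ _ _ (@sval_circle_continuous z)); exact: cvg_fst.
Qed.

Lemma circle_snd_continuous : continuous (fun z : circle R => (sval z).2).
Proof.
by move=> z; apply: (@cvg_comp _ _ _ _ snd _ _ _ (@sval_circle_continuous z)); exact: cvg_snd.
Qed.

Lemma circle_mulr_continuous w : continuous (circle_mul ^~ w).
Proof.
apply: continuous_comp_initial => z.
have c1 := @circle_fst_continuous z; have c2 := @circle_snd_continuous z.
have ca : (fun z => (sval z).1 * (sval w).1 - (sval z).2 * (sval w).2) @ z -->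
    (sval z).1 * (sval w).1 - (sval z).2 * (sval w).2.
  exact: (cvgB (cvgM c1 (cvg_cst (sval w).1)) (cvgM c2 (cvg_cst (sval w).2))).
have cb : (fun z => (sval z).1 * (sval w).2 + (sval z).2 * (sval w).1) @ z -->
    (sval z).1 * (sval w).2 + (sval z).2 * (sval w).1.
  exact: (cvgD (cvgM c1 (cvg_cst (sval w).2)) (cvgM c2 (cvg_cst (sval w).1))).
exact: (cvg_pair ca cb).
Qed.

(** The point of angle [2 arctan t]. Smoothness of the action is stated in stereographic charts, so
    local time along orbits is measured by this parameter instead of the angle. *)
Definition stereo_param (t : R) : circle R := stereo_inv true (const_mx t).

Lemma stereo_param0 : stereo_param 0 = circle_one.
Proof.
apply: circle_eq; rewrite /= !mxE expr1 expr0n/= mulr0 mul0r; congr pair.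
by rewrite sub0r add0r invr1 mulr1 mulrNN mulr1.
Qed.

Lemma stereo_param_inj : injective stereo_param.
Proof.
move=> t t' /(congr1 (stereo_map true)).
rewrite !(stereo_invK true _).2 => /matrixP/(_ 0 0).
by rewrite !mxE.
Qed.

Lemma stereo_param_continuous : continuous stereo_param.
Proof.
move=> t; apply: (@continuous_comp _ _ _ (fun t : R => const_mx t : 'rV[R]_1)).
  by apply: (@const_mx_cvg _ _ (nbhs t)); exact: cvg_id.
by apply: stereo_inv_continuous; rewrite stereo_cod.
Qed.

(** Each stereographic chart sends the half circle away from its pole onto [[-1, 1]], so two compact
    images cover the circle. *)
Lemma circle_compact : compact [set: circle R].
Proof.
have -> : [set: circle R] =
    \big[setU/set0]_(s <- [:: true; false]) (stereo_inv s @` box 0 (const_mx 1)).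
  rewrite !big_cons big_nil setU0; apply/seteqP; split=> // z _.
  have Hs (s : bool) : (-1) ^+ s * (sval z).1 <= 0 -> (stereo_inv s @` box 0 (const_mx 1)) z.
    move=> h; have d : stereo_dom s z.
      by rewrite /stereo_dom/= gt_eqF// subr_gt0 (le_lt_trans h)// ltr01.
    exists (stereo_map s z); last by rewrite stereo_mapK.
    move=> j; rewrite /stereo_map !mxE subr0 normrM normfV.
    have d1 : 1 <= 1 - (-1) ^+ s * (sval z).1 by rewrite lerBrDr gerDl.
    rewrite [`|1 - _|]ger0_norm ?(le_trans ler01)//.
    rewrite ler_pdivrMr ?(lt_le_trans ltr01)// mul1r (le_trans _ d1)//.
    rewrite -(@ler_pXn2r _ 2)// ?nnegrE// expr1n real_normK ?num_real//.
    by rewrite -(circleP z) lerDr sqr_ge0.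
  have [h|h] := leP (sval z).1 0.
    by right; apply: Hs; rewrite expr0 mul1r.
  by left; apply: Hs; rewrite expr1 mulN1r oppr_le0 ltW.
apply: bigsetU_compact => s _; apply: continuous_compact; last exact: box_compact.
apply: continuous_in_subspaceT => v _.
by apply: stereo_inv_continuous; rewrite stereo_cod.
Qed.

End CircleGroup.
Section FlowBox.
Context {R : realType} (n : nat) (M : topologicalType) (SM : smooth_structure R n M).
Context (act : circle R -> M -> M).
Hypothesis act_smooth : smooth_circle_action SM act.
Hypothesis act_free : free_circle_action act.

Let act1 x : act circle_one x = x. Proof. by have [] := act_smooth. Qed.

Let act_cts : continuous (fun p : circle R * M => act p.1 p.2).
Proof. by have [_ _ []] := act_smooth. Qed.

Let prow (w : R) (u : 'rV[R]_n) : 'rV[R]_(1 + n) := row_mx (const_mx w) u.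

Let prow_ball w u w' u' (r : R) : 0 < r -> ball w r w' -> ball u r u' ->
  ball (prow w u) r (prow w' u').
Proof.
move=> r0 ww [_ uu]; split=> // i j; rewrite ord1.
have [k ->|k ->] := split_ordP j; first by rewrite !row_mxEl !mxE.
by rewrite !row_mxEr.
Qed.

(* The time derivative of the orbit of x0 is nonzero at some small time w0,
   otherwise x0 would be fixed for all small times.  Working at w0 rather than at
   0 avoids the chain rule for the flow. *)
Lemma coordinate_flow_increasing (x0 : M) : exists (c : chart R n M) (w0 : R) (i : 'I_n)
    (s : R) (eta : R),
  [/\ chart_dom c x0, s != 0, 0 < eta,
    forall w u, ball w0 eta w -> ball (chart_map c x0) eta u ->
      chart_dom c (chart_inv c u) /\ chart_dom c (act (stereo_param w) (chart_inv c u))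
    & forall w w' u, ball w0 eta w -> ball w0 eta w' -> ball (chart_map c x0) eta u ->
      w < w' -> s * chart_map c (act (stereo_param w) (chart_inv c u)) 0 i <
                s * chart_map c (act (stereo_param w') (chart_inv c u)) 0 i].
Proof.
have [c Mc cx0] := atlas_cover SM x0.
pose P := prod_chart (stereo_chart true) c.
have PP : atlas (prod_smooth_structure (circle_smooth_structure R) SM) P.
  by exists (stereo_chart true, c) => //; split=> //; exists true.
pose f (p : circle R * M) := act p.1 p.2.
pose U := chart_map P @` (chart_dom P `&` f @^-1` chart_dom c).
pose Psi := chart_map c \o f \o chart_inv P.
have [_ HD] : Ck_on 1 U Psi by have [_ _ [_ H]] := act_smooth; exact: (H P c PP Mc 1%N).
have PsiE w u : Psi (prow w u) = chart_map c (act (stereo_param w) (chart_inv c u)).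
  by rewrite /Psi /prow /f /= row_mxKl row_mxKr.
have UE w u : U (prow w u) ->
    chart_dom c (chart_inv c u) /\ chart_dom c (act (stereo_param w) (chart_inv c u)).
  move=> [[z x] [/= [dz dx] dzx] /eq_row_mx[zw xu]].
  by rewrite /stereo_param -zw -xu chart_mapK// stereo_mapK.
have oU : open U.
  apply: chart_image_open; apply: open_comp (chart_dom_open c) => ? _; exact: act_cts.
(* The direction of the circle parameter in the product chart: ['D_v Psi] is the velocity of the
   orbits read in [c]. *)
pose v : 'rV[R]_(1 + n) := row_mx (const_mx 1) 0.
have [dPsi [cD _]] := HD v.
have der w u i : U (prow w u) ->
    is_derive w 1 (fun t => Psi (prow t u) 0 i) ('D_v Psi (prow w u) 0 i).
  move=> Uwu.
  have H : (fun h : R => h^-1 *: (((fun t => Psi (prow t u) 0 i) \o shift w) (h *: 1)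
      - Psi (prow w u) 0 i)) @ 0^' --> 'D_v Psi (prow w u) 0 i.
    have dcv : _ --> 'D_v Psi (prow w u) := dPsi _ Uwu.
    have := @cvg_comp _ _ _ _ (fun M : 'rV[R]_n => M 0 i) _ _ _ dcv
      (@coord_continuous R 1 n 0 i _).
    apply: cvg_trans; apply: near_eq_cvg; near=> h.
    rewrite /= !mxE; congr (_ * (Psi _ 0 i - _)).
    by rewrite /prow /v scale_row_mx add_row_mx scaler0 add0r; congr row_mx;
      apply/matrixP => a b; rewrite !mxE.
  by apply: DeriveDef; [apply/cvg_ex; eexists; exact: H|exact: cvg_lim].
have U0 : U (prow 0 (chart_map c x0)).
  have [d1 m1] := stereo_invK true (const_mx 0 : 'rV[R]_1).
  exists (stereo_param 0, x0) => //=; last by rewrite /stereo_param m1.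
  by split=> //; rewrite /f /= stereo_param0 act1.
have /nbhs_ballP[r /= r0 rU] : nbhs (prow 0 (chart_map c x0)) U by apply: open_nbhs_nbhs.
have rU' w u : ball 0 r w -> ball (chart_map c x0) r u -> U (prow w u).
  by move=> hw hu; apply/rU/prow_ball.
set u0 := chart_map c x0 in U0 rU rU' *.
have mvt w w' u i : w < w' -> (forall t, t \in `[w, w'] -> U (prow t u)) ->
    exists2 t, t \in `[w, w'] & Psi (prow w' u) 0 i - Psi (prow w u) 0 i =
      'D_v Psi (prow t u) 0 i * (w' - w).
  move=> ww' HU; have dd t : t \in `[w, w'] ->
    is_derive t 1 (fun t => Psi (prow t u) 0 i) ('D_v Psi (prow t u) 0 i).
    by move=> /HU; exact: der.
  have hd t : t \in `]w, w'[%R ->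
    is_derive t 1 (fun t => Psi (prow t u) 0 i) ('D_v Psi (prow t u) 0 i).
    by move=> /subset_itv_oo_cc; exact: dd.
  have hc : {within `[w, w'], continuous (fun t => Psi (prow t u) 0 i)}.
    apply: continuous_in_subspaceT => t; rewrite inE => /dd [dt _].
    exact/differentiable_continuous/derivable1_diffP.
  have [t tww' tE] := MVT ww' hd hc.
  by exists t; [exact: subset_itv_oo_cc|exact: tE].
have [w0 [i [w0r Dw0]]] : exists w0 i, ball 0 r w0 /\ 'D_v Psi (prow w0 u0) 0 i != 0.
  apply: contrapT => H.
  have H0 w i : ball 0 r w -> 'D_v Psi (prow w u0) 0 i = 0.
    move=> rw; apply/eqP; rewrite -[_ == _]negbK; apply/negP => Dn; apply: H.
    by exists w, i.
  have r2 : 0 < r / 2 by rewrite divr_gt0.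
  have tr t : t \in `[0, r / 2] -> ball 0 r t.
    rewrite in_itv/= => /andP[t0 tr]; rewrite -ball_normE /ball_/= sub0r normrN ger0_norm//.
    by apply: le_lt_trans tr _; rewrite ltr_pdivrMr// ltr_pMr// ltr1n.
  have Psi_eq : Psi (prow (r / 2) u0) = Psi (prow 0 u0).
    apply/rowP => i; apply/eqP; rewrite -subr_eq0.
    have [t|t tt ->] := @mvt 0 (r / 2) u0 i r2.
      by move=> /tr tt; apply: rU' => //; exact: ballxx.
    by rewrite H0 ?mul0r//; exact: tr.
  have r2' : (r / 2) \in `[0, r / 2] by rewrite in_itv/= lexx ltW.
  have [_ d1] := UE _ _ (rU' _ _ (tr _ r2') (ballxx u0 r0)).
  have [_ d2] := UE _ _ U0.
  move: Psi_eq; rewrite !PsiE => /(congr1 (chart_inv c)).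
  rewrite (chart_mapK d1) (chart_mapK d2) /u0 (chart_mapK cx0) stereo_param0 act1 => /act_free.
  rewrite -stereo_param0 => /stereo_param_inj /eqP.
  by rewrite gt_eqF.
(* With the derivative itself as factor, [s * 'D_v Psi] equals [s * s > 0] at the centre, whatever
   the sign of [s]. *)
pose s := 'D_v Psi (prow w0 u0) 0 i.
have s0 : 0 < s * s by rewrite -expr2 exprn_even_gt0.
have cs : (fun x => s * 'D_v Psi x 0 i) @ prow w0 u0 --> s * s.
  have cDi : (fun x => 'D_v Psi x 0 i) @ prow w0 u0 --> s.
    exact: (@cvg_comp _ _ _ _ (fun M : 'rV[R]_n => M 0 i) _ _ _
      (cD _ (rU' _ _ w0r (ballxx u0 r0))) (@coord_continuous R 1 n 0 i _)).
  exact: (cvgM (cvg_cst s) cDi).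
have npos : \forall x \near prow w0 u0, U x /\ 0 < s * 'D_v Psi x 0 i.
  apply: filterI.
    by apply: open_nbhs_nbhs; split=> //; apply: rU' => //; exact: ballxx.
  have : nbhs (s * s) [set y | 0 < y] by apply: lt_nbhsr.
  exact: cs.
have /nbhs_ballP[eta /= eta0 etaP] := npos.
have etaP' w u : ball w0 eta w -> ball u0 eta u ->
    U (prow w u) /\ 0 < s * 'D_v Psi (prow w u) 0 i.
  by move=> hw hu; apply/etaP/prow_ball.
exists c, w0, i, s, eta; split=> //.
- by move=> w u hw hu; apply: UE; have [] := etaP' w u hw hu.
- move=> w w' u hw hw' hu ww'; rewrite -!PsiE -subr_gt0 -mulrBr.
  have tball t : t \in `[w, w'] -> ball w0 eta t.
    move: hw hw'; rewrite in_itv/= -!ball_normE /ball_/= !ltr_distl.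
    by move=> /andP[h1 h2] /andP[h3 h4] /andP[h5 h6]; apply/andP; split; lra.
  have [t|t tt ->] := @mvt w w' u i ww'.
    by move=> /tball ht; have [] := etaP' t u ht hu.
  rewrite mulrA mulr_gt0 ?subr_gt0//.
  by have [] := etaP' t u (tball t tt) hu.
Unshelve. all: by end_near. Qed.

End FlowBox.

(** * Flat slices across the orbits *)

Section Slices.
Context {R : realType} (n : nat) (M : topologicalType) (SM : smooth_structure R n M).
Context (act : circle R -> M -> M).
Hypothesis M_hausdorff : hausdorff_space M.
Hypothesis act_smooth : smooth_circle_action SM act.
Hypothesis act_free : free_circle_action act.

Let act1 x : act circle_one x = x. Proof. by have [] := act_smooth. Qed.

Let actM z w x : act (circle_mul z w) x = act z (act w x).
Proof. by have [] := act_smooth. Qed.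

Let act_cts : continuous (fun p : circle R * M => act p.1 p.2).
Proof. by have [_ _ []] := act_smooth. Qed.

Lemma act_nbhs z x (W : set M) : open W -> W (act z x) ->
  exists I V, [/\ open I, open V, I z, V x & forall z' x', I z' -> V x' -> W (act z' x')].
Proof.
move=> oW Wzx.
have : nbhs (z, x) ((fun p : circle R * M => act p.1 p.2) @^-1` W).
  by apply: (@act_cts (z, x)); apply: open_nbhs_nbhs.
move=> [[I V] /= [+ +] IV]; rewrite !nbhsE => -[I' [oI' I'z] I'I] [V' [oV' V'x] V'V].
exists I', V'; split=> // z' x' Iz Vx; apply: (IV (z', x')).
by split; [exact: I'I|exact: V'V].
Qed.

Lemma act_continuous z : continuous (act z).
Proof.
move=> x W; rewrite {1}nbhsE => -[W' [oW' W'x] W'W].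
have [I [V [oI oV Iz Vx IV]]] := act_nbhs oW' W'x.
have nV : nbhs x V by apply: open_nbhs_nbhs.
by apply: filterS nV => y Vy; apply: W'W; apply: (IV z).
Qed.

(* D' contains D together with the neighbourhoods of the points of D needed to
   cut D into small flat boxes E. *)
Definition slice (D D' : set M) := [/\ compact D,
  forall x z, D' x -> D' (act z x) -> z = circle_one
  & forall x W, D x -> open W -> W x -> exists E e V,
    [/\ @boxlike R n M E e, E `<=` D' `&` W, open V, V x & D `&` V `<=` E]].

(** By freeness an element outside [Z] moves [x], hence it and its neighbours in the group move a
    whole neighbourhood of [x] off itself; the complement of [Z] is compact, so one neighbourhood
    serves all of them. *)
Lemma orbits_leave (x : M) (Z : set (circle R)) : open Z -> Z circle_one ->
  exists B, [/\ open B, B x & forall z y, ~ Z z -> B y -> ~ B (act z y)].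
Proof.
move=> oZ Z1.
have cZ : compact (~` Z).
  by apply: subclosed_compact circle_compact _ => //; exact: open_closedC.
pose P (A : set (circle R)) := exists B, [/\ open B, B x & forall z y, A z -> B y -> ~ B (act z y)].
suff [B [oB Bx HB]] : P (~` Z) by exists B.
apply: compact_induction cZ _ _ _ _.
- by exists setT; split=> //; exact: openT.
- move=> A1 A2 [B1 [ ob1 x1 H1]] [B2 [ ob2 x2 H2]]; exists (B1 `&` B2); split=> //.
    exact: openI.
  by move=> z y [Az|Az] [y1 y2] [z1 z2]; [apply: (H1 z y)|apply: (H2 z y)].
- by move=> A1 A2 A12 [B [oB Bx HB]]; exists B; split=> // z y /A12; exact: HB.
- move=> z nZz; have : act z x != x.
    by apply/eqP => /act_free z1; apply: nZz; rewrite z1.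
  move: M_hausdorff; rewrite open_hausdorff => /[apply]; case=> -[V U] /=.
  rewrite !inE => -[Vzx Ux] [oV oU VU].
  have [I [W [oI oW Iz Wx IW]]] := act_nbhs oV Vzx.
  exists I; first by apply: open_nbhs_nbhs.
  exists (U `&` W); split=> //; first exact: openI.
  move=> z' y Iz' [Uy Wy] [Uzy _]; suff : (V `&` U) (act z' y) by rewrite VU.
  by split=> //; exact: IW.
Qed.

(** Two points of [D'] on one orbit differ by an element of [Z], since all other elements move [B]
    off itself; for elements of [Z] the [i]-th coordinate is strictly monotone along the orbit, so a
    common level forces the identity. Orbits close to that of [x0] do cross the level, by the
    intermediate value theorem. *)
Lemma slice_through_orbit (x0 : M) : exists D D', slice D D' /\
  exists2 U, nbhs x0 U & forall x, U x -> exists z, D (act z x).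
Proof.
have [c [w0 [i [s [eta [cx0 s0 eta0 dom inc]]]]]] :=
  coordinate_flow_increasing act_smooth act_free x0.
set u0 := chart_map c x0 in dom inc.
have [_ cx1] := dom _ _ (ballxx w0 eta0) (ballxx u0 eta0).
rewrite {1}/u0 chart_mapK// in cx1.
pose z0 := stereo_param w0; pose x1 := act z0 x0.
pose v1 := chart_map c x1.
(* The slice is the level set through x1 of the i-th coordinate, which increases
   along the orbits. *)
pose flat r : 'rV[R]_n := \row_j if j == i then 0 else r.
have flat_ge0 r j : 0 <= r -> 0 <= flat r 0 j <= r.
  by move=> r0; rewrite mxE; case: eqP => _; rewrite ?lexx ?r0.
(* The elements that keep the flow, started at parameter [w0], within the window where monotonicity
   is known. *)
pose Z := [set z | stereo_dom true (circle_mul z z0) /\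
  ball (const_mx w0 : 'rV[R]_1) eta (stereo_map true (circle_mul z z0))].
have oZ : open Z.
  apply: (@open_comp _ _ (circle_mul ^~ z0) [set z | stereo_dom true z /\
    ball (const_mx w0 : 'rV[R]_1) eta (stereo_map true z)]).
    by move=> z _; exact: circle_mulr_continuous.
  exact: (chart_ball_open (stereo_chart true)).
have Zw z : Z z -> exists2 w, ball w0 eta w & stereo_param w = circle_mul z z0.
  move=> [dz bz]; exists (stereo_map true (circle_mul z z0) 0 0).
    by have [_ /(_ 0 0)] := bz; rewrite mxE.
  rewrite /stereo_param; set t := stereo_map _ _.
  have -> : const_mx (t 0 0) = t by apply/rowP => k; rewrite mxE ord1.
  exact: stereo_mapK.
have Z1 : Z circle_one.
  rewrite /Z /= circle_mul1; have [d1 ->] := stereo_invK true (const_mx w0).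
  by split=> //; exact: ballxx.
have [B [oB Bx1 HB]] := orbits_leave x1 oZ Z1.
(* The image under [z0] of the window around [x0]: monotonicity is known along orbits parametrised
   from that window, whereas the slice sits at [x1]. *)
pose B2 := act (circle_inv z0) @^-1` [set x | chart_dom c x /\ ball u0 eta (chart_map c x)].
have oB2 : open B2.
  by apply: open_comp; [move=> ? _; exact: act_continuous|exact: chart_ball_open].
have B2x1 : B2 x1.
  rewrite /B2 /= /x1 -actM circle_mulV act1; split=> //; exact: ballxx.
have oBB2 := openI oB oB2.
have [r0 r0gt0 Hr] := small_boxes cx1 oBB2 (conj Bx1 B2x1).
(* Halved so that a piece of half-width at most [r] centred in [D] remains in [D'], whose half-width
   is [r0]. *)
pose r := r0 / 2.
have rgt0 : 0 < r by rewrite divr_gt0.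
have r2 : r + r = r0 by rewrite -splitr.
have flat_r0 : forall j, 0 <= flat r0 0 j <= r0 by move=> j; apply/flat_ge0/ltW.
have flat_r : forall j, 0 <= flat r 0 j <= r0.
  by move=> j; have /andP[-> /le_trans->//] := flat_ge0 r j (ltW rgt0); rewrite -r2 lerDl ltW.
have [D'sub _ D'BB] := Hr v1 (flat r0) (ballxx _ r0gt0) flat_r0.
have [Dsub _ _] := Hr v1 (flat r) (ballxx _ r0gt0) flat_r.
pose D := chart_inv c @` box v1 (flat r); pose D' := chart_inv c @` box v1 (flat r0).
exists D, D'; split.
  split.
  - by apply: chart_inv_box_compact => u /Dsub[x [cx _] <-]; exists x.
  - move=> y z D'y D'zy; apply: (@act_free _ y).
    have [Zz|nZz] := pselect (Z z); last first.
      have [By _] := D'BB _ D'y; have [Bzy _] := D'BB _ D'zy.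
      by case: (HB _ _ nZz By Bzy).
    have [_ B2y] := D'BB _ D'y; have [cx bx] := B2y.
    set x := act (circle_inv z0) y in cx bx.
    have z0x : act z0 x = y by rewrite /x -actM circle_mulC circle_mulV act1.
    have [w ww wz] := Zw _ Zz.
    have coord t : D' t -> chart_map c t 0 i = v1 0 i.
      move=> [u Bu <-]; have [_ _ ->] := chart_invE (D'sub _ Bu).
      by have := Bu i; rewrite mxE eqxx normr_le0 subr_eq0 => /eqP.
    have e1 : act (stereo_param w) x = act z y by rewrite wz actM z0x.
    have inc' := inc _ _ _ _ _ bx; rewrite chart_mapK// in inc'.
    case: (ltgtP w w0) => [lt|lt|ww0].
    + have := inc' w w0 ww (ballxx w0 eta0) lt.
      by rewrite e1 z0x !coord// ltxx.
    + have := inc' w0 w (ballxx w0 eta0) ww lt.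
      by rewrite e1 z0x !coord// ltxx.
    + by rewrite -e1 ww0 z0x.
  - move=> x W [u Bu ux] oW Wx.
    have [cx _ mx] := chart_invE (Dsub _ Bu); rewrite ux in cx mx.
    have [r1 r1gt0 Hr1] := small_boxes cx oW Wx.
    pose rr := Num.min r1 r.
    have rr0 : 0 < rr by rewrite lt_min r1gt0.
    have rr1 j : 0 <= flat rr 0 j <= r1.
      by have /andP[-> /le_trans->//] := flat_ge0 rr j (ltW rr0); rewrite ge_min lexx.
    have [Esub Ebox EW] := Hr1 (chart_map c x) (flat rr) (ballxx _ r1gt0) rr1.
    exists (chart_inv c @` box (chart_map c x) (flat rr)), x.
    exists [set y | chart_dom c y /\ ball (chart_map c x) rr (chart_map c y)]; split.
    + by rewrite (chart_mapK cx) in Ebox.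
    + move=> y Ey; split; last exact: EW.
      have [t Bt <-] := Ey; exists t => // j.
      have := Bt j; have := Bu j; rewrite mx !mxE; case: eqP => _.
        by rewrite !normr_le0 !subr_eq0 => /eqP -> /eqP ->.
      move=> h1 h2; rewrite -(subrKA (u 0 j)); apply: le_trans (ler_normD _ _) _.
      by rewrite -r2 lerD// (le_trans h2)// ge_min lexx orbT.
    + exact: chart_ball_open.
    + by split=> //; exact: ballxx.
    + move=> y [[t Bt ty] [cy xy]]; exists (chart_map c y); last by rewrite chart_mapK.
      have [_ _ my] := chart_invE (Dsub _ Bt); rewrite ty in my.
      move=> j; rewrite mxE; case: eqP => [->|_].
        have := Bt i; have := Bu i; rewrite my mx !mxE eqxx !normr_le0 !subr_eq0.
        by move=> /eqP -> /eqP ->.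
      move: xy; rewrite -ball_normE /ball_/= distrC => /ltW.
      by move=> /(row_norm_le _ (ltW rr0))/(_ j); rewrite !mxE.
have cinv w u : ball w0 eta w -> ball u0 eta u ->
    {for (w, chart_inv c u), continuous (fun p : R * M =>
      chart_map c (act (stereo_param p.1) p.2))}.
  move=> hw hu; have [_ dd] := dom _ _ hw hu.
  apply: (@continuous_comp _ _ _ (fun p : R * M => act (stereo_param p.1) p.2));
    last exact: chart_map_continuous.
  apply: (@continuous_comp _ _ _ (fun p : R * M => (stereo_param p.1, p.2))
    (fun p => act p.1 p.2)); last exact: act_cts.
  have cs : (fun p : R * M => stereo_param p.1) @ (w, chart_inv c u) --> stereo_param w.
    by apply: (@cvg_comp _ _ _ fst stereo_param _ _ _ cvg_fst); exact: stereo_param_continuous.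
  exact: (cvg_pair cs cvg_snd).
have [eta1 eta1gt0 [eta1_eta near_x1]] : exists2 eta1, 0 < eta1 & eta1 < eta /\
    \forall x \near x0, chart_dom c x /\ ball u0 eta (chart_map c x) /\
      forall w, ball w0 eta1 w -> ball v1 r (chart_map c (act (stereo_param w) x)).
  have := cinv w0 u0 (ballxx _ eta0) (ballxx _ eta0).
  rewrite /prop_for /continuous_at /= /u0 chart_mapK// => /(_ _ (nbhsx_ballx v1 r rgt0)).
  move=> [[I V] /= [/nbhs_ballP[k /= k0 kI] Vx0] IV].
  pose eta1 := Num.min k (eta / 2).
  have e2 : 0 < eta / 2 by rewrite divr_gt0.
  exists eta1; first by rewrite lt_min k0.
  split.
    by rewrite gt_min orbC ltr_pdivrMr// ltr_pMr// ltr1n.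
  have nb := open_nbhs_nbhs (conj (chart_ball_open c u0 eta) (conj cx0 (ballxx u0 eta0))).
  apply: filterS (filterI Vx0 nb) => x [Vx [cx bx]]; split=> //; split=> // w ww.
  by apply: (IV (w, x)); split=> //; apply: kI; apply: le_ball ww; rewrite ge_min lexx.
(* The closed interval of radius [eta2] lies in the open ball of radius [eta1], where the orbits
   stay within [r] of [v1] and hence are in [D] as soon as they reach the level. *)
pose eta2 := eta1 / 2.
have eta2gt0 : 0 < eta2 by rewrite divr_gt0.
have eta2_lt : eta2 < eta1 by rewrite ltr_pdivrMr// ltr_pMr// ltr1n.
have itv_ball w : w \in `[w0 - eta2, w0 + eta2] -> ball w0 eta1 w /\ ball w0 eta w.
  rewrite in_itv/= -!ball_normE /ball_/= !ltr_distl => /andP[h1 h2].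
  by split; apply/andP; split; lra.
have wl : (w0 - eta2) \in `[w0 - eta2, w0 + eta2] by rewrite in_itv/= lexx/=; lra.
have wr : (w0 + eta2) \in `[w0 - eta2, w0 + eta2] by rewrite in_itv/= lexx andbT; lra.
pose g w x := s * chart_map c (act (stereo_param w) x) 0 i.
have cg w x : ball w0 eta w -> chart_dom c x -> ball u0 eta (chart_map c x) ->
    {for (w, x), continuous (fun p : R * M => g p.1 p.2)}.
  move=> hw cx hx; have := cinv w _ hw hx; rewrite chart_mapK// => ci.
  apply: (cvgM (cvg_cst s)).
  exact: (@cvg_comp _ _ _ (fun p : R * M => chart_map c (act (stereo_param p.1) p.2))
    (fun u : 'rV[R]_n => u 0 i) _ _ _ ci (@coord_continuous R 1 n 0 i _)).
have near_lt w : ball w0 eta w -> forall P : set R, open P -> P (g w x0) ->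
    \forall x \near x0, P (g w x).
  move=> hw P oP Px.
  have : nbhs (w, x0) ((fun p : R * M => g p.1 p.2) @^-1` P).
    by apply: (cg w x0 hw cx0 (ballxx _ eta0)); apply: open_nbhs_nbhs.
  by move=> [[I V] /= [nI nV] IV]; apply: filterS nV => x Vx;
    apply: (IV (w, x)); split=> //; exact: nbhs_singleton.
have inc0 w w' x : chart_dom c x -> ball u0 eta (chart_map c x) -> ball w0 eta w ->
    ball w0 eta w' -> w < w' -> g w x < g w' x.
  by move=> cx hx hw hw' ww'; have := inc w w' _ hw hw' hx ww'; rewrite chart_mapK.
have g0 : g w0 x0 = s * v1 0 i by [].
have gl : \forall x \near x0, g (w0 - eta2) x < s * v1 0 i.
  apply: (near_lt _ (itv_ball _ wl).2 [set y | y < s * v1 0 i]); first exact: open_lt.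
  rewrite /= -g0; apply: inc0 => //; [exact: ballxx|exact: (itv_ball _ wl).2|exact: ballxx|].
  by rewrite ltrBlDr ltrDl.
have gr : \forall x \near x0, s * v1 0 i < g (w0 + eta2) x.
  apply: (near_lt _ (itv_ball _ wr).2 [set y | s * v1 0 i < y]); first exact: open_gt.
  rewrite /= -g0; apply: inc0 => //; [exact: ballxx|exact: ballxx|exact: (itv_ball _ wr).2|].
  by rewrite ltrDl.
exists [set x | (chart_dom c x /\ ball u0 eta (chart_map c x) /\
      forall w, ball w0 eta1 w -> ball v1 r (chart_map c (act (stereo_param w) x))) /\
    g (w0 - eta2) x < s * v1 0 i /\ s * v1 0 i < g (w0 + eta2) x].
  exact: filterI near_x1 (filterI gl gr).
move=> x [[cx [hx hD]] [lt_l lt_r]].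
have cts : {within `[w0 - eta2, w0 + eta2], continuous (fun w => g w x)}.
  apply: continuous_in_subspaceT => w; rewrite inE => /itv_ball[_ hw].
  apply: (@continuous_comp _ _ _ (fun w : R => (w, x)) (fun p : R * M => g p.1 p.2)).
    exact: (cvg_pair cvg_id (cvg_cst x)).
  exact: cg.
have [||w ww gw] := IVT _ cts (v := s * v1 0 i).
- by lra.
- by rewrite ge_min le_max (ltW lt_l) (ltW lt_r) orbT.
have [hw1 hw] := itv_ball _ ww.
have [_ dw] := dom _ _ hw hx; rewrite chart_mapK// in dw.
exists (stereo_param w); exists (chart_map c (act (stereo_param w) x)); last by rewrite chart_mapK.
move=> j; rewrite mxE; case: eqP => [->|_].
  by move/(mulfI s0): gw => ->; rewrite subrr normr0.
have := hD w hw1; rewrite -ball_normE /ball_/= distrC => /ltW.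
by move=> /(row_norm_le _ (ltW rgt0))/(_ j); rewrite !mxE.
Qed.

End Slices.

(** * The circle group parametrised by turns *)

Section Angle.
Context {R : realType}.
Local Notation turn := (pi *+ 2 : R).

Lemma angle_subproof (t : R) : circle_set (cos (t * turn), sin (t * turn)).
Proof. exact: cos2Dsin2. Qed.

Definition angle (t : R) : circle R := to_circle (angle_subproof t).

Lemma angleD s t : angle (s + t) = circle_mul (angle s) (angle t).
Proof.
by apply: circle_eq; rewrite /= mulrDl cosD sinD; congr pair; rewrite addrC [sin _ * _]mulrC.
Qed.

Lemma angle0 : angle 0 = circle_one.
Proof. by apply: circle_eq; rewrite /= mul0r cos0 sin0. Qed.

Lemma angle_nat n : angle n%:R = circle_one.
Proof.
elim: n => [|n IH]; first exact: angle0.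
rewrite -addn1 natrD angleD IH circle_mul1.
by apply: circle_eq; rewrite /= mul1r cos2pi sin2pi.
Qed.

Lemma angleN t : angle (- t) = circle_inv (angle t).
Proof. by apply: circle_eq; rewrite /= mulNr cosN sinN. Qed.

Lemma angle_neq1 x : 0 < x < 1 -> angle x <> circle_one.
Proof.
move=> /andP[x0 x1] /(congr1 (fun z : circle R => (sval z).1)) /= c1.
have p0 : 0 < (pi : R) := pi_gt0 R.
(* [cos] is injective on [[0, pi]], that is up to half a turn; the other half is reflected by [x] to
   [1 - x]. *)
have aux y : 0 < y <= 1 / 2 -> cos (y * turn) = 1 -> False.
  move=> /andP[y0 y1]; rewrite -cos0 => /cos_inj.
  have yp : y * turn <= pi.
    rewrite mulrnAr -mulrnAl ger_pMl// -mulr_natr; lra.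
  have y2 : 0 < y * turn by rewrite mulr_gt0// mulrn_wgt0.
  rewrite !in_itv/= lexx (ltW y2) yp (ltW p0) => /(_ isT isT) y3.
  by rewrite y3 ltxx in y2.
have [h|h] := leP x (1 / 2); first by apply: (aux x) => //; rewrite x0.
apply: (aux (1 - x)); first by apply/andP; split; lra.
rewrite mulrBl mul1r -cosN opprB -[RHS]c1.
by rewrite -(cosD2pi (x * turn - turn)) subrK.
Qed.

Lemma angle_frac_dvdn (o l : nat) : (0 < l)%N -> angle (o%:R / l%:R) = circle_one -> (l %| o)%N.
Proof.
move=> l0; have lR : 0 < l%:R :> R by rewrite ltr0n.
have -> : o%:R / l%:R = (o %/ l)%:R + (o %% l)%:R / l%:R :> R.
  by rewrite {1}(divn_eq o l) natrD natrM mulrDl mulfK// gt_eqF.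
rewrite angleD angle_nat circle_mul1 /dvdn => H; apply/eqP; apply: contrapT => /eqP.
rewrite -lt0n => m0; apply: angle_neq1 H.
by rewrite divr_gt0 ?ltr0n//= ltr_pdivrMr// mul1r ltr_nat ltn_mod.
Qed.

Lemma angle_continuous : continuous angle.
Proof.
apply: continuous_comp_initial => t.
have ct : (fun t : R => t * turn) @ t --> t * turn by exact: (cvgM cvg_id (cvg_cst _)).
have ca : (fun t : R => cos (t * turn)) @ t --> cos (t * turn).
  exact: (@cvg_comp _ _ _ (fun t : R => t * turn) cos _ _ _ ct (@continuous_cos R _)).
have cb : (fun t : R => sin (t * turn)) @ t --> sin (t * turn).
  exact: (@cvg_comp _ _ _ (fun t : R => t * turn) sin _ _ _ ct (@continuous_sin R _)).
exact: (cvg_pair ca cb).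
Qed.

Lemma angle_surj z : exists t, angle t = z.
Proof.
have zP := circleP z; set a := (sval z).1 in zP; set b := (sval z).2 in zP.
have a1 : -1 <= a <= 1.
  rewrite -ler_norml -(@ler_pXn2r _ 2)// ?nnegrE// expr1n real_normK ?num_real//.
  by rewrite -zP lerDl sqr_ge0.
have t0 : turn != 0 by rewrite mulrn_eq0/= gt_eqF ?pi_gt0.
have sb : sin (acos a) = `|b|.
  by rewrite sin_acos// -sqrtr_sqr; congr Num.sqrt; rewrite -zP addrAC subrr add0r.
have [b0|b0] := leP 0 b.
  exists (acos a / turn); apply: circle_eq; rewrite /= divfK// acosK ?in_itv// sb ger0_norm//.
  by rewrite /a /b -surjective_pairing.
exists (- (acos a / turn)); apply: circle_eq.
rewrite /= mulNr divfK// cosN sinN acosK ?in_itv// sb ltr0_norm// opprK.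
by rewrite /a /b -surjective_pairing.
Qed.

Lemma circle_hausdorff : hausdorff_space (circle R).
Proof.
rewrite open_hausdorff => z w zw.
have h2 : hausdorff_space (R * R)%type := @norm_hausdorff _ _.
have : sval z != sval w by apply: contra zw => /eqP/circle_eq ->.
move: h2; rewrite open_hausdorff => /[apply]; case=> -[U V] /=; rewrite !inE.
move=> [Uz Vw] [oU oV UV]; exists (sval @^-1` U, sval @^-1` V); rewrite /= ?inE//; split.
- by apply: open_comp oU => ? _; exact: sval_circle_continuous.
- by apply: open_comp oV => ? _; exact: sval_circle_continuous.
- by rewrite -preimage_setI (UV : U `&` V = set0) preimage_set0.
Qed.

(** The circle has no isolated points, so a nonempty open set stays nonempty and open when one point
    is removed. *)
Lemma circle_avoid (I F : set (circle R)) : open I -> I !=set0 -> finite_set F ->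
  exists2 z, I z & ~ F z.
Proof.
move=> oI I0 /finite_seqP[s ->]; elim: s I oI I0 => [|a s IH] I oI [z Iz].
  by exists z.
have oIa : open (I `&` ~` [set a]).
  apply: openI => //; rewrite openC; apply: compact_closed; first exact: circle_hausdorff.
  exact: compact_set1.
have [] := IH _ oIa; last first.
  by move=> w [Iw wa] ws; exists w => //=; rewrite inE => /orP[/eqP|].
have [za|za] := pselect (z = a); last by exists z.
have ct : {for 0, continuous (fun t => circle_mul (angle t) z)}.
  apply: (@continuous_comp _ _ _ angle (circle_mul ^~ z)); first exact: angle_continuous.
  exact: circle_mulr_continuous.
have : nbhs (0 : R) [set t | I (circle_mul (angle t) z)].
  by apply: ct; apply: open_nbhs_nbhs; rewrite angle0 circle_mul1.
move=> /nbhs_ballP[r /= r0 rI].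
(* Small enough for the rotated point to stay in [I], and less than a full turn so that it differs
   from [a]. *)
pose t := Num.min (r / 2) (1 / 2).
have t0 : 0 < t by rewrite lt_min !divr_gt0.
have tr : t < r by rewrite gt_min ltr_pdivrMr// ltr_pMr// ltr1n.
have t1 : t < 1 by rewrite gt_min orbC ltr_pdivrMr// mul1r ltr1n.
exists (circle_mul (angle t) z); split.
  by apply: rI; rewrite -ball_normE /ball_/= sub0r normrN gtr0_norm.
rewrite /= -za => tz; apply: (@angle_neq1 t); first by rewrite t0.
by rewrite -(circle_mul1 (angle t)) circle_mulC -(circle_mulV z) circle_mulA
  [circle_mul _ (circle_inv z)]circle_mulC -circle_mulA tz.
Qed.

End Angle.
(** * Disjoint boxes meeting every circle orbit *)

Lemma hausdorffX (S T : topologicalType) :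
  hausdorff_space S -> hausdorff_space T -> hausdorff_space (S * T)%type.
Proof.
move=> hS hT [a b] [c d] H; congr pair.
  apply: hS => U V nU nV; have [] := H (U `*` setT) (V `*` setT).
  - by exists (U, setT) => //; split=> //; exact: filterT.
  - by exists (V, setT) => //; split=> //; exact: filterT.
  by move=> [x y] [[/= Ux _] [Vx _]]; exists x.
apply: hT => U V nU nV; have [] := H (setT `*` U) (setT `*` V).
- by exists (setT, U) => //; split=> //; exact: filterT.
- by exists (setT, V) => //; split=> //; exact: filterT.
by move=> [x y] [[/= _ Uy] [_ Vy]]; exists y.
Qed.

Lemma connectedX (S T : topologicalType) :
  connected [set: S] -> connected [set: T] -> connected [set: S * T].
Proof.
move=> cS cT B [[a b] Bab] [C oC BC] [C' cC BC']; rewrite !setTI in BC BC'; subst C C'.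
have Pair1 y : continuous (fun x : S => (x, y) : S * T).
  by move=> x; exact: (cvg_pair cvg_id (cvg_cst y)).
have Pair2 x : continuous (fun y : T => (x, y) : S * T).
  by move=> y; exact: (cvg_pair (cvg_cst x) cvg_id).
have BS y : (exists x, B (x, y)) -> forall x, B (x, y).
  move=> Bx x; suff : [set x | B (x, y)] = setT by move/seteqP => [_ /(_ x)]; apply.
  apply: cS => //.
  - exists ((fun x : S => (x, y) : S * T) @^-1` B); last by rewrite setTI.
    by apply: open_comp oC => ? _; exact: Pair1.
  - exists ((fun x : S => (x, y) : S * T) @^-1` B); last by rewrite setTI.
    by apply: preimage_closed cC => ? _; exact: Pair1.
have BT x : (exists y, B (x, y)) -> forall y, B (x, y).
  move=> By y; suff : [set y | B (x, y)] = setT by move/seteqP => [_ /(_ y)]; apply.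
  apply: cT => //.
  - exists ((fun y : T => (x, y) : S * T) @^-1` B); last by rewrite setTI.
    by apply: open_comp oC => ? _; exact: Pair2.
  - exists ((fun y : T => (x, y) : S * T) @^-1` B); last by rewrite setTI.
    by apply: preimage_closed cC => ? _; exact: Pair2.
apply/seteqP; split=> // -[x y] _; apply: BT; exists b; apply: BS; by exists a.
Qed.

Lemma compactXT (S T : topologicalType) :
  compact [set: S] -> compact [set: T] -> compact [set: S * T].
Proof. by move=> cS cT; rewrite -setXTT; exact: compact_setX. Qed.

Section CircleOrbits.
Context {R : realType} (n m : nat) (M Y : topologicalType) (SM : smooth_structure R n M).
Context (act : circle R -> M -> M) (beta : Y -> Y).
Hypothesis M_manifold : closed_connected_manifold R n M.
Hypothesis Y_manifold : closed_connected_manifold R m Y.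
Hypothesis act_smooth : smooth_circle_action SM act.
Hypothesis act_free : free_circle_action act.
Hypothesis beta_homeo : homeomorphism beta.

Let T : topologicalType := (M * Y)%type.

Let act1 x : act circle_one x = x. Proof. by have [] := act_smooth. Qed.

Let actM z w x : act (circle_mul z w) x = act z (act w x).
Proof. by have [] := act_smooth. Qed.

Let actK z : cancel (act z) (act (circle_inv z)).
Proof. by move=> x; rewrite -actM circle_mulV act1. Qed.

Let actVK z : cancel (act (circle_inv z)) (act z).
Proof. by move=> x; rewrite -actM circle_mulC circle_mulV act1. Qed.

Let M_hausdorff : hausdorff_space M. Proof. by have [[]] := M_manifold. Qed.

Let T_hausdorff : hausdorff_space T.
Proof. by apply: hausdorffX => //; have [[]] := Y_manifold. Qed.

Let T_compact : compact [set: T].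
Proof. by apply: compactXT; [have [] := M_manifold|have [] := Y_manifold]. Qed.

Let T_connected : connected [set: T].
Proof. by apply: connectedX; [have [] := M_manifold|have [] := Y_manifold]. Qed.

Let T_cell : locally_cellular T.
Proof.
apply: (@chart_locally_cellular R (n + m)) => // -[x y].
have [[_ _ cM] _ _] := M_manifold; have [[_ _ cY] _ _] := Y_manifold.
by have [c cx] := cM x; have [d dy] := cY y; exists (prod_chart c d).
Qed.

Lemma map_pair_homeo (X1 X2 : topologicalType) (f : X1 -> X1) (g : X2 -> X2) :
  homeomorphism f -> homeomorphism g ->
  homeomorphism (fun p : X1 * X2 => (f p.1, g p.2)).
Proof.
have cts (h : X1 -> X1) (k : X2 -> X2) : continuous h -> continuous k ->
    continuous (fun p : X1 * X2 => (h p.1, k p.2)).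
  move=> ch ck [x y].
  have c1 : (fun p : X1 * X2 => h p.1) @ (x, y) --> h x.
    by apply: (@cvg_comp _ _ _ fst h _ _ _ cvg_fst); exact: ch.
  have c2 : (fun p : X1 * X2 => k p.2) @ (x, y) --> k y.
    by apply: (@cvg_comp _ _ _ snd k _ _ _ cvg_snd); exact: ck.
  exact: (cvg_pair c1 c2).
move=> [cf [f' [cf' fK f'K]]] [cg [g' [cg' gK g'K]]]; split; first exact: cts.
exists (fun p => (f' p.1, g' p.2)); split; first exact: cts.
  by move=> [x y] /=; rewrite fK gK.
by move=> [x y] /=; rewrite f'K g'K.
Qed.

Lemma act_homeo z : homeomorphism (act z).
Proof.
split; first exact: (act_continuous act_smooth).
by exists (act (circle_inv z)); split=> //; exact: (act_continuous act_smooth).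
Qed.

Definition rot (t : R) (p : T) : T := (act (angle t) p.1, beta p.2).

Lemma rot_homeo t : homeomorphism (rot t).
Proof. by apply: map_pair_homeo => //; exact: act_homeo. Qed.

Lemma iter_rot t i p : iter i (rot t) p = (act (angle (i%:R * t)) p.1, iter i beta p.2).
Proof.
elim: i => [|i IH] /=; first by rewrite mul0r angle0 act1 -surjective_pairing.
by rewrite IH /rot /= -actM -angleD -addn1 natrD mulrDl mul1r addrC.
Qed.

Section Period.
Context (t : R) (q : nat).
Hypothesis q_gt0 : (0 < q)%N.
Hypothesis qt : angle (q%:R * t) = circle_one.
Hypothesis betaq : forall y, iter q beta y = y.
Hypothesis free_t : forall i, (0 < i < q)%N -> angle (i%:R * t) <> circle_one.

Let A := rot t.

Let Aq p : iter q A p = p.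
Proof. by rewrite iter_rot qt act1 betaq -surjective_pairing. Qed.

Let A_free i p : (0 < i < q)%N -> iter i A p <> p.
Proof.
move=> /free_t H e; apply: H; apply: (@act_free _ p.1).
by move: e; rewrite iter_rot => /(congr1 fst).
Qed.

(** Thinness ensures that a new tile finds a free height: only finitely many positions on each
    circle orbit are occupied. *)
Definition thin (C : set T) := forall x y, finite_set [set z | C (act z x, y)].

Lemma thin_saturation C : thin C -> thin (saturation A C).
Proof.
move=> tC x y.
apply: (@sub_finite_set _ _ (\bigcup_(i in [set i | (i < q)%N])
    (circle_mul (angle (i%:R * t)) @^-1` [set z | C (act z x, iter i beta y)]))).
  move=> z [i]; rewrite -(iter_modn Aq) iter_rot /= => Ci.
  by exists (i %% q)%N; rewrite /= ?ltn_mod// actM.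
apply: bigcup_finite; first exact: finite_II.
move=> i _; apply: finite_preimage; last exact: tC.
move=> z w _ _ /= /(congr1 (circle_mul (circle_inv (angle (i%:R * t))))).
by rewrite !circle_mulA circle_mulV !circle_mul1.
Qed.

Definition good (C : set T) := [/\ closed C, engulfable A C & thin C].

Definition extendable (U : set T) := forall C, good C ->
  exists C', [/\ good C', C `<=` C' & forall p, U p -> exists z, C' (act z p.1, p.2)].

Let actC z w x : act z (act w x) = act w (act z x).
Proof. by rewrite -!actM circle_mulC. Qed.

(** The height [z] of a point [act z x] over the slice is thus well defined, and disjointness of
    tiles can be checked by comparing heights. *)
Lemma slice_inj D D' : slice n act D D' ->
  forall z w x y, D' x -> D' y -> act z x = act w y -> z = w.
Proof.
move=> [_ inj _] z w x y Dx Dy e.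
have e' : act (circle_mul (circle_inv w) z) x = y by rewrite actM e actK.
have e1 : circle_mul (circle_inv w) z = circle_one by apply: (inj x) => //; rewrite e'.
by rewrite -(circle_mul1 z) -(circle_mulV w) [circle_mul _ w]circle_mulC -circle_mulA e1
  circle_mulC circle_mul1.
Qed.

Definition heights (D' : set M) (S : set (circle R)) : set T :=
  [set p | exists z x, [/\ S z, D' x & p.1 = act z x]].

Lemma thin_heights D D' S : slice n act D D' -> finite_set S -> thin (heights D' S).
Proof.
move=> sD fS x y.
apply: (@sub_finite_set _ _ (\bigcup_(z in S) [set w | exists2 d, D' d & act w x = act z d])).
  by move=> w [z [d [Sz Dd /= e]]]; exists z => //; exists d.
apply: bigcup_finite => // z _; set H := [set w | _].
have H1 : is_subset1 H.
  move=> w w' [d Dd e] [d' Dd' e'].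
  have : act w d' = act w' d.
    by apply: (can_inj (actK z)); rewrite actC -e' actC e actC.
  by move/esym/(slice_inj sD Dd Dd').
have [->|/set0P[w Hw]] := eqVneq H set0; first exact: finite_set0.
have -> : H = [set w] by apply/seteqP; split=> [w' Hw'|_ ->//]; exact: H1.
exact: finite_set1.
Qed.

Lemma thin_sub C C' : C `<=` C' -> thin C' -> thin C.
Proof. by move=> CC' tC x y; apply: sub_finite_set (tC x y) => z /CC'. Qed.

Lemma thinU C C' : thin C -> thin C' -> thin (C `|` C').
Proof.
move=> tC tC' x y.
apply: (@sub_finite_set _ _ ([set z | C (act z x, y)] `|` [set z | C' (act z x, y)])) => //.
by rewrite finite_setU.
Qed.

Lemma act_box_cellular z (E : set M) (B : set Y) e b :
  boxlike (R := R) n E e -> boxlike (R := R) m B b ->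
  let X := (fun p : T => (act z p.1, p.2)) @` (E `*` B) in
  cellular X (act z e, b) /\ closed X.
Proof.
move=> hE hB X; have hz : homeomorphism (fun p : T => (act z p.1, p.2)).
  exact: map_pair_homeo (act_homeo z) (homeo_id Y).
have hEB := boxlikeX hE hB; split.
  exact: (cellular_homeo hz (boxlike_cellular T_hausdorff hEB)).
apply: compact_closed => //; apply: continuous_compact.
  exact/continuous_subspaceT/hz.1.
exact: boxlike_compact hEB.
Qed.

(** Each tile is a small box of the slice times [Y], lifted to a height [z]. This height is taken in
    a window [I] where the tile avoids the orbits of [C0], and away from the finitely many values
    that some iterate of [A] would bring to a height already in use. Distinct heights separate the
    tile from the earlier ones, and exactness of the period separates it from its own translates. *)
Lemma extendable_slice D D' : slice n act D D' -> extendable (D `*` setT).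
Proof.
move=> sD C0 [cC0 eC0 tC0].
have [cD _ tiles] := sD.
(* The windows of admissible heights depend on C0 only; the boxes added since C0
   exclude finitely many more heights. *)
pose ok C := [/\ closed C, engulfable A C, C0 `<=` C & exists2 S, finite_set S &
  C `<=` C0 `|` heights D' S].
pose P (U : set T) := forall C, ok C -> exists C', [/\ ok C', C `<=` C'
  & forall p, U p -> D p.1 -> exists z, C' (act z p.1, p.2)].
suff HP : P (D `*` setT).
  have [|C [[cC eC C0C [S fS CS]] _ HC]] := HP C0.
    split=> //; exists set0; first exact: finite_set0.
    by move=> p; left.
  exists C; split=> //; last by move=> p Up; apply: HC => //; case: Up.
  split=> //; apply: thin_sub CS _; apply: thinU => //; exact: thin_heights sD fS.
apply: compact_induction.
- by apply: compact_setX => //; have [] := Y_manifold.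
- by move=> C okC; exists C; split.
- move=> U V PU PV C okC; have [C1 [ok1 CC1 H1]] := PU C okC.
  have [C2 [ok2 C12 H2]] := PV C1 ok1; exists C2; split=> //.
    exact: subset_trans CC1 C12.
  move=> p [Up|Vp] Dp; last exact: H2.
  by have [z Hz] := H1 p Up Dp; exists z; exact: C12.
- move=> U V UV PV C okC; have [C1 [ok1 CC1 H1]] := PV C okC; exists C1; split=> //.
  by move=> p /UV; exact: H1.
move=> [x y] [/= Dx _].
have csat : closed (saturation A C0).
  exact (saturation_closed (rot_homeo t) q_gt0 Aq cC0).
(* The saturation of [C0] is thin, so some height over [(x, y)] is free; as the saturation is
   closed, nearby heights over nearby points are free too. *)
have [z0 _ nz0] : exists2 z0, setT z0 & ~ [set z | saturation A C0 (act z x, y)] z0.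
  apply: circle_avoid; [exact: openT|by exists circle_one|].
  exact: thin_saturation.
have [I [V1 [V2 [oI oV1 oV2 [Iz0 V1x V2y IV]]]]] : exists I V1 V2,
    [/\ open I, open V1, open V2 & [/\ I z0, V1 x, V2 y & forall z x' y', I z -> V1 x' ->
      V2 y' -> ~ saturation A C0 (act z x', y')]].
  have : nbhs (act z0 x, y) (~` saturation A C0).
    by apply: open_nbhs_nbhs; split=> //; rewrite openC.
  move=> [[W V] /= [+ +] WV]; rewrite !nbhsE => -[W' [oW' W'x] W'W] [V' [oV' V'y] V'V].
  have [I [V1 [oI oV1 Iz V1x IV]]] := act_nbhs act_smooth oW' W'x.
  exists I, V1, V'; split=> //; split=> // z x' y' Iz' Vx' Vy'.
  by apply: (WV (_, _)); split=> /=; [apply/W'W/IV|exact: V'V].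
have [E [e [V [hE EDV oV Vx DVE]]]] := tiles x V1 Dx oV1 V1x.
have [B [hB BV2 nB]] : exists B, [/\ boxlike (R := R) m B y, B `<=` V2 & nbhs y B].
  have [[_ _ cY] _ _] := Y_manifold; have [c cy] := cY y.
  exact: boxlike_nbhd cy oV2 V2y.
exists (V `*` B).
  by exists (V, B) => //; split=> //; apply: open_nbhs_nbhs.
move=> C [cC eC C0C [S fS CS]].
pose rho i := angle (i%:R * t).
have [z Iz nz] : exists2 z, I z & ~ (\bigcup_(i in [set i | (i < q)%N])
    (circle_mul (rho i) @^-1` S)) z.
  apply: circle_avoid => //; first by exists z0.
  apply: bigcup_finite; first exact: finite_II.
  move=> i _; apply: finite_preimage => // w w' _ _ /=.
  move/(congr1 (circle_mul (circle_inv (rho i)))).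
  by rewrite !circle_mulA circle_mulV !circle_mul1.
have [cellX cX] := act_box_cellular z hE hB.
set X := _ @` _ in cellX cX.
have XE p : X p -> exists x' y', [/\ E x', B y', D' x' & p = (act z x', y')].
  move=> [[x' y'] [/= Ex By] <-]; exists x', y'; split=> //.
  by have [] := EDV _ Ex.
exists (C `|` X); split.
- split.
  + exact: closedU.
  + apply: (engulfableU T_hausdorff T_compact T_connected T_cell (rot_homeo t) q_gt0 Aq
      A_free cC eC cellX cX).
      move=> i p iq /XE[x1 [y1 [_ _ Dx1 ->]]] /XE[x2 [y2 [_ _ Dx2]]].
      rewrite iter_rot /= => -[e1 _]; apply: (free_t iq).
      rewrite -actM in e1; have := slice_inj sD Dx1 Dx2 e1.
      move/(congr1 (circle_mul (circle_inv z))).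
      by rewrite circle_mulC -circle_mulA [circle_mul z _]circle_mulC circle_mulV
        circle_mulC circle_mul1.
    move=> p /XE[x1 [y1 [Ex1 By1 Dx1 ->]]] [i].
    rewrite -(iter_modn Aq); have : (i %% q < q)%N by rewrite ltn_mod.
    move: (i %% q)%N => {}i iq /CS[C0i|].
      apply: (IV z x1 y1) => //; [by have [] := EDV _ Ex1|exact: BV2|].
      by exists i.
    rewrite iter_rot => -[w [d [Sw Dd /=]]]; rewrite -actM => /(slice_inj sD Dx1 Dd) e1.
    by apply: nz; exists i => //=; rewrite /rho e1.
  + by move=> p C0p; left; exact: C0C.
  + exists (S `|` [set z]); first by rewrite finite_setU; split=> //; exact: finite_set1.
    move=> p [/CS[|[w [d [Sw Dd ep]]]]|/XE[x1 [y1 [_ _ Dx1 ->]]]]; first by left.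
      by right; exists w, d; split=> //; left.
    by right; exists z, x1; split=> //; right.
- by move=> p; left.
- move=> [x1 y1] [/= Vx1 By1] Dx1; exists z; right; exists (x1, y1) => //; split=> //=.
  exact: DVE.
Qed.

(** All orbits near a given point cross one slice, and finitely many slices suffice by compactness
    of [M]. *)
Lemma exists_engulfable_transversal : exists C, [/\ closed C, engulfable A C
  & forall p : T, exists z, C (act z p.1, p.2)].
Proof.
suff H : forall C, good C -> exists C', [/\ good C', C `<=` C'
    & forall p : T, setT p.1 -> exists z, C' (act z p.1, p.2)].
  have [|C [[cC eC _] _ HC]] := H set0.
    split; [exact: closed0|exact: engulfable0|].
    by move=> x y; apply: sub_finite_set (@finite_set0 _) => z.
  by exists C; split=> // p; exact: HC.
move: [set: M] (let: And3 _ cM _ := M_manifold in cM) => K cK.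
pose P (U : set M) := extendable [set p | U p.1].
suff : P K by [].
apply: (compact_induction cK).
- by move=> C gC; exists C; split.
- move=> U V PU PV C gC; have [C1 [g1 CC1 H1]] := PU C gC.
  have [C2 [g2 C12 H2]] := PV C1 g1; exists C2; split=> //.
    exact: subset_trans CC1 C12.
  move=> p [Up|Vp]; last exact: H2.
  by have [z Hz] := H1 p Up; exists z; exact: C12.
- move=> U V UV PV C gC; have [C1 [g1 CC1 H1]] := PV C gC; exists C1; split=> //.
  by move=> p /UV; exact: H1.
- move=> x _; have [D [D' [sD [U nU UD]]]] := slice_through_orbit M_hausdorff act_smooth act_free x.
  exists U => // C gC; have [C' [g' CC' H]] := extendable_slice sD gC.
  exists C'; split=> // p Up; have [z Dz] := UD _ Up.
  have [w /=] := H (act z p.1, p.2) (conj Dz I).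
  by rewrite -actM; exists (circle_mul w z).
Qed.

(** Engulfing asks for an invariant target, so the transversal is pushed into the saturation of [V];
    the iterate [i] accounts for the difference. *)
Lemma spreading_conjugator (V : set T) : open V -> V !=set0 -> exists h : T -> T,
  [/\ homeomorphism h, forall p, h (A p) = A (h p)
    & forall p, exists z i, V (h (iter i A (act z p.1, p.2)))].
Proof.
move=> oV [v Vv]; have [C [cC eC HC]] := exists_engulfable_transversal.
have sV0 : saturation A V !=set0 by exists v; exact: saturation_sub.
have [h [hh hA hC]] := eC _ (saturation_open (rot_homeo t) oV) sV0 (saturationA q_gt0 Aq V).
exists h; split=> // p; have [z /hC[i Vi]] := HC p.
by exists z, i; rewrite (iter_comm i _ hA).
Qed.

End Period.
End CircleOrbits.
(** * Metrics and uniform limits *)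

Lemma second_countableX (S T : topologicalType) :
  @second_countable S -> @second_countable T -> @second_countable (S * T)%type.
Proof.
move=> [B cB [oB nB]] [C cC [oC nC]].
exists ((fun UV => UV.1 `*` UV.2) @` (B `*` C)).
  exact: card_le_trans (card_image_le _ _) (countableX cB cC).
split=> [_ [[U V] [/= BU CV] <-]|[x y] W [[U V] /= [nU nV] UVW]].
  rewrite openE => -[x y] [/= Ux Vy]; exists (U, V) => //.
  by split; apply: open_nbhs_nbhs; split=> //; [exact: oB|exact: oC].
have [U' [BU' U'x] U'U] := nB x _ nU; have [V' [CV' V'y] V'V] := nC y _ nV.
exists (U' `*` V'); first by split=> //; exists (U', V').
by move=> [a b] [/= Ua Vb]; apply: UVW; split=> /=; [exact: U'U|exact: V'V].
Qed.

Lemma second_countable_enum (T : topologicalType) : @second_countable T ->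
  exists V : nat -> set T, (forall n, open (V n)) /\
    forall x W, open W -> W x -> exists n, V n x /\ V n `<=` W.
Proof.
move=> [B /countable_injP[f finj] [oB nB]].
(* [f] injects the basis into the natural numbers; indices outside its range receive the open set
   [setT]. *)
pose V n : set T := xget setT [set U | B U /\ f U = n].
exists V; split=> [n|x W oW Wx].
  by rewrite /V; case: xgetP => [U -> [BU _]|_]; [exact: oB|exact: openT].
have [U [BU Ux] UW] := nB x W (open_nbhs_nbhs (conj oW Wx)).
exists (f U); suff -> : V (f U) = U by [].
rewrite /V; case: xgetP => [U' -> [BU' /finj]|/(_ U)]; last by case.
by rewrite !inE; apply.
Qed.

Section Metric.
Context {R : realType}.

(** Continuity of [d] is enough on a compact space: it forces [d] to induce the topology, see
    [metric_nbhs]. *)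
Definition compatible_metric (T : topologicalType) (d : T -> T -> R) :=
  [/\ continuous (fun p : T * T => d p.1 p.2), forall x y, d x y = 0 <-> x = y,
    forall x y, d x y = d y x & forall x y z, d x z <= d x y + d y z].

(** Each point has a neighbourhood whose points are separated from all others by a continuous
    pseudometric; finitely many of these are added up. The local one compares a bump [b] and the
    product [e] of [b] with the chart map: if [b x > 0], equality of [b] puts both points in the
    chart, and equality of [e] then gives equal coordinates. *)
Lemma compact_manifold_metric n (T : topologicalType) : hausdorff_space T ->
  compact [set: T] -> (forall x : T, exists c : chart R n T, chart_dom c x) ->
  exists d, @compatible_metric T d.
Proof.
move=> hT cT charts.
pose P (U : set T) := exists d : T -> T -> R,
  [/\ continuous (fun p : T * T => d p.1 p.2), forall x, d x x = 0, forall x y, 0 <= d x y,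
    forall x y, d x y = d y x & forall x y z, d x z <= d x y + d y z] /\
  forall x y, U x -> d x y = 0 -> x = y.
suff [d [[cd d0 dge ds dt] sep]] : P setT.
  by exists d; split=> // x y; split=> [|->//]; exact: sep.
apply: (compact_induction cT).
- exists (fun _ _ => 0); split; last by [].
  by split=> // p; exact: cvg_cst.
- move=> U V [d [[cd d0 dge ds dt] sep]] [e [[ce e0 ege es et] seq]].
  exists (fun x y => d x y + e x y); split; first split.
  + by move=> p; exact: (cvgD (@cd p) (@ce p)).
  + by move=> x; rewrite d0 e0 addr0.
  + by move=> x y; rewrite addr_ge0.
  + by move=> x y; rewrite ds es.
  + by move=> x y z; rewrite addrACA lerD.
  + move=> x y UVx /eqP; rewrite paddr_eq0// => /andP[/eqP dxy /eqP exy].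
    by case: UVx => [Ux|Vx]; [exact: sep dxy|exact: seq exy].
- by move=> U V UV [d [Hd sep]]; exists d; split=> // x y /UV; exact: sep.
move=> z _; have [c cz] := charts z.
have [r r0 Hr] := small_boxes cz openT I.
have [|j|Bsub _ _] := Hr (chart_map c z) (const_mx r).
- exact: ballxx.
- by rewrite mxE lexx ltW.
pose K := chart_inv c @` box (chart_map c z) (const_mx r).
have cK : closed K.
  apply: compact_closed => //; apply: chart_inv_box_compact => u /Bsub[x [cx _] <-].
  by exists x.
have Kdom : K `<=` chart_dom c by move=> _ [u /Bsub/chart_invE[? _ _] <-].
(* A tent function that vanishes in the chart outside the box [K], hence extends by zero. *)
pose b0 x := Num.max 0 (r - `|chart_map c x - chart_map c z|).
have b0_out x : chart_dom c x -> ~ K x -> b0 x = 0.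
  move=> cx nKx; rewrite /b0; apply/max_idPl; rewrite subr_le0.
  have [h|h] := leP `|chart_map c x - chart_map c z| r; last exact: ltW.
  case: nKx; exists (chart_map c x); last by rewrite chart_mapK.
  by move=> j; move: h => /(row_norm_le _ (ltW r0))/(_ j); rewrite !mxE.
have b0_cts x : chart_dom c x -> {for x, continuous b0}.
  move=> cx; have cm := chart_map_continuous cx.
  have cn : (fun x => `|chart_map c x - chart_map c z|) @ x -->
      `|chart_map c x - chart_map c z|.
    apply: (@cvg_norm _ _ _ (nbhs x) _ (fun x => chart_map c x - chart_map c z)).
    exact: (cvgB cm (cvg_cst (chart_map c z))).
  have cr : {for x, continuous (fun x => r - `|chart_map c x - chart_map c z|)}.
    exact: (cvgB (cvg_cst r) cn).
  exact: (@continuous_max R _ (cst 0) _ x (@cst_continuous _ R^o 0 x) cr).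
pose b := patch (fun=> 0) (chart_dom c) b0.
pose e := patch (fun=> 0) (chart_dom c) (fun x => b0 x *: chart_map c x).
have cb : continuous b.
  apply: (glue_continuous (chart_dom_open c) cK Kdom) => //.
  by move=> x _; exact: cst_continuous.
have ce : continuous e.
  apply: (glue_continuous (chart_dom_open c) cK Kdom).
  - by move=> x cx; exact: (cvgZ (@b0_cts x cx) (chart_map_continuous cx)).
  - by move=> x _; exact: cst_continuous.
  - by move=> x cx nKx; rewrite b0_out// scale0r.
have bE x : chart_dom c x -> b x = b0 x by move=> cx; rewrite /b patchT// inE.
have eE x : chart_dom c x -> e x = b0 x *: chart_map c x.
  by move=> cx; rewrite /e patchT// inE.
exists [set x | 0 < b x].
  have : nbhs (b z) [set y : R | 0 < y].
    apply: lt_nbhsr; rewrite bE// /b0 subrr normr0 subr0 lt_max r0 orbT //.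
  exact: cb.
exists (fun x y => `|b x - b y| + `|e x - e y|); split; first split.
- move=> [x y].
  have c1 : (fun p : T * T => b p.1) @ (x, y) --> b x.
    by apply: (@cvg_comp _ _ _ fst b _ _ _ cvg_fst); exact: cb.
  have c2 : (fun p : T * T => b p.2) @ (x, y) --> b y.
    by apply: (@cvg_comp _ _ _ snd b _ _ _ cvg_snd); exact: cb.
  have c3 : (fun p : T * T => e p.1) @ (x, y) --> e x.
    by apply: (@cvg_comp _ _ _ fst e _ _ _ cvg_fst); exact: ce.
  have c4 : (fun p : T * T => e p.2) @ (x, y) --> e y.
    by apply: (@cvg_comp _ _ _ snd e _ _ _ cvg_snd); exact: ce.
  have n1 : (fun p : T * T => `|b p.1 - b p.2|) @ (x, y) --> `|b x - b y|.
    by apply: (@cvg_norm _ _ _ (nbhs (x, y)) _ (fun p => b p.1 - b p.2)); exact: (cvgB c1 c2).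
  have n2 : (fun p : T * T => `|e p.1 - e p.2|) @ (x, y) --> `|e x - e y|.
    by apply: (@cvg_norm _ _ _ (nbhs (x, y)) _ (fun p => e p.1 - e p.2)); exact: (cvgB c3 c4).
  exact: (cvgD n1 n2).
- by move=> x; rewrite !subrr !normr0 addr0.
- by move=> x y; rewrite addr_ge0.
- by move=> x y; rewrite distrC [`|e x - _|]distrC.
- move=> x y w; rewrite addrACA lerD//.
    by rewrite -(subrKA (b y)) ler_normD.
  by rewrite -(subrKA (e y)) ler_normD.
move=> x y /= bx0 /eqP; rewrite paddr_eq0// !normr_eq0 !subr_eq0 => /andP[/eqP bxy /eqP exy].
have cx : chart_dom c x.
  by apply: contrapT => ncx; move: bx0; rewrite /b /patch memNset// ltxx.
have cy : chart_dom c y.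
  by apply: contrapT => ncy; move: bx0; rewrite bxy /b /patch memNset// ltxx.
move: bx0 bxy exy; rewrite !bE// !eE// => bx0 <- /(scalerI (lt0r_neq0 bx0)).
by move/(congr1 (chart_inv c)); rewrite !chart_mapK.
Qed.

Section MetricTheory.
Context (T : topologicalType) (d : T -> T -> R).
Hypothesis T_compact : compact [set: T].
Hypothesis dP : compatible_metric d.

Let d_cts : continuous (fun p : T * T => d p.1 p.2). Proof. by case: dP. Qed.
Let d0 x y : d x y = 0 <-> x = y. Proof. by case: dP. Qed.
Let dC x y : d x y = d y x. Proof. by case: dP. Qed.
Let dD x y z : d x z <= d x y + d y z. Proof. by case: dP. Qed.

Lemma metric_refl x : d x x = 0. Proof. by rewrite d0. Qed.

Lemma metric_ge0 x y : 0 <= d x y.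
Proof.
by have := dD x y x; rewrite metric_refl (dC y x); lra.
Qed.

Lemma metric_cvg (U : topologicalType) (f g : U -> T) u :
  {for u, continuous f} -> {for u, continuous g} ->
  {for u, continuous (fun u => d (f u) (g u))}.
Proof.
move=> cf cg; apply: (@continuous_comp _ _ _ (fun u => (f u, g u)) (fun p => d p.1 p.2)).
  exact: (cvg_pair cf cg).
exact: d_cts.
Qed.

Lemma metric_near (U : topologicalType) (f g : U -> T) u (P : set R) :
  {for u, continuous f} -> {for u, continuous g} -> open P -> P (d (f u) (g u)) ->
  \forall v \near u, P (d (f v) (g v)).
Proof.
by move=> cf cg oP Pu; exact: (metric_cvg cf cg (open_nbhs_nbhs (conj oP Pu))).
Qed.

Lemma metric_lt_near (U : topologicalType) (f g : U -> T) u (e : R) :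
  {for u, continuous f} -> {for u, continuous g} -> d (f u) (g u) < e ->
  \forall v \near u, d (f v) (g v) < e.
Proof. by move=> cf cg; exact: (metric_near cf cg (@open_lt _ e)). Qed.

Lemma metric_ball_open x e : open [set y | d x y < e].
Proof.
rewrite openE => y lt_e.
by apply: (@metric_lt_near _ (cst x) id); [exact: cst_continuous|exact: cvg_id|].
Qed.

(** The complement of an open neighbourhood is compact and [d x] is positive on it, so it is bounded
    below there by some [e > 0]. *)
Lemma metric_nbhs x W : nbhs x W -> exists2 e, 0 < e & forall y, d x y < e -> W y.
Proof.
rewrite nbhsE => -[W' [oW' W'x] W'W].
have /compact_near_coveringP cK : compact (~` W').
  by apply: subclosed_compact T_compact _ => //; exact: open_closedC.
have H : \forall e \near (0 : R)^'+, ~` W' `<=` [set y | e <= d x y].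
  apply: cK => y nWy.
  have dxy : 0 < d x y.
    rewrite lt_neqAle metric_ge0 andbT eq_sym; apply/eqP => /d0 xy.
    by apply: nWy; rewrite -xy.
  have n1 : \forall y' \near y, d x y / 2 < d x y'.
    apply: (@metric_near _ (cst x) id y [set r | d x y / 2 < r]).
    - exact: cst_continuous.
    - exact: cvg_id.
    - exact: open_gt.
    by rewrite /= ltr_pdivrMr// ltr_pMr// ltr1n.
  have n2 : \forall e \near (0 : R)^'+, e < d x y / 2.
    by apply: nbhs_right_lt; rewrite divr_gt0.
  exists ([set y' | d x y / 2 < d x y'], [set e | e < d x y / 2]) => //.
  by move=> [y' e] /= [h1 h2]; apply/ltW/(lt_trans h2).
near (0 : R)^'+ => e; exists e; first by near: e; exact: nbhs_right_gt.
have He : ~` W' `<=` [set y | e <= d x y] by near: e.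
move=> y xy; apply: W'W; apply: contrapT => /He /=; rewrite leNgt xy //.
Unshelve. all: by end_near. Qed.

Lemma uniformly_continuous (f : T -> T) (e : R) : continuous f -> 0 < e ->
  exists2 k, 0 < k & forall x y, d x y < k -> d (f x) (f y) < e.
Proof.
move=> cf e0.
have /compact_near_coveringP cT := compactXT T_compact T_compact.
have cf1 (p : T * T) : {for p, continuous (fun p : T * T => f p.1)}.
  by case: p => x y; apply: (@cvg_comp _ _ _ fst f _ _ _ cvg_fst); exact: cf.
have cf2 (p : T * T) : {for p, continuous (fun p : T * T => f p.2)}.
  by case: p => x y; apply: (@cvg_comp _ _ _ snd f _ _ _ cvg_snd); exact: cf.
have H : \forall k \near (0 : R)^'+,
    [set: T * T] `<=` [set p | d p.1 p.2 < k -> d (f p.1) (f p.2) < e].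
  (* On the diagonal the conclusion holds nearby; off the diagonal the premise fails nearby for
     small [k]. *)
  apply: cT => -[x y] _; have [xy|xy] := pselect (x = y).
    exists ([set p : T * T | d (f p.1) (f p.2) < e], setT) => /=.
      split; last exact: filterT.
      apply: (metric_lt_near (cf1 _) (cf2 _)); rewrite /= xy metric_refl //.
    by move=> [p k] /= [+ _].
  have dxy : 0 < d x y.
    by rewrite lt_neqAle metric_ge0 andbT eq_sym; apply/eqP => /d0.
  have n1 : \forall p \near (x, y), d x y / 2 < d p.1 p.2.
    apply: (@metric_near _ fst snd (x, y) [set r | d x y / 2 < r]).
    - exact: cvg_fst.
    - exact: cvg_snd.
    - exact: open_gt.
    by rewrite /= ltr_pdivrMr// ltr_pMr// ltr1n.
  have n2 : \forall k \near (0 : R)^'+, k < d x y / 2.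
    by apply: nbhs_right_lt; rewrite divr_gt0.
  exists ([set p | d x y / 2 < d p.1 p.2], [set k | k < d x y / 2]) => //.
  by move=> [p k] /= [h1 h2] h3; have := lt_trans h3 (lt_trans h2 h1); rewrite ltxx.
near (0 : R)^'+ => k; exists k; first by near: k; exact: nbhs_right_gt.
have Hk : [set: T * T] `<=` [set p | d p.1 p.2 < k -> d (f p.1) (f p.2) < e] by near: k.
by move=> x y; exact: (Hk (x, y) I).
Unshelve. all: by end_near. Qed.

(** Serves to preserve, under perturbation of the map, the visits made within one period. *)
Lemma iter_close (f : T -> T) N (e : R) : continuous f -> 0 < e ->
  exists2 k, 0 < k & forall g : T -> T, (forall x, d (f x) (g x) < k) ->
    forall i x, (i <= N)%N -> d (iter i f x) (iter i g x) < e.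
Proof.
move=> cf; elim: N e => [|N IH] e e0.
  by exists 1 => // g _ i x; rewrite leqn0 => /eqP ->; rewrite metric_refl.
have e2 : 0 < e / 2 by rewrite divr_gt0.
have [k1 k10 H1] := uniformly_continuous cf e2.
have [k2 k20 H2] := IH _ k10.
exists (Num.min k2 (e / 2)); first by rewrite lt_min k20.
move=> g fg [|i] x; first by rewrite metric_refl.
rewrite ltnS => iN; rewrite !iterS.
apply: le_lt_trans (dD _ (f (iter i g x)) _) _; rewrite [e]splitr ltrD//.
  apply: H1; apply: H2 => // y; apply: lt_le_trans (fg y) _; by rewrite ge_min lexx.
by apply: lt_le_trans (fg _) _; rewrite ge_min lexx orbT.
Qed.

Section UniformLimit.
Context (Z : Type) (F : nat -> Z -> T) (k : nat -> R).
Hypothesis k_gt0 : forall n, 0 < k n.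
Hypothesis k_half : forall n, k n.+1 <= k n / 2.
Hypothesis F_close : forall n z, d (F n z) (F n.+1 z) <= k n.

Lemma radius_small (e : R) : 0 < e -> exists n, k n < e.
Proof.
(* Halving outweighs the growing factor because [n + 2 <= 2 * (n + 1)]; thus [k] decays at least
   like [1 / (n + 1)]. *)
move=> e0; have kn n : k n * n.+1%:R <= k 0%N.
  elim: n => [|n IH]; first by rewrite mulr1.
  apply: le_trans IH; apply: (@le_trans _ _ (k n / 2 * n.+2%:R)).
    by rewrite ler_wpM2r// ler0n.
  rewrite -mulrA ler_pM2l//; rewrite mulrC ler_pdivrMr// -natrM ler_nat.
  by rewrite muln2 -addnn -[n.+2]addn1 leq_add2l.
have k0e : 0 <= k 0%N / e by rewrite divr_ge0// ltW.
exists (Num.bound (k 0%N / e)); have := archi_boundP k0e; set N := Num.bound _ => lt_N.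
rewrite -(ltr_pM2r (x := N.+1%:R)) ?ltr0n//; apply: le_lt_trans (kn N) _.
rewrite mulrC -ltr_pdivrMr//; apply: lt_trans lt_N _.
by rewrite ltr_nat.
Qed.

(** Compactness replaces completeness: if no [y] met all the bounds, the indices up to some [N]
    would already exclude every [y], including [F N z], against the telescoped bound. The subtracted
    term in [tele] is what makes its induction close. *)
Lemma uniform_limit : exists G : Z -> T, forall n z, d (F n z) (G z) <= 2 * k n.
Proof.
have tele n i z : d (F n z) (F (n + i)%N z) <= 2 * k n - 2 * k (n + i)%N.
  elim: i => [|i IH]; first by rewrite addn0 metric_refl subrr.
  rewrite addnS; apply: le_trans (dD _ (F (n + i)%N z) _) _.
  have := F_close (n + i) z; have := k_half (n + i); lra.
suff H z : exists y, forall n, d (F n z) y <= 2 * k n by have [G HG] := choice H; exists G.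
apply: contrapT => noy.
have /compact_near_coveringP cT := T_compact.
have [|N _ HN] := cT nat \oo (fun N y => exists2 n, (n <= N)%N & 2 * k n < d (F n z) y) _.
  move=> y _; have [n lt_n] : exists n, 2 * k n < d (F n z) y.
    apply: contrapT => H; apply: noy; exists y => n; rewrite leNgt; apply/negP => lt_n.
    by apply: H; exists n.
  exists ([set y' | 2 * k n < d (F n z) y'], [set N | (n <= N)%N]) => /=.
    split; last by exists n.
    apply: (@metric_near _ (cst (F n z)) id y [set r | 2 * k n < r]).
    - exact: cst_continuous.
    - exact: cvg_id.
    - exact: open_gt.
    - exact: lt_n.
  by move=> [y' N] /= [h1 h2]; exists n.
have [n nN] := HN N (leqnn N) (F N z) I.
rewrite ltNge => /negP; apply; have := tele n (N - n)%N z; rewrite subnKC//.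
have := k_gt0 N; lra.
Qed.

End UniformLimit.

Lemma uniform_limit_continuous (Z : topologicalType) (F : nat -> Z -> T) (G : Z -> T)
    (k : nat -> R) : (forall e, 0 < e -> exists n, k n < e) ->
  (forall n, continuous (F n)) -> (forall n z, d (F n z) (G z) <= 2 * k n) -> continuous G.
Proof.
move=> ksmall cF FG z W nW; have [e e0 eW] := metric_nbhs nW.
have [n kn] : exists n, k n < e / 8 by apply: ksmall; rewrite divr_gt0.
have e2 : d (F n z) (F n z) < e / 2 by rewrite metric_refl divr_gt0.
have := @metric_lt_near _ (cst (F n z)) (F n) z _ (@cst_continuous _ _ _ z) (@cF n z) e2.
apply: filterS => z' lt_e; apply: eW.
apply: le_lt_trans (dD _ (F n z) _) _.
have h1 := FG n z; rewrite dC in h1.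
have h2 := dD (F n z) (F n z') (G z'); have h3 := FG n z'.
rewrite /= in lt_e; lra.
Qed.

End MetricTheory.
End Metric.
(** * Fast conjugation *)

Section Approximation.
Context {R : realType} (n m : nat) (M Y : topologicalType) (SM : smooth_structure R n M).
Context (act : circle R -> M -> M) (beta betaV : Y -> Y) (d : M * Y -> M * Y -> R).
Hypothesis M_manifold : closed_connected_manifold R n M.
Hypothesis Y_manifold : closed_connected_manifold R m Y.
Hypothesis act_smooth : smooth_circle_action SM act.
Hypothesis act_free : free_circle_action act.
Hypothesis beta_cts : continuous beta.
Hypothesis betaV_cts : continuous betaV.
Hypothesis betaK : cancel beta betaV.
Hypothesis betaVK : cancel betaV beta.
Hypothesis dP : compatible_metric d.

Let T : topologicalType := (M * Y)%type.

Let act1 x : act circle_one x = x. Proof. by have [] := act_smooth. Qed.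

Let actM z w x : act (circle_mul z w) x = act z (act w x).
Proof. by have [] := act_smooth. Qed.

Let actK z : cancel (act z) (act (circle_inv z)).
Proof. by move=> x; rewrite -actM circle_mulV act1. Qed.

Let actVK z : cancel (act (circle_inv z)) (act z).
Proof. by move=> x; rewrite -actM circle_mulC circle_mulV act1. Qed.

Let act_cts : continuous (fun p : circle R * M => act p.1 p.2).
Proof. by have [_ _ []] := act_smooth. Qed.

Let beta_homeo : homeomorphism beta.
Proof. by split=> //; exists betaV. Qed.

Let T_compact : compact [set: T].
Proof. by apply: compactXT; [have [] := M_manifold|have [] := Y_manifold]. Qed.

Let iter_rotE t i p : iter i (rot act beta t) p =
  (act (angle (i%:R * t)) p.1, iter i beta p.2).
Proof. by rewrite (iter_rot beta act_smooth). Qed.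

Lemma turn_continuous : continuous (fun u : R * T => (act (angle u.1) u.2.1, u.2.2) : T).
Proof.
move=> [s [x y]].
have c1 : (fun u : R * T => angle u.1) @ (s, (x, y)) --> angle s.
  by apply: (@cvg_comp _ _ _ fst angle _ _ _ cvg_fst); exact: angle_continuous.
have c2 : (fun u : R * T => u.2.1) @ (s, (x, y)) --> x.
  by apply: (@cvg_comp _ _ _ (@snd R T) fst _ _ _ cvg_snd); exact: cvg_fst.
have c3 : (fun u : R * T => u.2.2) @ (s, (x, y)) --> y.
  by apply: (@cvg_comp _ _ _ (@snd R T) snd _ _ _ cvg_snd); exact: cvg_snd.
have c4 : (fun u : R * T => act (angle u.1) u.2.1) @ (s, (x, y)) --> act (angle s) x.
  exact: (@cvg_comp _ _ _ (fun u : R * T => (angle u.1, u.2.1)) (fun p => act p.1 p.2)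
    _ _ _ (cvg_pair c1 c2) (@act_cts (angle s, x))).
exact: (cvg_pair c4 c3).
Qed.

Lemma angle_muln (i : nat) (x : R) : angle x = circle_one -> angle (i%:R * x) = circle_one.
Proof.
move=> x1; elim: i => [|i IH]; first by rewrite mul0r angle0.
by rewrite -addn1 natrD mulrDl angleD IH mul1r x1 circle_mul1.
Qed.

(** The circle action conjugated by [g], where [gV] stands for the inverse of [g]. *)
Definition flow (g gV : T -> T) (s : R) (p : T) : T :=
  g (act (angle s) (gV p).1, (gV p).2).

Definition rotV (t : R) (p : T) : T := (act (circle_inv (angle t)) p.1, betaV p.2).

(** [cnj] and [time] are the g_n and t_n of the construction. [radius] bounds how far the next stage
    may move the map and its inverse; since radii at least halve, the limit lies within
    [2 * radius]. *)
Record stage := Stage {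
  cnj : T -> T; cnjV : T -> T; time : R; period : nat; radius : R }.

Definition fwd s (p : T) : T := cnj s (rot act beta (time s) (cnjV s p)).
Definition bwd s (p : T) : T := cnj s (rotV (time s) (cnjV s p)).

Definition valid s := [/\ continuous (cnj s), continuous (cnjV s),
  cancel (cnj s) (cnjV s), cancel (cnjV s) (cnj s)
  & [/\ (0 < period s)%N, angle ((period s)%:R * time s) = circle_one,
    forall y, iter (period s) beta y = y,
    forall i, (0 < i < period s)%N -> angle (i%:R * time s) <> circle_one
    & 0 < radius s]].

Section Flow.
Context (g gV : T -> T).
Hypothesis g_cts : continuous g.
Hypothesis gV_cts : continuous gV.
Hypothesis gVK : cancel gV g.

Lemma flow_continuous : continuous (fun u : R * T => flow g gV u.1 u.2).
Proof.
move=> [s p].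
have c1 : (fun u : R * T => (u.1, gV u.2)) @ (s, p) --> (s, gV p).
  have c2 : (fun u : R * T => gV u.2) @ (s, p) --> gV p.
    by apply: (@cvg_comp _ _ _ snd gV _ _ _ cvg_snd); exact: gV_cts.
  exact: (cvg_pair cvg_fst c2).
have c3 : (fun u : R * T => (act (angle u.1) (gV u.2).1, (gV u.2).2) : T) @ (s, p) -->
    ((act (angle s) (gV p).1, (gV p).2) : T).
  exact: (@cvg_comp _ _ _ (fun u : R * T => (u.1, gV u.2))
    (fun u : R * T => (act (angle u.1) u.2.1, u.2.2) : T) _ _ _ c1 (@turn_continuous (s, gV p))).
exact: (@cvg_comp _ _ _ _ g _ _ _ c3 (@g_cts _)).
Qed.

Lemma flow0 p : flow g gV 0 p = p.
Proof. by rewrite /flow angle0 act1 -surjective_pairing gVK. Qed.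

Lemma flow_small (e : R) : 0 < e ->
  exists2 k, 0 < k & forall s p, `|s| < k -> d p (flow g gV s p) < e.
Proof.
move=> e0; have /compact_near_coveringP cT := T_compact.
have H : \forall s \near (0 : R), [set: T] `<=` [set p | d p (flow g gV s p) < e].
  apply: (cT R (nbhs 0) (fun s p => d p (flow g gV s p) < e)) => p _.
  have cflow : {for (p, 0), continuous (fun u : T * R => flow g gV u.2 u.1)}.
    apply: (@continuous_comp _ _ _ (fun u : T * R => (u.2, u.1))
      (fun u : R * T => flow g gV u.1 u.2)); last exact: flow_continuous.
    exact: (cvg_pair cvg_snd cvg_fst).
  have de : d p (flow g gV 0 p) < e by rewrite flow0 (metric_refl dP).
  exact: (@metric_lt_near R T d dP _ fst (fun u : T * R => flow g gV u.2 u.1) (p, 0) e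
    (@cvg_fst _ _ _ _ _) cflow de).
have /nbhs_ballP[k /= k0 kP] := H.
exists k => // s p sk; apply: (kP s) => //.
by rewrite -ball_normE /ball_/= sub0r normrN.
Qed.

End Flow.

Lemma rot_rotV t : cancel (rotV t) (rot act beta t).
Proof. by move=> [x y]; rewrite /rot /rotV /= actVK betaVK. Qed.

Lemma rotV_rot t : cancel (rot act beta t) (rotV t).
Proof. by move=> [x y]; rewrite /rot /rotV /= actK betaK. Qed.

Lemma rotV_continuous t : continuous (rotV t).
Proof.
apply: (map_pair_homeo (act_homeo act_smooth (circle_inv (angle t))) _).1.
by split=> //; exists beta.
Qed.

(** A hit at angle [r] persists for nearby angles and points because [W] is open, and compactness
    makes the tolerance uniform. The angle and the iterate of [beta] are kept apart so that another
    rotation can realise them. *)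
Lemma uniform_return (t : R) (W : set T) : open W ->
  (forall p, exists z i, W (iter i (rot act beta t) (act z p.1, p.2))) ->
  exists2 k, 0 < k & forall p, exists (r : R) (i : nat), forall r', `|r' - r| < k ->
    W (act (angle r') p.1, iter i beta p.2).
Proof.
move=> oW HW; have /compact_near_coveringP cT := T_compact.
have H : \forall k \near (0 : R)^'+, [set: T] `<=` [set p | exists (r : R) (i : nat),
    forall r', `|r' - r| < k -> W (act (angle r') p.1, iter i beta p.2)].
  apply: (cT R (0 : R)^'+ (fun k p => exists (r : R) (i : nat),
    forall r', `|r' - r| < k -> W (act (angle r') p.1, iter i beta p.2))) => p _.
  have [z [i]] := HW p; have [r0 <-] := angle_surj z.
  rewrite iter_rotE /= -actM -angleD; set r := _ + _ => Wp.
  have cts : {for (r, p), continuous (fun u : R * T =>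
      (act (angle u.1) u.2.1, iter i beta u.2.2) : T)}.
    apply: (@continuous_comp _ _ _ (fun u : R * T => (act (angle u.1) u.2.1, u.2.2) : T)
      (fun p : T => (p.1, iter i beta p.2))); first exact: turn_continuous.
    exact: (map_pair_homeo (homeo_id M) (homeo_iter i beta_homeo)).1.
  have := cts _ (open_nbhs_nbhs (conj oW Wp)).
  move=> [[I V] /= [/nbhs_ballP[k /= k0 kI] nV] IV].
  exists (V, [set k' | k' < k]); first by split=> //; exact: nbhs_right_lt.
  move=> [q k'] /= [Vq k'k]; exists r, i => r' rr'.
  apply: (IV (r', q)); split=> //=; apply: kI.
  by rewrite -ball_normE /ball_/= distrC; exact: lt_trans k'k.
near (0 : R)^'+ => k; exists k; first by near: k; exact: nbhs_right_gt.
move=> p; have Hk : [set: T] `<=` [set p | exists (r : R) (i : nat),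
    forall r', `|r' - r| < k -> W (act (angle r') p.1, iter i beta p.2)] by near: k.
exact: Hk.
Unshelve. all: by end_near. Qed.

(* Since q t' = 1 / (q l) modulo 1, the period of t' is a multiple of q l, hence of
   q, and then t' - t forces a multiple of q (q l). *)
Lemma finer_period (t : R) (q l : nat) : (0 < q)%N -> (0 < l)%N ->
  angle (q%:R * t) = circle_one ->
  (forall i, (0 < i < q)%N -> angle (i%:R * t) <> circle_one) ->
  let t' := t + (q * (q * l))%:R^-1 in
  angle ((q * (q * l))%:R * t') = circle_one /\
  (forall i, (0 < i < q * (q * l))%N -> angle (i%:R * t') <> circle_one).
Proof.
move=> q0 l0 qt free_t t'.
have ql0 : (0 < q * l)%N by rewrite muln_gt0 q0.
have Q0 : (q * (q * l))%:R != 0 :> R by rewrite pnatr_eq0 -lt0n muln_gt0 q0.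
have lR : l%:R != 0 :> R by rewrite pnatr_eq0 -lt0n.
have qR : q%:R != 0 :> R by rewrite pnatr_eq0 -lt0n.
split.
  rewrite /t' mulrDr mulfV// angleD mulnC natrM -mulrA angle_muln// circle_mul1.
  exact: (angle_nat 1).
move=> j /andP[j0 jQ] H.
have e1 : q%:R * (j%:R * t') = j%:R * (q%:R * t) + j%:R / (q * l)%:R.
  by rewrite /t' !natrM; field; rewrite qR lR.
have := angle_muln q H; rewrite e1 angleD angle_muln// circle_mul1.
move=> /(angle_frac_dvdn ql0) lj.
have qj : (q %| j)%N by apply: dvdn_trans lj; exact: dvdn_mulr.
have [b jb] := dvdnP qj.
move: H; rewrite {1}/t' mulrDr angleD {1}jb natrM -mulrA angle_muln// circle_mul1.
have QN : (0 < q * (q * l))%N by rewrite muln_gt0 q0.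
by move=> /(angle_frac_dvdn QN) /(dvdn_leq j0); rewrite leqNgt jQ.
Qed.

(** Modulo one turn [q * t'] is [1 / l], so [q] steps of the new rotation advance by [1 / l] of a
    turn on [M] and do nothing on [Y]. After [i] steps that set the [Y]-coordinate, a multiple of
    [q] further steps brings the angle within [1 / l] of [r]. *)
Lemma fine_return (t : R) (q l : nat) (W : set T) (k : R) : (0 < q)%N -> (0 < l)%N ->
  angle (q%:R * t) = circle_one -> (forall y, iter q beta y = y) -> 1 / l%:R < k ->
  (forall p, exists (r : R) (i : nat), forall r', `|r' - r| < k ->
    W (act (angle r') p.1, iter i beta p.2)) ->
  forall p, exists i, W (iter i (rot act beta (t + (q * l)%:R^-1)) p).
Proof.
move=> q0 l0 qt bq lk HW p; have [r [i Hi]] := HW p.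
set t' := t + _.
have lR : 0 < l%:R :> R by rewrite ltr0n.
have qR : q%:R != 0 :> R by rewrite pnatr_eq0 -lt0n.
(* Adding [N] full turns to the target makes the remaining angle nonnegative, so that [a], its
   integer part in units of [1 / l], is a natural number of steps. *)
pose N := Num.bound `|i%:R * t' - r|.
have Nr : 0 <= (r + N%:R - i%:R * t') * l%:R.
  rewrite mulr_ge0 ?ltW//.
  have := archi_boundP (normr_ge0 (i%:R * t' - r)); rewrite -/N.
  have := ler_norm (i%:R * t' - r); lra.
pose a := Num.trunc ((r + N%:R - i%:R * t') * l%:R).
have /andP[a1 a2] := truncn_itv Nr; rewrite -/a in a1 a2.
exists (i + q * a)%N; rewrite iter_rotE.
have -> : iter (i + q * a) beta p.2 = iter i beta p.2.
  rewrite iterD; congr iter; elim: (a) => [|b IH]; first by rewrite muln0.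
  by rewrite mulnS iterD IH bq.
have -> : (i + q * a)%:R * t' = (i%:R * t' + a%:R / l%:R - N%:R) + (a%:R * (q%:R * t) + N%:R).
  by rewrite natrD natrM /t' natrM; field; rewrite qR gt_eqF.
rewrite angleD [angle (a%:R * _ + _)]angleD angle_muln// angle_nat circle_mul1.
rewrite circle_mulC circle_mul1; apply: Hi.
apply: le_lt_trans lk.
have e : i%:R * t' + a%:R / l%:R - N%:R - r = (a%:R - (r + N%:R - i%:R * t') * l%:R) / l%:R.
  by field; rewrite gt_eqF.
rewrite e normrM [`|l%:R^-1|]gtr0_norm ?invr_gt0// ler_pM2r ?invr_gt0//.
by rewrite ler_norml; move: a2; rewrite -addn1 natrD; lra.
Qed.

(** The order of choices matters: [h] depends on the old rotation only, the moduli of continuity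
    involve [g1] but not the new angle, then the denominator is fixed, and the new radius comes
    last, from the finished map. The final clause speaks of every [f] near the new map so that it
    passes to the limit. *)
Lemma refine_stage s (V : set T) : valid s -> open V -> V !=set0 -> exists s' tau, valid s' /\
  [/\ forall p, fwd s' p = flow (cnj s') (cnjV s') tau (fwd s p),
    forall u p, 0 <= u <= 1 -> d p (flow (cnj s') (cnjV s') (u * tau) p) <= radius s,
    forall p, d (bwd s p) (bwd s' p) <= radius s,
    radius s' <= radius s / 2
  & forall f : T -> T, (forall p, d (fwd s' p) (f p) <= 2 * radius s') ->
      forall p, exists i, V (iter i f p)].
Proof.
case: s => g gV t q rad [/= g_cts gV_cts gK gVK [q0 qt bq free_t rad0]] oV [v Vv].
have [e e0 eV] := metric_nbhs T_compact dP (open_nbhs_nbhs (conj oV Vv)).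
have e2 : 0 < e / 2 by rewrite divr_gt0.
pose V0 := [set p | d v p < e / 2].
have oV0 : open V0 := metric_ball_open dP v (e / 2).
have V0v : V0 v by rewrite /V0 /= (metric_refl dP).
have [h [hh hA hV]] : exists h : T -> T, [/\ homeomorphism h,
    forall p, h (rot act beta t p) = rot act beta t (h p)
    & forall p, exists z i, (g @^-1` V0) (h (iter i (rot act beta t) (act z p.1, p.2)))].
  apply: (spreading_conjugator M_manifold Y_manifold act_smooth act_free beta_homeo
    q0 qt bq free_t).
    by apply: open_comp oV0 => ? _; exact: g_cts.
  by exists (gV v); rewrite /= gVK.
have [h' [hh' hK h'K]] := homeo_inv hh.
pose g1 := g \o h; pose g1V := h' \o gV.
have g1_cts : continuous g1 by apply: continuous_comp_all => //; exact: hh.1.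
have g1V_cts : continuous g1V by apply: continuous_comp_all => //; exact: hh'.1.
have g1K : cancel g1 g1V by move=> p; rewrite /g1 /g1V /= gK hK.
have g1VK : cancel g1V g1 by move=> p; rewrite /g1 /g1V /= h'K gVK.
have oW : open (g1 @^-1` V0) by apply: open_comp oV0 => ? _; exact: g1_cts.
have [k k0 kP] := uniform_return oW hV.
pose b (p : T) := g (rotV t (gV p)).
have b_cts : continuous b.
  apply: (@continuous_comp_all _ _ _ (rotV t \o gV) g) => //.
  by apply: continuous_comp_all => //; exact: rotV_continuous.
(* The new inverse is the old inverse [b] preceded by the flow at time [- tau], so its closeness to
   [b] rests on the uniform continuity of [b]. *)
have [e1 e10 e1P] := uniformly_continuous T_compact dP b_cts rad0.
have [k2 k20 k2P] : exists2 k2, 0 < k2 & forall s p, `|s| < k2 ->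
    d p (flow g1 g1V s p) < Num.min e1 rad.
  by apply: flow_small => //; rewrite lt_min e10.
pose kk := Num.min k k2.
have kk0 : 0 < kk by rewrite lt_min k0.
pose l := (Num.bound kk^-1).+1.
have l_lt : 1 / l%:R < kk.
  rewrite div1r -[kk]invrK ltf_pV2 ?posrE ?invr_gt0 ?ltr0n//.
  have kV : 0 <= kk^-1 by rewrite invr_ge0 ltW.
  by apply: lt_trans (archi_boundP kV) _; rewrite ltr_nat.
(* The second factor [q] gives [finer_period] its exact period; [fine_return] is applied with
   [q * l] in the role of [l]. *)
pose t1 := t + (q * (q * l))%:R^-1; pose tau : R := (q * (q * l))%:R^-1.
have l0 : (0 < l)%N by [].
have ql0 : (0 < q * l)%N by rewrite muln_gt0 q0.
have Q0 : (0 < q * (q * l))%N by rewrite muln_gt0 q0.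
have tau0 : 0 < tau by rewrite invr_gt0 ltr0n.
have tau_lt : tau < k2.
  apply: le_lt_trans (_ : _ <= 1 / l%:R) _; last first.
    by apply: lt_le_trans l_lt _; rewrite ge_min lexx orbT.
  rewrite div1r lef_pV2 ?posrE ?ltr0n// ler_nat.
  by rewrite mulnA leq_pmull// muln_gt0 q0.
have ql_lt : 1 / (q * l)%:R < k.
  apply: le_lt_trans (_ : _ <= 1 / l%:R) _; last by apply: lt_le_trans l_lt _; rewrite ge_min lexx.
  by rewrite !div1r lef_pV2 ?posrE ?ltr0n// ler_nat leq_pmull.
have [Qt1 free_t1] := finer_period q0 l0 qt free_t.
have bQ y : iter (q * (q * l)) beta y = y.
  by elim: (q * l)%N => [|i IH]; rewrite ?muln0// mulnS iterD IH bq.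
have ret := fine_return q0 ql0 qt bq ql_lt kP.
pose f1 (p : T) := g1 (rot act beta t1 (g1V p)).
have f1_cts : continuous f1.
  apply: (@continuous_comp_all _ _ _ (rot act beta t1 \o g1V) g1) => //.
  by apply: continuous_comp_all => //; exact: (rot_homeo act_smooth beta_homeo t1).1.
have f1iter i p : iter i f1 p = g1 (iter i (rot act beta t1) (g1V p)).
  by elim: i => [|i IH]; rewrite /= ?g1VK// IH /f1 g1K.
have f1Q p : iter (q * (q * l)) f1 p = p.
  by rewrite f1iter iter_rotE Qt1 act1 bQ -surjective_pairing g1VK.
have hits p : exists2 i, (i <= q * (q * l))%N & d v (iter i f1 p) < e / 2.
  have [i Vi] := ret (g1V p); exists (i %% (q * (q * l)))%N; first by rewrite ltnW// ltn_mod.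
  by rewrite (iter_modn f1Q) f1iter.
(* The visits to the half-size ball [V0] occur within one period, so [e / 2]-closeness over that
   many iterates keeps them in [V]. *)
have [k3 k30 k3P] := iter_close T_compact dP (q * (q * l)) f1_cts e2.
have h'A p : h' (rot act beta t p) = rot act beta t (h' p).
  by apply: (can_inj hK); rewrite h'K hA h'K.
have hAV p : h (rotV t p) = rotV t (h p).
  by apply: (can_inj (rotV_rot t)); rewrite -hA !rot_rotV.
have rot_add p : rot act beta t1 p = (act (angle tau) (rot act beta t p).1, (rot act beta t p).2).
  by rewrite /rot /= -actM -angleD addrC.
exists (Stage g1 g1V t1 (q * (q * l)) (Num.min (rad / 2) (k3 / 3))), tau; split.
  split=> //=; split=> //.
  by rewrite lt_min !divr_gt0.
split=> /=.
- move=> p; rewrite /fwd /= /flow rot_add /g1V /g1 /= gK h'A //.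
- move=> u p /andP[u0 u1]; apply/ltW.
  apply: lt_le_trans (k2P _ _ _) _; last by rewrite ge_min lexx orbT.
  rewrite normrM !ger0_norm ?(ltW tau0)//; apply: le_lt_trans tau_lt.
  by rewrite ler_piMl// ltW.
- move=> p.
  have bE : b (flow g1 g1V (- tau) p) = g1 (rotV t1 (g1V p)).
    rewrite /b /flow /= gK -hAV; congr (g (h (_, _))).
    by rewrite /= -actM -!angleN -angleD -opprD.
  rewrite /bwd /= -bE -[g _]/(b p).
  apply/ltW/e1P; apply: lt_le_trans (k2P _ _ _) _; last by rewrite ge_min lexx.
  by rewrite normrN gtr0_norm.
- by rewrite ge_min lexx.
- move=> f ff p; have [i iQ Vi] := hits p; exists i; apply: eV.
  have lt3 x : d (f1 x) (f x) < k3.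
    apply: le_lt_trans (ff x) _; apply: (@le_lt_trans _ _ (2 * (k3 / 3))).
      by rewrite ler_pM2l// ge_min lexx orbT.
    by lra.
  have [_ _ _ dD] := dP.
  apply: le_lt_trans (dD _ (iter i f1 p) _) _; rewrite [e]splitr ltrD//.
  exact: k3P.
Qed.

End Approximation.

(** * Passage to the limit *)

Lemma metric_small_eq (R : realType) (T : topologicalType) (d : T -> T -> R) x y :
  compatible_metric d -> (forall e, 0 < e -> d x y < e) -> x = y.
Proof.
move=> dP H; have [_ d0 _ _] := dP; apply/d0/eqP; rewrite eq_le (metric_ge0 dP) andbT.
by rewrite leNgt; apply/negP => /H; rewrite ltxx.
Qed.

(** [phi (psi p)] is close to [phi (G n p)] by uniform continuity of [phi], and the latter to
    [F n (G n p) = p] by uniform convergence. *)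
Lemma limit_cancel (R : realType) (T : topologicalType) (d : T -> T -> R)
    (F G : nat -> T -> T) (k : nat -> R) (phi psi : T -> T) :
  compact [set: T] -> compatible_metric d ->
  (forall e, 0 < e -> exists n, k n < e) ->
  (forall n, cancel (G n) (F n)) -> continuous phi ->
  (forall n p, d (F n p) (phi p) <= 2 * k n) ->
  (forall n p, d (G n p) (psi p) <= 2 * k n) -> cancel psi phi.
Proof.
move=> cT dP ksmall GF cphi Fphi Gpsi p; apply: (metric_small_eq dP) => e e0.
have e2 : 0 < e / 2 by rewrite divr_gt0.
have [r r0 rP] := uniformly_continuous cT dP cphi e2.
have [n kn] : exists n, k n < Num.min (r / 2) (e / 4).
  by apply: ksmall; rewrite lt_min !divr_gt0.
have /andP[kr ke] : (k n < r / 2) && (k n < e / 4) by rewrite -lt_min.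
have [_ _ dC dD] := dP.
apply: le_lt_trans (dD _ (phi (G n p)) _) _.
have h1 : d (phi (psi p)) (phi (G n p)) < e / 2.
  by apply: rP; rewrite dC; apply: le_lt_trans (Gpsi n p) _; lra.
have h2 := Fphi n (G n p); rewrite GF dC in h2.
lra.
Qed.

Section Construction.
Context {R : realType} (n m : nat) (M Y : topologicalType) (SM : smooth_structure R n M).
Context (act : circle R -> M -> M) (beta betaV : Y -> Y) (d : M * Y -> M * Y -> R).
Hypothesis M_manifold : closed_connected_manifold R n M.
Hypothesis Y_manifold : closed_connected_manifold R m Y.
Hypothesis act_smooth : smooth_circle_action SM act.
Hypothesis act_free : free_circle_action act.
Hypothesis beta_cts : continuous beta.
Hypothesis betaV_cts : continuous betaV.
Hypothesis betaK : cancel beta betaV.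
Hypothesis betaVK : cancel betaV beta.
Hypothesis dP : compatible_metric d.

Let T : topologicalType := (M * Y)%type.

Let act1 x : act circle_one x = x. Proof. by have [] := act_smooth. Qed.

Let beta_homeo : homeomorphism beta.
Proof. by split=> //; exists betaV. Qed.

Let T_compact : compact [set: T].
Proof. by apply: compactXT; [have [] := M_manifold|have [] := Y_manifold]. Qed.

Local Notation valid := (valid beta).
Local Notation fwd := (fwd act beta).
Local Notation bwd := (bwd act betaV).

Lemma stage_sequence (V : nat -> set T) (s0 : @stage R M Y) :
  (forall i, open (V i)) -> (forall i, V i !=set0) -> valid s0 ->
  exists (st : nat -> @stage R M Y) (tau : nat -> R), st 0%N = s0 /\ forall i, valid (st i) /\
  [/\ forall p, fwd (st i.+1) p = flow act (cnj (st i.+1)) (cnjV (st i.+1)) (tau i) (fwd (st i) p),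
    forall u p, 0 <= u <= 1 ->
      d p (flow act (cnj (st i.+1)) (cnjV (st i.+1)) (u * tau i) p) <= radius (st i),
    forall p, d (bwd (st i) p) (bwd (st i.+1) p) <= radius (st i),
    radius (st i.+1) <= radius (st i) / 2
  & forall f : T -> T, (forall p, d (fwd (st i.+1) p) (f p) <= 2 * radius (st i.+1)) ->
      forall p, exists j, V i (iter j f p)].
Proof.
move=> oV V0 v0.
(* Validity is carried in the type, so that a next stage exists for every argument and plain choice
   applies. *)
pose rel (w : nat * {s : @stage R M Y | valid s}) (st : {s : @stage R M Y | valid s} * R) :=
  let s := sval w.2 in let s' := sval st.1 in
  [/\ forall p, fwd s' p = flow act (cnj s') (cnjV s') st.2 (fwd s p),
    forall u p, 0 <= u <= 1 -> d p (flow act (cnj s') (cnjV s') (u * st.2) p) <= radius s,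
    forall p, d (bwd s p) (bwd s' p) <= radius s,
    radius s' <= radius s / 2
  & forall f : T -> T, (forall p, d (fwd s' p) (f p) <= 2 * radius s') ->
      forall p, exists j, V w.1 (iter j f p)].
have relP w : exists y, rel w y.
  case: w => i [s vs].
  have [s' [tau [vs' H]]] := refine_stage M_manifold Y_manifold act_smooth act_free beta_cts
    betaV_cts betaK betaVK dP vs (oV i) (V0 i).
  by exists (exist _ s' vs', tau).
have [nxt nxtP] := choice relP.
pose st := fix st i := if i is i'.+1 then (nxt (i', st i')).1 else exist _ s0 v0.
exists (fun i => sval (st i)), (fun i => (nxt (i, st i)).2); split=> // i; split.
  exact: (svalP (st i)).
exact: (nxtP (i, st i)).
Qed.

Lemma fwd_bwd s : valid s ->
  [/\ continuous (fwd s), continuous (bwd s), cancel (fwd s) (bwd s) & cancel (bwd s) (fwd s)].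
Proof.
move=> [g_cts gV_cts gK gVK _]; split.
- apply: (@continuous_comp_all _ _ _ (rot act beta (time s) \o cnjV s) (cnj s)) => //.
  by apply: continuous_comp_all => //; exact: (rot_homeo act_smooth beta_homeo _).1.
- apply: (@continuous_comp_all _ _ _ (rotV act betaV (time s) \o cnjV s) (cnj s)) => //.
  apply: continuous_comp_all => //.
  exact: (@rotV_continuous _ _ _ _ _ _ _ _ act_smooth beta_cts betaV_cts betaK betaVK).
- by move=> p; rewrite /bwd /fwd gK (rotV_rot act_smooth betaK) gVK.
- by move=> p; rewrite /bwd /fwd gK (rot_rotV act_smooth betaVK) gVK.
Qed.

(** Extends the homotopies to all real times, since the estimates on the flow cover the unit
    interval only. *)
Let clamp (u : R) : R := Num.max 0 (Num.min u 1).

Let clamp01 u : 0 <= clamp u <= 1.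
Proof. by rewrite /clamp le_max lexx /= ge_max ler01 ge_min lexx orbT. Qed.

Let clamp_continuous : continuous clamp.
Proof.
move=> u.
have c1 := @continuous_min R R id (cst 1) u cvg_id (@cst_continuous _ R^o 1 u).
exact: (@continuous_max R R (cst 0) _ u (@cst_continuous _ R^o 0 u) c1).
Qed.

(** A uniform limit of homeomorphisms need not be injective; the stages therefore make the inverses
    converge as well, to [psi], and [limit_cancel] is applied in both directions. *)
Lemma minimal_perturbation (V : nat -> set T) (q : nat) : (0 < q)%N ->
  (forall y, iter q beta y = y) ->
  (forall i, open (V i)) -> (forall i, V i !=set0) ->
  exists G : R * T -> T, [/\ continuous G, homeomorphism (fun p => G (1, p)),
    forall p, G (0, p) = (p.1, beta p.2)
    & forall i p, exists j, V i (iter j (fun p => G (1, p)) p)].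
Proof.
move=> q0 bq oV V0.
have qR : q%:R != 0 :> R by rewrite pnatr_eq0 -lt0n.
(* The initial angle [1 / q] gives the rotation the exact order [q]; the homotopy [H 0] turns from
   [0] to this angle. The radius [1] is arbitrary. *)
pose s0 : @stage R M Y := Stage id id q%:R^-1 q 1.
have v0 : valid s0.
  split=> //=; try by move=> p; exact: cvg_id.
  split=> //; first by rewrite mulfV//; exact: (angle_nat 1).
  move=> i /andP[i0 iq] /(angle_frac_dvdn q0)/(dvdn_leq i0).
  by rewrite leqNgt iq.
have [st [tau [st0 stP]]] := stage_sequence oV V0 v0.
pose fl i := flow act (cnj (st i.+1)) (cnjV (st i.+1)).
(* H i is a homotopy from id x beta to the i-th approximation. *)
pose H := fix H i (u : R * T) : T := if i is j.+1 then fl j (clamp u.1 * tau j) (H j u)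
  else (act (angle (clamp u.1 * q%:R^-1)) u.2.1, beta u.2.2).
pose k i := radius (st i).
have k_gt0 i : 0 < k i by have [[_ _ _ _ []]] := stP i.
have k_half i : k i.+1 <= k i / 2 by have [_ []] := stP i.
have ksmall := radius_small k_gt0 k_half.
have H_cts i : continuous (H i).
  have cc (a : R) : continuous (fun u : R * T => clamp u.1 * a).
    move=> u; have c1 : (fun u : R * T => clamp u.1) @ u --> clamp u.1.
      by apply: (@cvg_comp _ _ _ fst clamp _ _ _ _ (@clamp_continuous u.1)); exact: cvg_fst.
    exact: (cvgM c1 (cvg_cst a)).
  elim: i => [|i IH] u.
    have c2 : (fun u : R * T => (u.2.1, beta u.2.2) : T) @ u --> ((u.2.1, beta u.2.2) : T).
      apply: (@cvg_comp _ _ _ (@snd R T) (fun p : T => (p.1, beta p.2)) _ _ _ cvg_snd).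
      exact: (map_pair_homeo (homeo_id M) beta_homeo).1.
    have c3 : (fun u : R * T => (clamp u.1 * q%:R^-1, (u.2.1, beta u.2.2)) : R * T) @ u -->
        ((clamp u.1 * q%:R^-1, (u.2.1, beta u.2.2)) : R * T).
      exact: (cvg_pair (@cc q%:R^-1 u) c2).
    exact: (@cvg_comp _ _ _ _ (fun u : R * T => (act (angle u.1) u.2.1, u.2.2) : T) _ _ _
      c3 (@turn_continuous _ _ _ _ _ _ act_smooth (_, _))).
  have [[g_cts gV_cts _ _ _] _] := stP i.+1.
  have c4 : (fun u : R * T => (clamp u.1 * tau i, H i u) : R * T) @ u -->
      ((clamp u.1 * tau i, H i u) : R * T).
    exact: (cvg_pair (@cc (tau i) u) (IH u)).
  exact: (@cvg_comp _ _ _ _ (fun u : R * T => fl i u.1 u.2) _ _ _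
    c4 (@flow_continuous _ _ _ _ _ _ act_smooth _ _ g_cts gV_cts (_, _))).
have H_close i u : d (H i u) (H i.+1 u) <= k i.
  by have [_ [_ + _ _ _]] := stP i; apply; exact: clamp01.
have H1 i p : H i (1, p) = fwd (st i) p.
  have c1 : clamp 1 = 1 by rewrite /clamp minxx; apply/max_idPr.
  elim: i => [|i IH]; first by rewrite /= c1 mul1r st0.
  by rewrite /= IH c1 mul1r; have [_ [-> _ _ _ _]] := stP i.
have H0 i p : H i (0, p) = (p.1, beta p.2).
  have c0 : clamp 0 = 0 by rewrite /clamp; apply/max_idPl; rewrite ge_min lexx.
  elim: i => [|i IH]; first by rewrite /= c0 mul0r angle0 act1.
  rewrite /= IH c0 mul0r /fl (flow0 act_smooth)//.
  by have [[]] := stP i.+1.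
have [G GP] := uniform_limit T_compact dP k_gt0 k_half H_close.
have G_cts : continuous G := uniform_limit_continuous T_compact dP ksmall H_cts GP.
have [psi psiP] : exists psi : T -> T, forall i p, d (bwd (st i) p) (psi p) <= 2 * k i.
  apply: (uniform_limit T_compact dP k_gt0 k_half) => i p.
  by have [_ []] := stP i.
have psi_cts : continuous psi.
  apply: (uniform_limit_continuous T_compact dP ksmall _ psiP) => i.
  by have [vi _] := stP i; have [] := fwd_bwd vi.
pose phi p := G (1, p).
have phi_cts : continuous phi.
  move=> p; apply: (@cvg_comp _ _ _ (fun p : T => (1, p) : R * T) G _ _ _ _ (@G_cts (1, p))).
  exact: (cvg_pair (cvg_cst (1 : R)) cvg_id).
have phiP i p : d (fwd (st i) p) (phi p) <= 2 * k i by rewrite -H1; exact: GP.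
exists G; split=> //.
- split=> //; exists psi; split=> //.
  + apply: (limit_cancel T_compact dP ksmall _ psi_cts psiP phiP) => i.
    by have [vi _] := stP i; have [] := fwd_bwd vi.
  + apply: (limit_cancel T_compact dP ksmall _ phi_cts phiP psiP) => i.
    by have [vi _] := stP i; have [] := fwd_bwd vi.
- move=> p; apply: (metric_small_eq dP) => e e0.
  have [i ki] : exists i, k i < e / 2 by apply: ksmall; rewrite divr_gt0.
  have [_ _ dC _] := dP; rewrite dC -(H0 i); apply: le_lt_trans (GP i _) _; lra.
- move=> i; have [_ [_ _ _ _ hit]] := stP i; apply: hit => p; exact: phiP.
Qed.

End Construction.

Theorem theorem0p2 (R : realType) (n m : nat) (M Y : topologicalType)
    (SM : smooth_structure R n M)
    (M_closed_connected : closed_connected_manifold R n M)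
    (M_free_action : exists act : circle R -> M -> M,
       smooth_circle_action SM act /\ free_circle_action act)
    (Y_closed_connected : closed_connected_manifold R m Y)
    (beta : Y -> Y) (beta_homeo : homeomorphism beta)
    (beta_finite_order : finite_order beta) :
  exists phi : M * Y -> M * Y,
    [/\ homeomorphism phi, minimal phi
      & homotopic R phi (fun p => (p.1, beta p.2))].
Proof.
have [act [act_smooth act_free]] := M_free_action.
have [beta_cts [betaV [betaV_cts betaK betaVK]]] := beta_homeo.
have [q q0 bq] := beta_finite_order.
have [[hM sM cM] kM _] := M_closed_connected.
have [[hY sY cY] kY _] := Y_closed_connected.
pose idbeta (p : M * Y) := (p.1, beta p.2).
have hidbeta : homeomorphism idbeta := map_pair_homeo (homeo_id M) beta_homeo.
(* In an empty product minimality is vacuous; otherwise [p0] makes the whole space an admissible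
   nonempty open set. *)
have [[p0 _]|empty] := pselect (exists p : M * Y, True); last first.
  exists idbeta; split=> //; first by move=> F _ [p _]; case: empty; exists p.
  exists (fun u => idbeta u.2); split=> //; apply: continuous_subspaceT => u.
  by apply: (@cvg_comp _ _ _ snd idbeta _ _ _ cvg_snd); exact: hidbeta.1.
have [d dP] : exists d : M * Y -> M * Y -> R, compatible_metric d.
  apply: (@compact_manifold_metric R (n + m)); [exact: hausdorffX|exact: compactXT|].
  by move=> [x y]; have [c cx] := cM x; have [e ey] := cY y; exists (prod_chart c e).
have [V [oV basisV]] := second_countable_enum (second_countableX sM sY).
(* Empty basis sets cannot be visited and are replaced by the whole space. *)
pose V' i := if pselect (V i !=set0) then V i else setT.
have oV' i : open (V' i) by rewrite /V'; case: pselect => ?; [exact: oV|exact: openT].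
have V'0 i : V' i !=set0 by rewrite /V'; case: pselect => // ?; exists p0.
have [G [G_cts hphi G0 hit]] := minimal_perturbation M_closed_connected Y_closed_connected
  act_smooth act_free beta_cts betaV_cts betaK betaVK dP q0 bq oV' V'0.
exists (fun p => G (1, p)); split=> //.
  move=> F cF [y Fy] FF; apply/seteqP; split=> // x _; apply: contrapT => nFx.
  have oF : open (~` F) by rewrite openC.
  have [i [Vx VF]] := basisV x _ oF nFx.
  (* The orbit of [y] stays in [F], yet it enters a basis set contained in the complement of [F]. *)
  have [j] := hit i y; rewrite /V'; case: pselect => [? /VF|]; last by case; exists x.
  apply; elim: j => //= j Fj; rewrite -FF; by exists (iter j (fun p => G (1, p)) y).
(* Time is reversed: [G] ends at the new map, where the required homotopy starts. *)
exists (fun u => G (1 - u.1, u.2)); split.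
- apply: continuous_subspaceT => u.
  apply: (@cvg_comp _ _ _ (fun u : R * (M * Y) => (1 - u.1, u.2)) G _ _ _ _ (@G_cts _)).
  have c1 : (fun u : R * (M * Y) => 1 - u.1) @ u --> 1 - u.1.
    by apply: (cvgB (cvg_cst (1 : R))); exact: cvg_fst.
  exact: (cvg_pair c1 cvg_snd).
- by move=> p; rewrite subr0.
- by move=> p; rewrite subrr G0.
Qed.
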